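(* Consider the equation $$Y_t = \xi_{t_0} + \int_{t_0}^t \mathbf 1_{\{ \varphi(s) < y \}} \big[ \alpha_1(s)\, dB_s + \beta_1(s)\, ds \big] + \int_{t_0}^t \mathbf 1_{\{ \varphi(s) \ge y \}} \big[ \alpha_2(s)\, dB_s + \beta_2(s)\, ds \big], \quad t \in [t_0,\infty), \qquad \varphi(t) = \mathbb P(Y_t \le \bar\mu_0),$$ with data $t_0, y, \alpha_1,\alpha_2,\beta_1,\beta_2,\xi_{t_0},\bar\mu_0$ as specified in the context. If $$\tfrac14 \alpha_1(t)^2 \le \beta_1(t) \le \tfrac12 \alpha_1(t)^2,$$ $$-\tfrac12 \alpha_2(t)^2 \le \beta_2(t) \le -\tfrac14 \alpha_2(t)^2$$ hold for all $t \in [t_0,\infty)$, and in both lines at least one of the inequalities is strict uniformly in $t$ (i.e. in each line, one and the same of the two inequalities is strict for every $t\in[t_0,\infty)$), then the equation has exactly two solutions defined on $[t_0,\infty)$.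
   Context: $(\Omega, \mathcal F, \mathbb P, \mathbb F = (\mathcal F_t)_{t\in[0,\infty)})$ is a stochastic basis satisfying the usual conditions, and $B$ is a one-dimensional $\mathbb F$-Brownian motion. Data: (i) $t_0 \in [0,\infty)$ and $y \in (0,1)$; (ii) $\alpha_1,\alpha_2 : [0,\infty)\to[0,\infty)$ and $\beta_1,\beta_2 : [0,\infty)\to\mathbb R$ are continuous and bounded; (iii) $\xi_{t_0}$ is an $\mathcal F_{t_0}$-measurable random variable for which there exist parameters $(\bar\mu_0, \bar\mu_{t_0}, \bar\sigma_0^2, \bar\sigma_{t_0}^2) \in \mathbb R\times\mathbb R\times(0,\infty)\times[0,\infty)$ with $|\bar\mu_{t_0}| \le \frac12 \bar\sigma_{t_0}^2$, $\xi_{t_0} \sim \mathcal N(\bar\mu_0 + \bar\mu_{t_0}, \bar\sigma_0^2 + \bar\sigma_{t_0}^2)$ and $\mathbb P(\xi_{t_0} \le \bar\mu_0) = y$; the $\bar\mu_0$ in the equation is this parameter. A (strong) solution on $[t_0,T)$, $T\in(t_0,\infty]$, is an adapted process $(Y_t)_{t\in[t_0,T)}$ with continuous sample paths such that, with $\varphi(t) = \mathbb P(Y_t\le\bar\mu_0)$, the equation holds for all $t\in[t_0,T)$ $\mathbb P$-almost surely, and for all $S \in (t_0,T)$ the integral over $[t_0,S]$ of $\mathbf 1_{\{\varphi(s)<y\}}(\alpha_1(s)^2+|\beta_1(s)|) + \mathbf 1_{\{\varphi(s)\ge y\}}(\alpha_2(s)^2+|\beta_2(s)|)$ is finite. Two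 solutions are identified if they coincide for all times $\mathbb P$-almost surely. *)

(* Defs.v *)
From HB Require Import structures.
From mathcomp Require Import all_boot all_order all_algebra.
From mathcomp Require Import all_classical all_reals all_analysis.

Set Implicit Arguments.
Unset Strict Implicit.
Unset Printing Implicit Defensive.

Import Order.TTheory GRing.Theory Num.Theory.
Import numFieldNormedType.Exports.

Local Open Scope classical_set_scope.
Local Open Scope ring_scope.

(* Time-indexed objects (filtrations, processes, coefficients) are functions
   of all t : R; only their values at times t >= 0, or on the stated time
   interval, are ever constrained or used.  A process is a map
   [X : R -> Omega -> R], time first. *)

Section StochasticBasis.
Context {R : realType} {d : measure_display} {Omega : measurableType d}.
Variable P : probability Omega R.
Implicit Types (F : R -> set (set Omega)) (X : Omega -> R).

Record usual_conditions F : Prop := UsualConditions {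
  filtration_sigma_algebra : forall t : R, 0 <= t -> sigma_algebra setT (F t);
  filtration_measurable : forall t : R, 0 <= t -> F t `<=` measurable;
  filtration_nondecreasing : forall s t : R, 0 <= s -> s <= t -> F s `<=` F t;
  filtration_right_continuous : forall t : R, 0 <= t ->
    \bigcap_(s in [set s | t < s]) F s = F t;
  (* Since [F 0] consists of measurable sets, this also makes P complete. *)
  filtration_complete : P.-negligible `<=` F 0
}.

(* Measurability with respect to a sub-sigma-algebra [G]. *)
Definition rv_measurable (G : set (set Omega)) X : Prop :=
  forall D : set R, measurable D -> G (X @^-1` D).

Definition independent_of (G : set (set Omega)) X : Prop :=
  forall (A : set Omega) (D : set R), G A -> measurable D ->
    P (A `&` X @^-1` D) = (P A * P (X @^-1` D))%E.

(* X ~ N(m, v); [normal_prob] takes the standard deviation.  Only used with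
   v > 0: [normal_prob m 0] is not the Dirac mass at m. *)
Definition has_normal_law X (m v : R) : Prop :=
  forall D : set R, measurable D ->
    P (X @^-1` D) = normal_prob m (Num.sqrt v) D.

Record brownian_motion F (B : R -> Omega -> R) : Prop := BrownianMotion {
  bm_adapted : forall t : R, 0 <= t -> rv_measurable (F t) (B t);
  bm_start : {ae P, forall w, B 0 w = 0};
  bm_continuous :
    {ae P, forall w, {within `[0, +oo[%classic, continuous (B ^~ w)}};
  bm_independent : forall s t : R, 0 <= s -> s < t ->
    independent_of (F s) (fun w => B t w - B s w);
  bm_normal : forall s t : R, 0 <= s -> s < t ->
    has_normal_law (fun w => B t w - B s w) 0 (t - s)
}.

End StochasticBasis.

Section Processes.
Context {R : realType} {d : measure_display} {Omega : measurableType d}.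
Implicit Types (F : R -> set (set Omega)) (H X : R -> Omega -> R).

Definition time_interval (a : R) (T : \bar R) : set R :=
  [set t | a <= t /\ (t%:E < T)%E].

Definition adapted F (a : R) (T : \bar R) X : Prop :=
  forall t, time_interval a T t -> rv_measurable (F t) (X t).

Definition continuous_paths (a : R) (T : \bar R) X : Prop :=
  forall w, {within time_interval a T, continuous (X ^~ w)}.

(* [g_sigma_algebraType (F t)] is Omega equipped with the sigma-algebra
   generated by [F t], i.e. [F t] itself. *)
Definition progressive F (a : R) (T : \bar R) H : Prop :=
  forall t, time_interval a T t ->
    measurable_fun (`[a, t]%classic `*` [set: g_sigma_algebraType (F t)])
      (fun p : measurableTypeR R * g_sigma_algebraType (F t) => H p.1 p.2).

(* Data of the simple process
     S_s = \sum_(i < sp_size) sp_coef i * 1_{sp_time i < s <= sp_time i.+1}. *)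
Record simple_process := SimpleProcess {
  sp_size : nat;
  sp_time : nat -> R;
  sp_coef : nat -> Omega -> R
}.

Definition simple_value (S : simple_process) (s : R) (w : Omega) : R :=
  \sum_(i < sp_size S)
    sp_coef S i w * (sp_time S i < s <= sp_time S i.+1)%R%:R.

Definition simple_integral (B : R -> Omega -> R) (S : simple_process)
    (w : Omega) : R :=
  \sum_(i < sp_size S)
    sp_coef S i w * (B (sp_time S i.+1) w - B (sp_time S i) w).

Definition simple_on F (a t : R) (S : simple_process) : Prop :=
  [/\ sp_time S 0%N = a,
      sp_time S (sp_size S) = t &
      forall i, (i < sp_size S)%N ->
        [/\ sp_time S i <= sp_time S i.+1,
            rv_measurable (F (sp_time S i)) (sp_coef S i) &
            exists M : R, forall w, `|sp_coef S i w| <= M]].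

Variable P : probability Omega R.

(* [J] is a version of \int_a^t H_s dB_s: the L^2(P)-limit of the integrals of
   simple processes converging to H in L^2(P \x ds) on Omega \x [a, t].  An
   approximating sequence forces E \int_a^t H_s^2 ds < +oo. *)
Definition is_ito_integral F (B : R -> Omega -> R) (a t : R)
    (H : R -> Omega -> R) (J : Omega -> R) : Prop :=
  exists S : nat -> simple_process,
    [/\ forall n, simple_on F a t (S n),
        (fun n => \int[P]_w \int[lebesgue_measure]_(s in `[a, t]%classic)
           ((simple_value (S n) s w - H s w) ^+ 2)%:E)%E @ \oo --> 0%E &
        (fun n => \int[P]_w
           ((simple_integral B (S n) w - J w) ^+ 2)%:E)%E @ \oo --> 0%E].

(* [I] is the adapted continuous version of (\int_a^t H_s dB_s)_{t in [a, T[}. *)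
Definition is_ito_process F (B : R -> Omega -> R) (a : R) (T : \bar R)
    (H I : R -> Omega -> R) : Prop :=
  [/\ progressive F a T H,
      adapted F a T I,
      continuous_paths a T I &
      forall t, time_interval a T t -> is_ito_integral F B a t H (I t)].

Definition prob_below (mu0 : R) (Y : R -> Omega -> R) (t : R) : R :=
  fine (P [set w | Y t w <= mu0]).

(* The strong solutions on [t0, T[.  The stochastic integrands are
   deterministic because [phi] is, hence constant in the second argument. *)
Definition is_solution F (B : R -> Omega -> R) (t0 y : R)
    (alpha1 alpha2 beta1 beta2 : R -> R) (xi : Omega -> R) (mu0 : R)
    (T : \bar R) (Y : R -> Omega -> R) : Prop :=
  let phi := prob_below mu0 Y in
  [/\ adapted F t0 T Y,
      continuous_paths t0 T Y,
      forall S : R, t0 < S -> (S%:E < T)%E ->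
        lebesgue_measure.-integrable `[t0, S]%classic (fun s =>
          ((phi s < y)%R%:R * (alpha1 s ^+ 2 + `|beta1 s|)
           + (y <= phi s)%R%:R * (alpha2 s ^+ 2 + `|beta2 s|))%:E) &
      exists I1 I2 : R -> Omega -> R,
        [/\ is_ito_process F B t0 T (fun s _ => (phi s < y)%R%:R * alpha1 s) I1,
            is_ito_process F B t0 T (fun s _ => (y <= phi s)%R%:R * alpha2 s) I2 &
            {ae P, forall w, forall t, time_interval t0 T t ->
              Y t w = xi w
                + (I1 t w + \int[lebesgue_measure]_(s in `[t0, t]%classic)
                              ((phi s < y)%R%:R * beta1 s))
                + (I2 t w + \int[lebesgue_measure]_(s in `[t0, t]%classic)
                              ((y <= phi s)%R%:R * beta2 s))}]].

Definition indistinguishable (a : R) (T : \bar R) (Y Z : R -> Omega -> R)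
    : Prop :=
  {ae P, forall w, forall t, time_interval a T t -> Y t w = Z t w}.

End Processes.

Definition continuous_bounded {R : realType} (f : R -> R) : Prop :=
  {within `[0, +oo[%classic, continuous f} /\
  exists M : R, forall t : R, 0 <= t -> `|f t| <= M.

(* Main.v *)
Require Import Defs.
From HB Require Import structures.
From mathcomp Require Import all_boot all_order all_algebra.
From mathcomp Require Import all_classical all_reals all_analysis.
From mathcomp Require Import measurable_realfun ring lra.

Import Order.TTheory GRing.Theory Num.Theory.
Import numFieldNormedType.Exports.

Local Open Scope classical_set_scope.
Local Open Scope ring_scope.

Set Implicit Arguments.
Unset Strict Implicit.
Unset Printing Implicit Defensive.

(** At any time a solution is a normal variable, because both indicators are
    deterministic: Y_t = xi + (Wiener integral) + (number). Write mu0 + M(t) and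
    V(t) for its mean and variance. Then phi(t) is the standard normal
    distribution function at -g(t), where g = M / sqrt V, and y is its value at
    -g(t0); so phi(t) < y says exactly that g(t) > g(t0). The equation is thereby
    reduced to a deterministic self-consistency problem for the regime
    p(s) = (phi(s) < y), which determines M and V and hence g.

    The hypotheses make g monotone in each regime. Both regimes have a drift of
    absolute value at most half the variance rate, so |M| < V / 2 for all times,
    and under this bound a drift of at least a quarter of the variance rate
    outweighs the growth of sqrt V (standardized_increase). Hence g increases
    strictly as long as p holds (standardized_mean_up) and decreases strictly as
    long as it fails (standardized_mean_down). As g is continuous, it cannot
    return to the level g(t0), neither from above nor from below: either p holds
    at all times after t0 or it never does (regime_dichotomy). The strict
    inequality in each line is what forces alpha1 and alpha2 to be positive, and
    so the monotonicity of g to be strict.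

    Both regimes are self-consistent, and once the regime is known the equation
    is explicit: each gives one solution (solution_of_regime), and two solutions
    with the same regime have the same integrands (solution_unique). The two are
    distinct because phi(t0 + 1) is below y for one of them only.

    The stochastic part needs three facts on integrals of deterministic
    integrands. Approximating simple processes may be replaced by deterministic
    ones (ito_wiener), which makes the integral a limit of sums of independent
    normal variables and identifies its law (wiener_integral_cdf). The isometry
    makes it unique (wiener_integral_unique). Applied to a stopped simple process
    it gives a maximal inequality (simple_maximal), from which, for a continuous
    integrand, Borel-Cantelli produces a version with continuous paths
    (exists_wiener_process). *)

(** * Random variables measurable for a sub-sigma-algebra *)

Section SubSigmaAlgebra.
Context {R : realType} {d : measure_display} {Omega : measurableType d}.
Implicit Types (G : set (set Omega)) (X Y : Omega -> R).

Lemma sub_measurableE G (A : set Omega) : sigma_algebra setT G ->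
  measurable (A : set (g_sigma_algebraType G)) -> G A.
Proof. by move=> sG mA; rewrite -(measurable_g_measurableTypeE sG). Qed.

Lemma rv_measurableP G X : sigma_algebra setT G ->
  rv_measurable G X <-> measurable_fun [set: g_sigma_algebraType G] X.
Proof.
move=> sG; split=> [mX _ D mD|mX D mD].
  by rewrite setTI; apply: sub_gen_smallest; exact: mX.
by apply: sub_measurableE => //; rewrite -[_ @^-1` _]setTI; exact: mX.
Qed.

Lemma rv_measurable_fun G X : G `<=` measurable -> rv_measurable G X ->
  measurable_fun setT X.
Proof. by move=> GM mX _ D mD; rewrite setTI; exact/GM/mX. Qed.

Lemma rv_measurableS G G' X : G `<=` G' -> rv_measurable G X ->
  rv_measurable G' X.
Proof. by move=> GG' mX D mD; exact/GG'/mX. Qed.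

Lemma rv_measurable_cst G (c : R) : sigma_algebra setT G ->
  rv_measurable G (fun=> c).
Proof. by move=> sG; apply/rv_measurableP => //; exact: measurable_cst. Qed.

Lemma rv_measurableD G X Y : sigma_algebra setT G ->
  rv_measurable G X -> rv_measurable G Y ->
  rv_measurable G (fun w => X w + Y w).
Proof.
move=> sG /(rv_measurableP _ sG) mX /(rv_measurableP _ sG) mY.
by apply/rv_measurableP => //; exact: measurable_funD.
Qed.

Lemma rv_measurableM G X Y : sigma_algebra setT G ->
  rv_measurable G X -> rv_measurable G Y ->
  rv_measurable G (fun w => X w * Y w).
Proof.
move=> sG /(rv_measurableP _ sG) mX /(rv_measurableP _ sG) mY.
by apply/rv_measurableP => //; exact: measurable_funM.
Qed.

Lemma rv_measurableB G X Y : sigma_algebra setT G ->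
  rv_measurable G X -> rv_measurable G Y ->
  rv_measurable G (fun w => X w - Y w).
Proof.
move=> sG /(rv_measurableP _ sG) mX /(rv_measurableP _ sG) mY.
by apply/rv_measurableP => //; exact: measurable_funB.
Qed.

Lemma rv_measurable_sum G I (r : seq I) (Q : pred I) (X_ : I -> Omega -> R) :
  sigma_algebra setT G -> (forall i, Q i -> rv_measurable G (X_ i)) ->
  rv_measurable G (fun w => \sum_(i <- r | Q i) X_ i w).
Proof.
move=> sG mX; elim: r => [|i r IH].
  by under eq_fun do rewrite big_nil; exact: rv_measurable_cst.
have [Qi|/negbTE Qi] := boolP (Q i).
  by under eq_fun do rewrite big_cons Qi; apply: rv_measurableD => //; exact: mX.
by under eq_fun do rewrite big_cons Qi.
Qed.

Lemma rv_measurable_indic G (A : set Omega) : sigma_algebra setT G -> G A ->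
  rv_measurable G (\1_A : Omega -> R).
Proof.
move=> sG GA; apply/rv_measurableP => //.
by apply: measurable_indic; apply: sub_gen_smallest.
Qed.

Lemma rv_measurable_lim G (X_ : nat -> Omega -> R) X :
  sigma_algebra setT G -> (forall n, rv_measurable G (X_ n)) ->
  (forall w, X_ n w @[n --> \oo] --> X w) -> rv_measurable G X.
Proof.
move=> sG mX cX; apply/rv_measurableP => //.
apply: (@measurable_fun_cvg _ (g_sigma_algebraType G) _ _ X_).
  by move=> n; exact/rv_measurableP.
by move=> w _; exact: cX.
Qed.

Lemma rv_measurable_pair G X Y (D : set (R * R)) : sigma_algebra setT G ->
  rv_measurable G X -> rv_measurable G Y -> measurable D ->
  G ((fun w => (X w, Y w)) @^-1` D).
Proof.
move=> sG /(rv_measurableP _ sG) mX /(rv_measurableP _ sG) mY mD.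
apply: sub_measurableE => //; rewrite -[_ @^-1` _]setTI.
exact: measurable_fun_pair.
Qed.

End SubSigmaAlgebra.

Section Freezing.
Context {R : realType} {d : measure_display} {Omega : measurableType d}.
Variable P : probability Omega R.

(** Fubini's theorem, since independence makes the joint law of X and Z a product
    measure. *)
Lemma freezing d1 (T1 : measurableType d1) (G : set (set Omega))
    (X : Omega -> T1) (Z : Omega -> R) (mu : probability (measurableTypeR R) R)
    (f : T1 * measurableTypeR R -> \bar R) :
  measurable_fun setT X -> measurable_fun setT Z ->
  (forall A, measurable A -> G (X @^-1` A)) -> independent_of P G Z ->
  (forall D, measurable D -> P (Z @^-1` D) = mu D) ->
  measurable_fun setT f -> (forall p, 0 <= f p)%E ->
  (\int[P]_w f (X w, Z w) = \int[P]_w \int[mu]_z f (X w, z))%E.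
Proof.
move=> mX mZ GX iZ lZ mf f0.
pose X' : {RV P >-> T1} := HB.pack X (isMeasurableFun.Build _ _ _ _ X mX).
have mXZ : measurable_fun setT
    (fun w => (X w, Z w) : T1 * measurableTypeR R).
  exact: measurable_fun_pair.
pose XZ : {RV P >-> (T1 * measurableTypeR R)%type} :=
  HB.pack (fun w => (X w, Z w)) (isMeasurableFun.Build _ _ _ _ _ mXZ).
have XZE A : measurable A -> (distribution P X' \x mu)%E A = distribution P XZ A.
  move=> mA; apply: product_measure_unique => // {mA}A D mA mD.
  by rewrite [LHS](iZ _ _ (GX _ mA) mD) lZ.
rewrite -[LHS]/(\int[P]_w (f \o XZ) w)%E -ge0_integral_distribution//.
rewrite (eq_measure_integral (distribution P X' \x mu)%E); last first.
  by move=> A mA _; apply/esym; exact: XZE.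
rewrite fubini_tonelli1// ge0_integral_distribution//.
- exact: measurable_fun_fubini_tonelli_F.
- by move=> x; apply: integral_ge0 => z _; exact: f0.
Qed.

End Freezing.

(** * Normal laws *)

Section NormalLaw.
Context {R : realType}.
Implicit Types (m s v x : R).

Let affine m s x : R := m + s * x.

Let measurable_affine m s : measurable_fun setT (affine m s).
Proof. by apply: measurable_funD => //; exact: measurable_funM. Qed.

Let affine_itv m s (a b : R) : 0 < s ->
  affine m s @^-1` `]a, b]%classic =
  `](a - m) / s, (b - m) / s]%classic.
Proof.
move=> s0; apply/seteqP; split => x;
  by rewrite /preimage/= !in_itv/= /affine ltr_pdivrMr// ler_pdivlMr//
    ltrBlDl lerBrDl (mulrC x).
Qed.

Lemma lebesgue_measure_affine m s (A : set R) : 0 < s -> measurable A ->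
  lebesgue_measure A =
  (s%:E * lebesgue_measure ((fun x => (m + s * x)%R) @^-1` A))%E.
Proof.
move=> s0 mA.
pose s' := NngNum (ltW s0).
pose T : R -> measurableTypeR R := affine m s.
have mT : measurable_fun setT T by exact: measurable_affine.
pose nu : {measure set (measurableTypeR R) -> \bar R} :=
  mscale s' (pushforward lebesgue_measure T).
rewrite -[RHS]/(nu mT A); apply: lebesgue_measure_unique => // _ [[a b] _ <-].
rewrite /nu/= /mscale/= /pushforward /T affine_itv// !lebesgue_measure_itv/=.
rewrite !lte_fin ltr_pM2r ?invr_gt0// ltrD2r; case: ifPn => ab; last by rewrite mule0.
rewrite -!EFinD -EFinM; congr EFin; field.
by rewrite gt_eqF.
Qed.

Lemma normal_pdf_affine m s x : 0 < s ->
  s * normal_pdf m s (m + s * x) = normal_pdf 0 1 x.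
Proof.
move=> s0; rewrite !normal_pdfE ?gt_eqF// mulrA; congr (_ * _).
  rewrite /normal_peak expr1n mul1r -mulrnAr sqrtrM ?sqr_ge0//.
  by rewrite sqrtr_sqr gtr0_norm// invfM mulrA divff ?gt_eqF// mul1r.
rewrite /normal_fun; congr expR; rewrite expr1n subr0; field.
by rewrite gt_eqF.
Qed.

Lemma normal_prob_affine m s (D : set R) : 0 < s -> measurable D ->
  normal_prob m s D = normal_prob 0 1 ((fun x => m + s * x) @^-1` D).
Proof.
move=> s0 mD.
pose s' := NngNum (ltW s0).
pose T : R -> measurableTypeR R := affine m s.
have mT : measurable_fun setT T by exact: measurable_affine.
pose nu : {measure set (measurableTypeR R) -> \bar R} :=
  mscale s' (pushforward lebesgue_measure T).
have mpdf m' s'' (E : set R) :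
    measurable_fun E (fun x => (normal_pdf m' s'' x)%:E).
  by apply/measurable_EFinP/measurable_funTS; exact: measurable_normal_pdf.
have pdf0 m' s'' x : (0 <= (normal_pdf m' s'' x)%:E)%E.
  by rewrite lee_fin normal_pdf_ge0.
rewrite /normal_prob.
rewrite (eq_measure_integral (nu mT)); last first.
  by move=> A mA _; exact: lebesgue_measure_affine.
rewrite ge0_integral_mscale//; last exact: (mpdf m s).
rewrite ge0_integral_pushforward//; last exact: (mpdf m s).
have mTD : measurable (T @^-1` D) by rewrite -[X in measurable X]setTI; exact: mT.
rewrite -ge0_integralZl//; first last.
- by move=> x _; exact: pdf0.
- apply: (measurableT_comp (mpdf m s setT)); exact: measurable_funTS.
by apply: eq_integral => x _; rewrite /= -EFinM normal_pdf_affine.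
Qed.

Lemma normal_prob_sym (D : set R) : measurable D ->
  normal_prob 0 1 (-%R @^-1` D) = normal_prob 0 1 D.
Proof.
move=> mD; rewrite /normal_prob.
pose T : R -> measurableTypeR R := -%R.
have mT : measurable_fun setT T by exact: oppr_measurable.
rewrite [RHS](eq_measure_integral (pushforward lebesgue_measure T :
  {measure set (measurableTypeR R) -> \bar R})); last first.
  by move=> A mA _; exact/esym/lebesgue_measureN.
rewrite ge0_integral_pushforward//.
- apply: eq_integral => x _ /=; congr EFin.
  by rewrite !normal_pdfE ?oner_eq0//; congr (_ * _); rewrite /normal_fun !subr0 sqrrN.
- by apply/measurable_EFinP/measurable_funTS; exact: measurable_normal_pdf.
- by move=> x _; rewrite lee_fin normal_pdf_ge0.
Qed.

(** The normal law as a density: the Radon-Nikodym derivative with respect to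
    Lebesgue measure is almost everywhere the density that defines it. *)
Lemma ge0_integral_normal_prob (f : R -> \bar R) m s :
  measurable_fun setT f -> (forall x, 0 <= f x)%E ->
  (\int[normal_prob m s]_x f x =
   \int[lebesgue_measure]_x (f x * (normal_pdf m s x)%:E))%E.
Proof.
move=> mf f0; have dom := @normal_prob_dominates R m s.
have mpdf : measurable_fun setT (fun x => (normal_pdf m s x)%:E).
  by apply/measurable_EFinP; exact: measurable_normal_pdf.
rewrite -(Radon_Nikodym_SigmaFinite.change_of_variables dom)//.
have iRN := Radon_Nikodym_SigmaFinite.f_integrable dom.
apply: ge0_ae_eq_integral => //.
- by apply: emeasurable_funM => //; exact: measurable_int iRN.
- exact: emeasurable_funM.
- by move=> x _; rewrite mule_ge0//; exact: Radon_Nikodym_SigmaFinite.f_ge0.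
- by move=> x _; rewrite mule_ge0// lee_fin normal_pdf_ge0.
apply: ae_eqe_mul2l; apply: integral_ae_eq => //.
by move=> E _ mE; rewrite -Radon_Nikodym_SigmaFinite.f_integral.
Qed.

(** The factor x^2 is absorbed by half of the exponent, so the integrand is
    bounded by a multiple of the density of N(0, 2). *)
Let normal_moment2_fin : (\int[normal_prob 0 1]_x (x ^+ 2)%:E < +oo :> \bar R)%E.
Proof.
rewrite ge0_integral_normal_prob//; last 2 first.
- by apply/measurable_EFinP; exact: measurable_funX.
- by move=> x; rewrite lee_fin sqr_ge0.
have s2 : Num.sqrt 2 != 0 :> R by rewrite gt_eqF// sqrtr_gt0.
pose C : R := 4 * normal_peak 1 / normal_peak (Num.sqrt 2).
have C0 : 0 <= C by rewrite /C divr_ge0 ?mulr_ge0 ?normal_peak_ge0.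
apply: (@le_lt_trans _ _
  (\int[lebesgue_measure]_x (C%:E * (normal_pdf 0 (Num.sqrt 2) x)%:E))%E).
- apply: ge0_le_integral => //.
  + by move=> x _; rewrite mule_ge0// lee_fin ?sqr_ge0 ?normal_pdf_ge0.
  + apply: emeasurable_funM; apply/measurable_EFinP; first exact: measurable_funX.
    exact: measurable_normal_pdf.
  + apply: emeasurable_funM; apply/measurable_EFinP; first exact: measurable_cst.
    exact: measurable_normal_pdf.
  + move=> x _; rewrite -!EFinM lee_fin !normal_pdfE ?oner_eq0//.
    have p0 : 0 < normal_peak (Num.sqrt 2 : R) by rewrite normal_peak_gt0.
    rewrite /C [leRHS]mulrA divfK ?gt_eqF// mulrCA [leRHS]mulrAC mulrC.
    rewrite ler_wpM2r ?normal_peak_ge0// /normal_fun subr0 sqr_sqrtr//.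
    have -> : - x ^+ 2 / (1 ^+ 2 *+ 2) =
        - (x ^+ 2 / 4) + - x ^+ 2 / (2 *+ 2) :> R by field.
    rewrite expRD mulrA ler_wpM2r ?expR_ge0// expRN ler_pdivrMr ?expR_gt0//.
    have := expR_ge1Dx (x ^+ 2 / 4); lra.
- rewrite ge0_integralZl//.
  + by rewrite integral_normal_pdf mule1 ltry.
  + by apply/measurable_EFinP; exact: measurable_normal_pdf.
  + by move=> x _; rewrite lee_fin normal_pdf_ge0.
Qed.

(** The number 1; the constant of the isometry. *)
Definition normal_moment2 : R :=
  fine (\int[normal_prob 0 1]_x (x ^+ 2)%:E : \bar R)%E.

Lemma normal_moment2E :
  (\int[normal_prob 0 1]_x (x ^+ 2)%:E = normal_moment2%:E)%E.
Proof.
rewrite fineK// ge0_fin_numE// ?normal_moment2_fin//.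
by apply: integral_ge0 => x _; rewrite lee_fin sqr_ge0.
Qed.

Lemma normal_moment2_ge0 : 0 <= normal_moment2.
Proof.
by apply/fine_ge0/integral_ge0 => x _; rewrite lee_fin sqr_ge0.
Qed.

End NormalLaw.
Arguments normal_moment2 R : clear implicits.

(** * Sums of independent normal variables *)

Section NormalIntegrals.
Context {R : realType}.
Implicit Types (m s v x : R).
Local Notation N01 := (normal_prob 0 1).

Lemma ge0_integral_normal_affine (f : R -> \bar R) m s : 0 < s ->
  measurable_fun setT f -> (forall x, 0 <= f x)%E ->
  (\int[normal_prob m s]_x f x = \int[N01]_x f (m + s * x)%R)%E.
Proof.
move=> s0 mf f0.
pose T : R -> measurableTypeR R := fun x => m + s * x.
have mT : measurable_fun setT T.
  by apply: measurable_funD => //; exact: measurable_funM.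
rewrite (eq_measure_integral
  (pushforward N01 T : {measure set (measurableTypeR R) -> \bar R})); last first.
  by move=> A mA _; exact: normal_prob_affine.
by rewrite ge0_integral_pushforward.
Qed.

Lemma ge0_integral_normal_sym (f : R -> \bar R) :
  measurable_fun setT f -> (forall x, 0 <= f x)%E ->
  (\int[N01]_x f x = \int[N01]_x f (- x)%R)%E.
Proof.
move=> mf f0.
pose T : R -> measurableTypeR R := -%R.
have mT : measurable_fun setT T by exact: oppr_measurable.
rewrite (eq_measure_integral
  (pushforward N01 T : {measure set (measurableTypeR R) -> \bar R})); last first.
  by move=> A mA _; exact/esym/normal_prob_sym.
by rewrite ge0_integral_pushforward.
Qed.

(** The cross term disappears because averaging over z and -z leaves only the
    even part of the square. *)
Lemma normal_integral_sqr (a b : R) :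
  (\int[N01]_z ((a + b * z) ^+ 2)%:E =
   (a ^+ 2 + b ^+ 2 * normal_moment2 R)%:E)%E.
Proof.
have mq (b' : R) : measurable_fun setT (fun z : R => ((a + b' * z) ^+ 2)%:E).
  apply/measurable_EFinP; apply: measurable_funX.
  by apply: measurable_funD => //; exact: measurable_funM.
have q0 (b' z : R) : (0 <= ((a + b' * z) ^+ 2)%:E)%E by rewrite lee_fin sqr_ge0.
set I := (LHS).
have IN : I = (\int[N01]_z ((a + (- b) * z) ^+ 2)%:E)%E.
  rewrite /I (ge0_integral_normal_sym (mq b) (q0 b)).
  by apply: eq_integral => z _; rewrite mulrN mulNr.
pose N01' : probability (measurableTypeR R) R := N01.
have IIE : (I + I = 2%:E * (a ^+ 2 + b ^+ 2 * normal_moment2 R)%:E)%E.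
  rewrite {2}IN -ge0_integralD//; [|exact: (mq b)|exact: (mq (- b))].
  have m2 : measurable_fun setT (fun z : R => ((z ^+ 2))%:E).
    by apply/measurable_EFinP; exact: measurable_funX.
  rewrite (EFinD (a ^+ 2)) (EFinM (b ^+ 2)) -normal_moment2E -ge0_integralZl//
    ?lee_fin ?sqr_ge0//; last first.
    by move=> z _; rewrite lee_fin sqr_ge0.
  rewrite -[X in (X + _)%E](_ : \int[N01]_z (cst (a ^+ 2)%:E z) = _)%E; last first.
    by rewrite integral_cst// [X in (_ * X)%E](probability_setT N01') mule1.
  rewrite -ge0_integralD//; last 3 first.
  - by move=> z _; rewrite lee_fin sqr_ge0.
  - by move=> z _; rewrite mule_ge0// lee_fin sqr_ge0.
  - exact: emeasurable_funM.
  rewrite -ge0_integralZl//; last 2 first.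
  - by apply: emeasurable_funD => //; exact: emeasurable_funM.
  - by move=> z _; rewrite adde_ge0 ?mule_ge0// lee_fin sqr_ge0.
  apply: eq_integral => z _; rewrite /= -!EFinM -!EFinD; congr EFin; ring.
have I2E : (2%:E * I = 2%:E * (a ^+ 2 + b ^+ 2 * normal_moment2 R)%:E)%E.
  by rewrite -IIE mule_natl mule2n.
have h : ((2^-1)%:E * 2%:E = 1 :> \bar R)%E by rewrite -EFinM mulVf.
by rewrite -[LHS]mul1e -[RHS]mul1e -h -2!muleA I2E.
Qed.

End NormalIntegrals.

Section NormalVariables.
Context {R : realType} {d : measure_display} {Omega : measurableType d}.
Variable P : probability Omega R.
Implicit Types (G : set (set Omega)) (U V X Z : Omega -> R) (m v u c : R).
Local Notation N01 := (normal_prob 0 1).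

Lemma ge0_integral_normal_law X m v (f : R -> \bar R) : 0 < v ->
  measurable_fun setT X -> has_normal_law P X m v ->
  measurable_fun setT f -> (forall x, 0 <= f x)%E ->
  (\int[P]_w f (X w) = \int[N01]_x f (m + Num.sqrt v * x)%R)%E.
Proof.
move=> v0 mX lX mf f0.
pose X0 : Omega -> measurableTypeR R := X.
have mX0 : measurable_fun setT X0 by exact: mX.
pose X' : {RV P >-> measurableTypeR R} :=
  HB.pack X0 (isMeasurableFun.Build _ _ _ _ X0 mX0).
rewrite -[LHS]/(\int[P]_w (f \o X') w)%E -ge0_integral_distribution//.
rewrite -ge0_integral_normal_affine ?sqrtr_gt0//.
by apply: eq_measure_integral => A mA _; exact: lX.
Qed.

Lemma normal_law_shift X m v c : 0 < v -> has_normal_law P X m v ->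
  has_normal_law P (fun w => c + X w) (c + m) v.
Proof.
move=> v0 lX D mD; have s0 : 0 < Num.sqrt v by rewrite sqrtr_gt0.
have mcD : measurable ((fun x : R => c + x) @^-1` D).
  by rewrite -[X in measurable X]setTI; apply: measurable_funD.
rewrite -[LHS]/(P (X @^-1` ((fun x : R => c + x) @^-1` D))) lX//.
rewrite !(normal_prob_affine _ s0)//; congr (normal_prob _ _ _).
by apply/seteqP; split => x; rewrite /preimage/= addrA.
Qed.

(** By freezing, the law of a sum of two independent normal variables depends
    on the two laws only. *)
Lemma normal_sum_prob G U Z m v u c (D : set R) :
  G `<=` measurable -> rv_measurable G U -> has_normal_law P U m v ->
  measurable_fun setT Z -> independent_of P G Z -> has_normal_law P Z 0 u ->
  0 < v -> 0 < u -> measurable D ->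
  P ((fun w => U w + c * Z w) @^-1` D) =
  (\int[N01]_x \int[N01]_z
     (\1_D (m + Num.sqrt v * x + c * (Num.sqrt u * z)))%:E)%E.
Proof.
move=> GM mU lU mZ iZ lZ v0 u0 mD.
have mU' := rv_measurable_fun GM mU.
have mUZ : measurable_fun setT (fun w => U w + c * Z w).
  by apply: measurable_funD => //; exact: measurable_funM.
have mDD : measurable ((fun w => U w + c * Z w) @^-1` D).
  by rewrite -[X in measurable X]setTI; exact: mUZ.
pose f (p : R * R) : \bar R := (\1_D (p.1 + c * p.2))%:E.
have mf : measurable_fun setT f.
  apply/measurable_EFinP; apply: measurableT_comp; first exact: measurable_indic.
  by apply: measurable_funD => //; apply: measurable_funM.
have f0 p : (0 <= f p)%E by rewrite lee_fin.
rewrite -[X in P X]setIT -integral_indic//.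
rewrite -[LHS]/(\int[P]_w f (U w, Z w))%E.
rewrite (freezing (mu := normal_prob 0 (Num.sqrt u)) mU' mZ mU iZ)//.
rewrite (ge0_integral_normal_law
  (f := fun x => \int[normal_prob 0 (Num.sqrt u)]_z f (x, z))%E v0 mU' lU); last 2 first.
- exact: (measurable_fun_fubini_tonelli_F (m2 := normal_prob 0 (Num.sqrt u))).
- by move=> x; apply: integral_ge0.
apply: eq_integral => x _; rewrite ge0_integral_normal_affine ?sqrtr_gt0//.
- by apply: eq_integral => z _; rewrite /f/= add0r.
- exact: measurableT_comp mf _.
Qed.

(** Freeze U and C and average over the symmetric variable Z: this is the step of
    the isometry that kills the cross term. *)
Lemma normal_sum_sqr G U C Z u : sigma_algebra setT G ->
  G `<=` measurable -> rv_measurable G U -> rv_measurable G C ->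
  measurable_fun setT Z -> independent_of P G Z -> has_normal_law P Z 0 u ->
  0 < u ->
  (\int[P]_w ((U w + C w * Z w) ^+ 2)%:E =
   \int[P]_w (U w ^+ 2)%:E
   + (u * normal_moment2 R)%:E * \int[P]_w (C w ^+ 2)%:E)%E.
Proof.
move=> sG GM mU mC mZ iZ lZ u0.
have mU' := rv_measurable_fun GM mU; have mC' := rv_measurable_fun GM mC.
pose f (p : (R * R) * R) : \bar R := ((p.1.1 + p.1.2 * p.2) ^+ 2)%:E.
have mf : measurable_fun setT f.
  apply/measurable_EFinP; apply: measurable_funX; apply: measurable_funD.
    exact: measurableT_comp.
  by apply: measurable_funM => //; exact: measurableT_comp.
have f0 p : (0 <= f p)%E by rewrite lee_fin sqr_ge0.
rewrite -[LHS]/(\int[P]_w f ((U w, C w), Z w))%E.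
rewrite (freezing (G := G) (mu := normal_prob 0 (Num.sqrt u)))//; last 2 first.
- exact: measurable_fun_pair.
- by move=> A mA; exact: rv_measurable_pair.
have inner w : (\int[normal_prob 0 (Num.sqrt u)]_z f ((U w, C w), z) =
    (U w ^+ 2)%:E + (u * normal_moment2 R)%:E * (C w ^+ 2)%:E)%E.
  rewrite ge0_integral_normal_affine ?sqrtr_gt0//; last first.
    exact: measurableT_comp mf _.
  under eq_integral => z _ do rewrite /f/= add0r mulrA.
  rewrite normal_integral_sqr -EFinM -EFinD; congr EFin.
  by rewrite exprMn sqr_sqrtr ?ltW//; ring.
have uk0 : (0 <= (u * normal_moment2 R)%:E)%E.
  by rewrite lee_fin mulr_ge0 ?normal_moment2_ge0// ltW.
under eq_integral => w _ do rewrite inner.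
rewrite ge0_integralD//.
- congr (_ + _)%E; rewrite ge0_integralZl//.
  + by apply/measurable_EFinP; exact: measurable_funX.
  + by move=> w _; rewrite lee_fin sqr_ge0.
- by move=> w _; rewrite lee_fin sqr_ge0.
- by apply/measurable_EFinP; exact: measurable_funX.
- by move=> w _; rewrite mule_ge0// lee_fin sqr_ge0.
- apply: emeasurable_funM => //.
  by apply/measurable_EFinP; exact: measurable_funX.
Qed.

(** Stability of the normal law is read off the Brownian motion itself: its
    increments over [0, v] and over [v, v + c^2 u] are independent and add up
    to an increment, which is normal. *)
Lemma normal_law_add F (B : R -> Omega -> R) G U Z m v u c :
  usual_conditions P F -> brownian_motion P F B ->
  sigma_algebra setT G ->
  G `<=` measurable -> rv_measurable G U -> has_normal_law P U m v ->
  measurable_fun setT Z -> independent_of P G Z -> has_normal_law P Z 0 u ->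
  0 < v -> 0 < u ->
  has_normal_law P (fun w => U w + c * Z w) m (v + c ^+ 2 * u).
Proof.
move=> HF HB sG GM mU lU mZ iZ lZ v0 u0.
have [->|c0] := eqVneq c 0.
  rewrite expr0n mul0r addr0; move=> D mD.
  rewrite (_ : (fun w => _) = U)//; first exact: lU.
  by apply/funext => w; rewrite mul0r addr0.
move=> D mD; rewrite (normal_sum_prob c GM mU lU mZ iZ lZ)//.
have cu0 : 0 < c ^+ 2 * u by rewrite mulr_gt0// exprn_even_gt0.
set u' := c ^+ 2 * u.
have sF t : 0 <= t -> sigma_algebra setT (F t) by exact: filtration_sigma_algebra HF t.
have FM t : 0 <= t -> F t `<=` measurable by exact: filtration_measurable HF t.
have B0 : rv_measurable (F v) (B 0).
  apply: rv_measurableS (bm_adapted HB (lexx 0)).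
  by apply: (filtration_nondecreasing HF) => //; exact: ltW.
have Bv := bm_adapted HB (ltW v0).
have vu0 : 0 <= v + u' by rewrite addr_ge0 ?ltW.
have vu : v < v + u' by rewrite ltrDl.
have mBv := rv_measurable_fun (FM _ (ltW v0)) Bv.
have mBvu := rv_measurable_fun (FM _ vu0) (bm_adapted HB vu0).
pose U' w := m + (B v w - B 0 w); pose Z' w := B (v + u') w - B v w.
have sFv := sF _ (ltW v0).
have mU' : rv_measurable (F v) U'.
  apply: rv_measurableD => //; first exact: rv_measurable_cst.
  exact: rv_measurableB.
have lB0 t : 0 < t -> has_normal_law P (fun w => B t w - B 0 w) 0 t.
  by move=> tp; have := bm_normal HB (lexx 0) tp; rewrite subr0.
have lU' : has_normal_law P U' m v.
  by have := normal_law_shift m v0 (lB0 _ v0); rewrite addr0.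
have mZ' : measurable_fun setT Z' by exact: measurable_funB.
have iZ' := bm_independent HB (ltW v0) vu.
have lZ' : has_normal_law P Z' 0 u'.
  by have := bm_normal HB (ltW v0) vu; rewrite addrAC subrr add0r.
have := normal_sum_prob 1 (FM _ (ltW v0)) mU' lU' mZ' iZ' lZ' v0 cu0 mD.
have -> : (fun w => U' w + 1 * Z' w) =
          (fun w => m + (B (v + u') w - B 0 w)).
  by apply/funext => w; rewrite /U' /Z'; ring.
have vu'0 : 0 < v + u' by rewrite addr_gt0.
rewrite (normal_law_shift m vu'0 (lB0 _ vu'0) mD) addr0 => ->.
apply: eq_integral => x _; rewrite /u' sqrtrM ?sqr_ge0// sqrtr_sqr.
under [RHS]eq_integral => z _ do rewrite mul1r -mulrA.
have [c0'|c0'] := leP 0 c; first by rewrite ger0_norm.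
rewrite ltr0_norm// ge0_integral_normal_sym//.
- by apply: eq_integral => z _; rewrite !(mulrN, mulNr).
- apply/measurable_EFinP; apply: measurableT_comp; first exact: measurable_indic.
  by apply: measurable_funD => //; do 2 apply: measurable_funM => //.
Qed.

End NormalVariables.

(** * The standard normal distribution function *)

Section NormalCdf.
Context {R : realType}.
Implicit Types (m s v x y : R).
Local Notation N01 := (normal_prob 0 1).
Let N01' : probability (measurableTypeR R) R := N01.

Definition std_normal_cdf x : R := fine (N01 `]-oo, x]%classic).

Let cdfE x : N01 `]-oo, x]%classic = (std_normal_cdf x)%:E.
Proof. by rewrite fineK// (fin_num_measure N01'). Qed.

Lemma std_normal_cdf_diff x y : x < y ->
  (\int[lebesgue_measure]_(z in `]x, y]) (normal_pdf 0 1 z)%:E =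
   (std_normal_cdf y - std_normal_cdf x)%:E)%E.
Proof.
move=> xy; rewrite -[LHS]/(N01' `]x, y]%classic).
have : N01' `]-oo, y]%classic =
    (N01' `]-oo, x]%classic + N01' `]x, y]%classic)%E.
  rewrite (@itv_bndbnd_setU _ _ _ (BRight x))// ?bnd_simp ?ltW// measureU//.
  by apply/seteqP; split => z //=; rewrite !in_itv/= => -[zx /andP[]]; rewrite ltNge zx.
have /fineK <- := fin_num_measure N01' `]x, y]%classic (measurable_itv _).
rewrite -[N01' `]-oo, y]%classic]/(N01 `]-oo, y]%classic).
rewrite -[N01' `]-oo, x]%classic]/(N01 `]-oo, x]%classic) !cdfE => -[->].
by rewrite addrAC subrr add0r.
Qed.

Lemma std_normal_cdf_lt x y : x < y -> std_normal_cdf x < std_normal_cdf y.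
Proof.
move=> xy; rewrite -subr_gt0 -lte_fin -std_normal_cdf_diff//.
pose c := normal_peak 1 * expR (- (x ^+ 2 + y ^+ 2) / 2) : R.
have c0 : 0 < c by rewrite mulr_gt0 ?expR_gt0// normal_peak_gt0// oner_eq0.
apply: (@lt_le_trans _ _ (\int[lebesgue_measure]_(z in `]x, y]) c%:E)%E).
  rewrite integral_cst//= lebesgue_measure_itv/= lte_fin xy -EFinD -EFinM lte_fin.
  by rewrite mulr_gt0// subr_gt0.
apply: ge0_le_integral => //.
- by move=> z _; rewrite lee_fin ltW.
- by apply/measurable_EFinP/measurable_funTS; exact: measurable_normal_pdf.
- move=> z /=; rewrite in_itv/= => /andP[xz zy]; rewrite lee_fin normal_pdfE ?oner_eq0//.
  rewrite ler_wpM2l ?normal_peak_ge0// /normal_fun ler_expR expr1n subr0.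
  have zxy : z ^+ 2 <= x ^+ 2 + y ^+ 2.
    have [z0|z0] := leP 0 z.
      by rewrite -[leLHS]add0r lerD ?sqr_ge0// lerXn2r ?nnegrE// (le_trans z0).
    rewrite -[leLHS]addr0 lerD ?sqr_ge0// -[leLHS]sqrrN -[leRHS]sqrrN.
    by rewrite lerXn2r ?nnegrE ?lerN2 ?oppr_ge0 ?(ltW xz)// ltW// (lt_trans xz).
  by rewrite !mulNr lerN2 ler_pM2r.
Qed.

(** The density is at most its value at 0. *)
Lemma std_normal_cdf_lipschitz x y : x <= y ->
  std_normal_cdf y - std_normal_cdf x <= normal_peak 1 * (y - x).
Proof.
rewrite le_eqVlt => /predU1P[->|xy]; first by rewrite !subrr mulr0.
rewrite -lee_fin -std_normal_cdf_diff//.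
have -> : (normal_peak 1 * (y - x))%:E =
    (\int[lebesgue_measure]_(z in `]x, y]) (normal_peak 1)%:E)%E.
  by rewrite integral_cst//= lebesgue_measure_itv/= lte_fin xy -EFinD -EFinM.
apply: ge0_le_integral => //.
- by move=> z _; rewrite lee_fin normal_pdf_ge0.
- by apply/measurable_EFinP/measurable_funTS; exact: measurable_normal_pdf.
- by move=> z _; rewrite lee_fin normal_pdf_ub ?oner_eq0.
Qed.

Lemma std_normal_cdf_ltE x y :
  (std_normal_cdf x < std_normal_cdf y) = (x < y).
Proof.
have [|yx|->] := ltgtP x y; first exact: std_normal_cdf_lt.
- by apply/negbTE; rewrite -leNgt ltW// std_normal_cdf_lt.
- by rewrite ltxx.
Qed.

Lemma continuous_std_normal_cdf : continuous std_normal_cdf.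
Proof.
move=> x; apply/cvgrPdist_le => e e0.
near=> y.
have : `|x - y| <= e / normal_peak 1.
  near: y; apply: cvgr_dist_le; first exact: cvg_id.
  by rewrite divr_gt0// normal_peak_gt0 ?oner_eq0.
rewrite ler_pdivlMr ?normal_peak_gt0 ?oner_eq0// => xy.
have [yx|yx] := leP y x.
- have mono : std_normal_cdf y <= std_normal_cdf x.
    by move: yx; rewrite le_eqVlt => /predU1P[->//|/std_normal_cdf_lt/ltW].
  rewrite ger0_norm ?subr_ge0//; apply: le_trans (std_normal_cdf_lipschitz yx) _.
  by move: xy; rewrite ger0_norm ?subr_ge0// mulrC.
- have mono := std_normal_cdf_lt yx.
  rewrite ltr0_norm ?subr_lt0// opprB; apply: le_trans (std_normal_cdf_lipschitz (ltW yx)) _.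
  by move: xy; rewrite ltr0_norm ?subr_lt0// opprB mulrC.
Unshelve. all: by end_near. Qed.

Context {d : measure_display} {Omega : measurableType d}.
Variable P : probability Omega R.

Lemma normal_law_cdf (X : Omega -> R) m v x : 0 < v -> has_normal_law P X m v ->
  P [set w | X w <= x] = (std_normal_cdf ((x - m) / Num.sqrt v))%:E.
Proof.
move=> v0 lX; have s0 : 0 < Num.sqrt v by rewrite sqrtr_gt0.
have -> : [set w | X w <= x] = X @^-1` `]-oo, x]%classic.
  by apply/seteqP; split => w; rewrite /preimage/= in_itv/=.
rewrite lX// normal_prob_affine// -cdfE; congr (normal_prob _ _ _).
apply/seteqP; split => z; rewrite /preimage/= !in_itv/=;
  by rewrite ler_pdivlMr// lerBrDl mulrC.
Qed.

End NormalCdf.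

(** * Simple processes *)

Section Grid.
Context {R : realType}.
Implicit Types (L : seq R) (f : R -> R) (p q : R).

Lemma sorted_nth_le L i j : sorted <=%R L -> (i <= j)%N -> (j < size L)%N ->
  nth 0 L i <= nth 0 L j.
Proof.
move=> sL ij jL; apply: (sorted_leq_nth le_trans lexx) => //.
by rewrite inE (leq_ltn_trans ij).
Qed.

Lemma grid_node L r i : sorted <=%R L -> r \in L -> (i.+1 < size L)%N ->
  r < nth 0 L i.+1 -> r <= nth 0 L i.
Proof.
move=> sL rL iL; rewrite -{1}(nth_index 0 rL) -{2}(nth_index 0 rL) => ri.
have rs : (index r L < size L)%N by rewrite index_mem.
apply: sorted_nth_le => //; last exact: ltnW.
rewrite leqNgt; apply/negP => ir; move: ri; rewrite ltNge => /negP; apply.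
exact: sorted_nth_le.
Qed.

(** No cell of the grid straddles p or q, so the indicator may be replaced by
    clamping f to [p, q], which makes the sum telescope. *)
Lemma grid_telescope L f p q : sorted <=%R L -> p \in L -> q \in L -> p <= q ->
  \sum_(i < (size L).-1)
    (p < nth 0 L i.+1 <= q)%R%:R * (f (nth 0 L i.+1) - f (nth 0 L i)) =
  f q - f p.
Proof.
move=> sL pL qL pq.
pose g x := f (Num.max p (Num.min x q)).
have L0 : (0 < size L)%N by case: L pL {sL qL}.
have gp x : x <= p -> g x = f p.
  by move=> xp; rewrite /g min_l ?(le_trans xp)// max_l.
have gq x : q <= x -> g x = f q by move=> qx; rewrite /g min_r// max_r.
have gpq x : p <= x -> x <= q -> g x = f x.
  by move=> px xq; rewrite /g min_l// max_r.
under eq_bigr => i _.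
  have iL : (i.+1 < size L)%N by rewrite -ltn_predRL.
  have iL' := sorted_nth_le sL (leqnSn i) iL.
  rewrite (_ : _ * _ = g (nth 0 L i.+1) - g (nth 0 L i)); last first.
    have [xp|px] /= := leP (nth 0 L i.+1) p.
      by rewrite mul0r !gp ?subrr// (le_trans iL').
    have pi := grid_node sL pL iL px.
    have [xq|qx] /= := leP (nth 0 L i.+1) q.
      by rewrite mul1r !gpq// ?(ltW px)// (le_trans iL').
    by rewrite mul0r !gq ?subrr ?(ltW qx)// (grid_node sL qL iL).
  over.
rewrite -(big_mkord xpredT (fun i => g (nth 0 L i.+1) - g (nth 0 L i))).
rewrite telescope_sumr//; congr (_ - _).
- apply: gq; rewrite -(nth_index 0 qL); apply: sorted_nth_le => //.
    by rewrite -ltnS prednK// index_mem.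
  by rewrite prednK.
- apply: gp; rewrite -(nth_index 0 pL); apply: sorted_nth_le => //.
  by rewrite index_mem.
Qed.

End Grid.

Section SimpleProcesses.
Context {R : realType} {d : measure_display} {Omega : measurableType d}.
Implicit Types (F : R -> set (set Omega)) (S : @simple_process R d Omega).

(** The indefinite integral t |-> \int_a^t S dB of a simple process. *)
Definition simple_running (B : R -> Omega -> R) S (t : R) (w : Omega) : R :=
  \sum_(i < sp_size S) sp_coef S i w *
    (B (Num.min t (sp_time S i.+1)) w - B (Num.min t (sp_time S i)) w).

Lemma simple_time_le F a T S i j : simple_on F a T S ->
  (i <= j <= sp_size S)%N -> sp_time S i <= sp_time S j.
Proof.
move=> [_ _ h] /andP[ij jS].
elim: j ij jS => [|j IH]; first by rewrite leqn0 => /eqP ->.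
rewrite leq_eqVlt => /predU1P[->//|ij jS].
by apply: (le_trans (IH ij (ltnW jS))); have [] := h j jS.
Qed.

Lemma simple_time_bounds F a T S i : simple_on F a T S -> (i <= sp_size S)%N ->
  a <= sp_time S i <= T.
Proof.
move=> hS iS; have [<- <- _] := hS.
by apply/andP; split; apply: (simple_time_le hS) => //; rewrite iS leqnn.
Qed.

Lemma simple_running_end F B a T S w : simple_on F a T S ->
  simple_running B S T w = simple_integral B S w.
Proof.
move=> hS; apply: eq_bigr => i _.
have /andP[_ h1] := simple_time_bounds hS (ltn_ord i).
have /andP[_ h0] := simple_time_bounds hS (ltnW (ltn_ord i)).
by rewrite !min_r.
Qed.

(* On the cell ending at a node the process g is represented by its value at that
   node. *)
Let refine (L : seq R) (g : R -> Omega -> R) : simple_process :=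
  SimpleProcess (size L).-1 (nth 0 L) (fun i => g (nth 0 L i.+1)).

(* With f the Brownian path stopped at t this is the integral over [a, t], with f
   the indicator of [s, +oo[ it is the value at s: one identity shows that
   refining the partition changes neither. *)
Let refine_sum L S (f : R -> R) w : sorted <=%R L ->
  (forall i, (i <= sp_size S)%N -> sp_time S i \in L) ->
  (forall i, (i < sp_size S)%N -> sp_time S i <= sp_time S i.+1) ->
  \sum_(k < (size L).-1)
    simple_value S (nth 0 L k.+1) w * (f (nth 0 L k.+1) - f (nth 0 L k)) =
  \sum_(i < sp_size S) sp_coef S i w *
    (f (sp_time S i.+1) - f (sp_time S i)).
Proof.
move=> sL tL tS.
under eq_bigr do rewrite /simple_value big_distrl/=.
rewrite exchange_big/=; apply: eq_bigr => i _.
under eq_bigr do rewrite -mulrA.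
rewrite -big_distrr/=; congr (_ * _).
by apply: grid_telescope => //; [apply: tL; exact: ltnW|exact: tL|exact: tS].
Qed.

Let refine_value L S s w : sorted <=%R L ->
  (forall i, (i <= sp_size S)%N -> sp_time S i \in L) ->
  (forall i, (i < sp_size S)%N -> sp_time S i <= sp_time S i.+1) ->
  simple_value (refine L (simple_value S)) s w = simple_value S s w.
Proof.
move=> sL tL tS.
have cell (x y : R) : x <= y -> (x < s <= y)%R%:R = (s <= y)%R%:R - (s <= x)%R%:R :> R.
  move=> xy; have [sx|xs] /= := leP s x; last by rewrite subr0.
  by rewrite (le_trans sx xy) subrr.
have e := refine_sum (fun x => (s <= x)%R%:R) w sL tL tS.
apply: etrans (etrans _ e) _; apply: eq_bigr => i _ /=.
  by rewrite cell// sorted_nth_le// -ltn_predRL.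
by rewrite cell// tS.
Qed.

(** Two simple processes are combined on the union of their partitions; the
    points of Q are added to the partition of the result. *)
Lemma simple_combine F (a T c : R) S1 S2 (Q : seq R) :
  (forall t, 0 <= t -> sigma_algebra setT (F t)) ->
  (forall s t, 0 <= s -> s <= t -> F s `<=` F t) -> 0 <= a ->
  simple_on F a T S1 -> simple_on F a T S2 ->
  (forall q, q \in Q -> a <= q <= T) ->
  exists S, [/\ simple_on F a T S,
    forall s w, simple_value S s w =
      simple_value S1 s w + c * simple_value S2 s w,
    forall B t w, simple_running B S t w =
      simple_running B S1 t w + c * simple_running B S2 t w,
    forall i w, sp_coef S i w = simple_value S1 (sp_time S i.+1) w +
      c * simple_value S2 (sp_time S i.+1) w &
    forall q, q \in Q -> exists2 j, (j <= sp_size S)%N & sp_time S j = q].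
Proof.
move=> sF ndF a0 hS1 hS2 hQ.
pose times S : seq R := [seq sp_time S i | i <- iota 0 (sp_size S).+1].
pose L := sort <=%R (times S1 ++ times S2 ++ Q).
have memt S i : (i <= sp_size S)%N -> sp_time S i \in times S.
  by move=> iS; apply: map_f; rewrite mem_iota.
have memL x : (x \in L) = [|| x \in times S1, x \in times S2 | x \in Q].
  by rewrite mem_sort !mem_cat.
have sL : sorted <=%R L by apply: sort_sorted; exact: le_total.
have tL1 i : (i <= sp_size S1)%N -> sp_time S1 i \in L.
  by move=> iS; rewrite memL memt.
have tL2 i : (i <= sp_size S2)%N -> sp_time S2 i \in L.
  by move=> iS; rewrite memL memt// orbT.
have tS1 i : (i < sp_size S1)%N -> sp_time S1 i <= sp_time S1 i.+1.
  by move=> iS; apply: (simple_time_le hS1); rewrite leqnSn.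
have tS2 i : (i < sp_size S2)%N -> sp_time S2 i <= sp_time S2 i.+1.
  by move=> iS; apply: (simple_time_le hS2); rewrite leqnSn.
have Lb x : x \in L -> a <= x <= T.
  rewrite memL => /or3P[/mapP[i]|/mapP[i]|/hQ//].
    by rewrite mem_iota/= add0n ltnS => iS ->; exact: simple_time_bounds hS1 iS.
  by rewrite mem_iota/= add0n ltnS => iS ->; exact: simple_time_bounds hS2 iS.
have [aS1 TS1 _] := hS1.
have aL : a \in L by rewrite -aS1 tL1.
have TL : T \in L by rewrite -TS1 tL1.
have L0 : (0 < size L)%N by case: (L) aL.
have value_coef S i : simple_on F a T S ->
    (forall j, (j <= sp_size S)%N -> sp_time S j \in L) -> (i.+1 < size L)%N ->
    rv_measurable (F (nth 0 L i)) (simple_value S (nth 0 L i.+1)) /\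
    exists M, forall w, `|simple_value S (nth 0 L i.+1) w| <= M.
  move=> hS tL iL.
  have mi : 0 <= nth 0 L i.
    by have /andP[+ _] := Lb _ (mem_nth 0 (ltnW iL)); exact: le_trans.
  split.
    apply: rv_measurable_sum => [|j _]; first exact: sF.
    have [_ _ /(_ j (ltn_ord j))[tj mj _]] := hS.
    have [lt_j|nlt_j] := ltP (sp_time S j) (nth 0 L i.+1); last first.
      rewrite (_ : (fun w => _) = fun=> 0); first by apply: rv_measurable_cst; exact: sF.
      by apply/funext => w; rewrite /= mulr0.
    apply: rv_measurableM; [exact: sF| |by apply: rv_measurable_cst; exact: sF].
    apply: rv_measurableS mj; apply: ndF.
      have /andP[+ _] := simple_time_bounds hS (ltnW (ltn_ord j)).
      exact: le_trans.
    exact: (grid_node sL (tL _ (ltnW (ltn_ord j)))).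
  have [_ _ hc] := hS.
  have /choice[M hM] : forall j : 'I_(sp_size S), exists M, forall w,
      `|sp_coef S j w| <= M.
    by move=> j; have [] := hc j (ltn_ord j).
  exists (\sum_(j < sp_size S) M j) => w.
  apply: le_trans (ler_norm_sum _ _ _) _; apply: ler_sum => j _.
  rewrite normrM (le_trans _ (hM j w))// ler_piMr// ger0_norm//.
  by case: (_ < _ <= _).
exists (refine L (fun s w => simple_value S1 s w + c * simple_value S2 s w)).
split.
- split=> /=.
  + apply/le_anti/andP; split; last by have /andP[] := Lb _ (mem_nth 0 L0).
    by rewrite -[leRHS](nth_index 0 aL) sorted_nth_le ?index_mem.
  + apply/le_anti/andP; split.
      have lt1 : ((size L).-1 < size L)%N by rewrite prednK.
      by have /andP[] := Lb _ (mem_nth 0 lt1).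
    rewrite -[leLHS](nth_index 0 TL) sorted_nth_le ?prednK//.
    by rewrite -ltnS prednK// index_mem.
  + move=> i iL; have {}iL : (i.+1 < size L)%N by rewrite -ltn_predRL.
    have le_i : nth 0 L i <= nth 0 L i.+1 by rewrite sorted_nth_le.
    have mi : a <= nth 0 L i by have /andP[] := Lb _ (mem_nth 0 (ltnW iL)).
    have [b1 mb1] := value_coef _ _ hS1 tL1 iL.
    have [b2 [M2 mb2]] := value_coef _ _ hS2 tL2 iL.
    have sFi : sigma_algebra setT (F (nth 0 L i)) by apply: sF; exact: le_trans mi.
    split => //.
      apply: rv_measurableD => //; apply: rv_measurableM => //.
      exact: rv_measurable_cst.
    have [M1 {}mb1] := mb1; exists (M1 + `|c| * M2) => w.
    rewrite (le_trans (ler_normD _ _))// lerD// normrM ler_wpM2l//.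
- move=> s w; rewrite -(refine_value s w sL tL1 tS1) -(refine_value s w sL tL2 tS2).
  rewrite /simple_value big_distrr/= -big_split/=; apply: eq_bigr => i _.
  by rewrite mulrDl mulrA.
- move=> B t w.
  rewrite /simple_running -(refine_sum (fun x => B (Num.min t x) w) w sL tL1 tS1).
  rewrite -(refine_sum (fun x => B (Num.min t x) w) w sL tL2 tS2).
  rewrite big_distrr/= -big_split/=; apply: eq_bigr => i _.
  by rewrite mulrDl mulrA.
- by [].
- move=> q qQ; exists (index q L) => /=.
    by rewrite -ltnS prednK// index_mem memL qQ !orbT.
  by rewrite nth_index// memL qQ !orbT.
Qed.

End SimpleProcesses.

(** * The isometry and the maximal inequality for simple processes *)

Section SimpleSquare.
Context {R : realType} {d : measure_display} {Omega : measurableType d}.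
Implicit Types (F : R -> set (set Omega)) (S : @simple_process R d Omega).

(** The cells are disjoint, so at most one term is nonzero. *)
Lemma simple_value_sqr F a T S s w : simple_on F a T S ->
  simple_value S s w ^+ 2 =
  \sum_(i < sp_size S) sp_coef S i w ^+ 2 *
    (sp_time S i < s <= sp_time S i.+1)%R%:R.
Proof.
move=> hS; rewrite /simple_value.
have [/existsP[i si]|] := boolP [exists i : 'I_(sp_size S),
    sp_time S i < s <= sp_time S i.+1]; last first.
  move=> /existsPn h; rewrite !big1 ?expr0n// => i _;
  by rewrite (negbTE (h i)) mulr0.
have other j : j != i -> (sp_time S j < s <= sp_time S j.+1) = false.
  move=> ji; apply/negbTE/negP => /andP[js sj]; move: si => /andP[is_ si].
  move: ji; rewrite -val_eqE/= neq_ltn => /orP[ji|ij].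
  - have := simple_time_le hS (i := j.+1) (j := i); rewrite ji ltnW// => /(_ erefl).
    by rewrite leNgt (lt_le_trans is_ sj).
  - have := simple_time_le hS (i := i.+1) (j := j); rewrite ij ltnW// => /(_ erefl).
    by rewrite leNgt (lt_le_trans js si).
rewrite (bigD1 i)//= [X in _ + X]big1; last by move=> j /other ->; rewrite mulr0.
rewrite [RHS](bigD1 i)//= [X in _ = _ + X]big1; last first.
  by move=> j /other ->; rewrite mulr0.
by rewrite si !mulr1 !addr0.
Qed.

Lemma simple_integral_sqr F a T S w : simple_on F a T S ->
  (\int[lebesgue_measure]_(s in `[a, T]%classic) (simple_value S s w ^+ 2)%:E =
   \sum_(i < sp_size S)
     (sp_time S i.+1 - sp_time S i)%:E * (sp_coef S i w ^+ 2)%:E)%E.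
Proof.
move=> hS.
under eq_integral => s _ do rewrite (simple_value_sqr s w hS) -sumEFin.
have mI (i : nat) : measurable_fun setT
    (fun s : R => (sp_time S i < s <= sp_time S i.+1)%R%:R : R).
  rewrite (_ : (fun s => _) = \1_(`]sp_time S i, sp_time S i.+1]%classic)).
    exact: measurable_indic.
  by apply/funext => s; rewrite indicE mem_setE in_itv.
rewrite ge0_integral_sum//; last 2 first.
- move=> i; apply/measurable_EFinP/measurable_funTS.
  by apply: measurable_funM => //; exact: mI.
- by move=> i s _; rewrite lee_fin mulr_ge0 ?sqr_ge0.
apply: eq_bigr => i _; under eq_integral => s _ do rewrite EFinM.
rewrite ge0_integralZl//; last 2 first.
- by apply/measurable_EFinP/measurable_funTS; exact: mI.
- by rewrite lee_fin sqr_ge0.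
rewrite muleC; congr (_ * _)%E.
have /andP[ai _] := simple_time_bounds hS (ltnW (ltn_ord i)).
have /andP[_ iT] := simple_time_bounds hS (ltn_ord i).
have ii1 : sp_time S i <= sp_time S i.+1.
  by have [_ _ /(_ i (ltn_ord i))[]] := hS.
under eq_integral => s _.
  rewrite (_ : _%:R = \1_(`]sp_time S i, sp_time S i.+1]%classic) s); last first.
    by rewrite indicE mem_setE in_itv.
  over.
rewrite integral_indic// (_ : _ `&` _ = `]sp_time S i, sp_time S i.+1]%classic).
  rewrite /= lebesgue_measure_itv/= lte_fin; case: ltP => // h.
  by rewrite (le_anti (introT andP (conj ii1 h))) subrr.
apply/seteqP; split => s /=; rewrite !in_itv/=; first by move=> [].
move=> /andP[is_ si]; split; first by rewrite is_.
by rewrite (le_trans ai (ltW is_)) (le_trans si iT).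
Qed.

End SimpleSquare.

Section Isometry.
Context {R : realType} {d : measure_display} {Omega : measurableType d}.
Variable P : probability Omega R.
Variables (F : R -> set (set Omega)) (B : R -> Omega -> R).
Hypotheses (HF : usual_conditions P F) (HB : brownian_motion P F B).
Implicit Type S : @simple_process R d Omega.

Lemma filtration_sub s t : 0 <= s -> s <= t -> F s `<=` F t.
Proof. exact: (filtration_nondecreasing HF). Qed.

Lemma filtration_sigma t : 0 <= t -> sigma_algebra setT (F t).
Proof. exact: (filtration_sigma_algebra HF). Qed.

Lemma adapted_measurable t (X : Omega -> R) : 0 <= t -> rv_measurable (F t) X ->
  measurable_fun setT X.
Proof. by move=> t0; apply: rv_measurable_fun; exact: (filtration_measurable HF). Qed.

Definition simple_partial S n w : R :=
  \sum_(i < n) sp_coef S i w * (B (sp_time S i.+1) w - B (sp_time S i) w).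

Definition simple_energy S : \bar R :=
  (\sum_(i < sp_size S)
    (sp_time S i.+1 - sp_time S i)%:E * \int[P]_w (sp_coef S i w ^+ 2)%:E)%E.

Lemma simple_partial_adapted a T S n : 0 <= a -> simple_on F a T S ->
  (n <= sp_size S)%N -> rv_measurable (F (sp_time S n)) (simple_partial S n).
Proof.
move=> a0 hS; have t0 i : (i <= sp_size S)%N -> 0 <= sp_time S i.
  by move=> iS; have /andP[+ _] := simple_time_bounds hS iS; exact: le_trans.
move=> nS; apply: rv_measurable_sum => [|i _]; first exact: filtration_sigma (t0 _ _).
have iS : (i < sp_size S)%N by rewrite (leq_trans (ltn_ord i)).
have [_ _ /(_ i iS)[_ mi _]] := hS.
have sub j : (j <= n)%N -> F (sp_time S j) `<=` F (sp_time S n).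
  move=> jn; apply: filtration_sub; first by rewrite t0// (leq_trans jn).
  by apply: (simple_time_le hS); rewrite jn.
have sFn := filtration_sigma (t0 _ nS).
apply: rv_measurableM => //.
  by apply: rv_measurableS mi; apply: sub; exact: ltnW.
apply: rv_measurableB => //.
  by apply: rv_measurableS (bm_adapted HB (t0 _ iS)); exact: sub.
apply: rv_measurableS (bm_adapted HB (t0 _ (ltnW iS))); apply: sub.
exact: ltnW.
Qed.

(** Ito's isometry. The coefficient of an increment and all earlier terms are
    measurable for the past, of which the increment is independent; the terms are
    therefore added one at a time, without cross terms. *)
Lemma simple_isometry_energy a T S : 0 <= a -> simple_on F a T S ->
  (\int[P]_w (simple_integral B S w ^+ 2)%:E =
   (normal_moment2 R)%:E * simple_energy S)%E.
Proof.
move=> a0 hS; have t0 i : (i <= sp_size S)%N -> 0 <= sp_time S i.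
  by move=> iS; have /andP[+ _] := simple_time_bounds hS iS; exact: le_trans.
suff H n : (n <= sp_size S)%N -> (\int[P]_w (simple_partial S n w ^+ 2)%:E =
    (normal_moment2 R)%:E * \sum_(i < n) (sp_time S i.+1 - sp_time S i)%:E *
       \int[P]_w (sp_coef S i w ^+ 2)%:E)%E by exact: H (leqnn _).
elim: n => [_|n IH nS].
  rewrite big_ord0 mule0 -[RHS](integral0 P setT); apply: eq_integral => w _.
  by rewrite /simple_partial big_ord0 expr0n.
have [_ _ /(_ n nS)[tn mn _]] := hS.
have sFn := filtration_sigma (t0 _ (ltnW nS)).
have e0 i : (i < sp_size S)%N -> (0 <= (sp_time S i.+1 - sp_time S i)%:E *
    \int[P]_w (sp_coef S i w ^+ 2)%:E)%E.
  move=> iS; rewrite mule_ge0//.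
    by rewrite lee_fin subr_ge0; have [_ _ /(_ i iS)[]] := hS.
  by apply: integral_ge0 => w _; rewrite lee_fin sqr_ge0.
rewrite big_ord_recr/= ge0_muleDr//; last 2 first.
- by apply: sume_ge0 => i _; apply: e0; rewrite (leq_trans (ltn_ord i))// ltnW.
- exact: e0.
rewrite -(IH (ltnW nS)) muleA -EFinM.
have -> : (\int[P]_w (simple_partial S n.+1 w ^+ 2)%:E = \int[P]_w
    ((simple_partial S n w + sp_coef S n w *
      (B (sp_time S n.+1) w - B (sp_time S n) w)) ^+ 2)%:E)%E.
  by apply: eq_integral => w _; rewrite /simple_partial big_ord_recr.
move: tn; rewrite le_eqVlt => /predU1P[tn|tn].
  rewrite tn subrr mulr0 mul0e adde0; apply: eq_integral => w _.
  by rewrite -tn subrr mulr0 addr0.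
rewrite [(normal_moment2 R * _)%R]mulrC.
apply: (normal_sum_sqr (G := F (sp_time S n))
  (Z := fun w => B (sp_time S n.+1) w - B (sp_time S n) w) sFn) => //.
- by apply: (filtration_measurable HF); rewrite t0// ltnW.
- exact: (simple_partial_adapted a0 hS (ltnW nS)).
- apply: measurable_funB; apply: adapted_measurable (bm_adapted HB _); rewrite t0// ltnW//.
- by apply: (bm_independent HB) => //; rewrite t0// ltnW.
- by apply: (bm_normal HB) => //; rewrite t0// ltnW.
- by rewrite subr_gt0.
Qed.

Lemma simple_coef_measurable a T S i : 0 <= a -> simple_on F a T S ->
  (i < sp_size S)%N -> measurable_fun setT (sp_coef S i).
Proof.
move=> a0 hS iS; have [_ _ /(_ i iS)[_ mi _]] := hS.
apply: adapted_measurable mi.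
by have /andP[+ _] := simple_time_bounds hS (ltnW iS); exact: le_trans.
Qed.

Lemma simple_energyE a T S : 0 <= a -> simple_on F a T S ->
  (simple_energy S = \int[P]_w
     \int[lebesgue_measure]_(s in `[a, T]%classic) (simple_value S s w ^+ 2)%:E)%E.
Proof.
move=> a0 hS; under eq_integral => w _ do rewrite (simple_integral_sqr w hS).
have m2 (i : 'I_(sp_size S)) : measurable_fun setT (fun w => (sp_coef S i w ^+ 2)%:E).
  by apply/measurable_EFinP/measurable_funX; exact: simple_coef_measurable hS _.
have ti (i : 'I_(sp_size S)) : 0 <= sp_time S i.+1 - sp_time S i.
  by rewrite subr_ge0; have [_ _ /(_ i (ltn_ord i))[]] := hS.
rewrite ge0_integral_sum//; last 2 first.
- by move=> i; apply: emeasurable_funM.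
- by move=> i w _; rewrite mule_ge0// lee_fin ?sqr_ge0.
apply: eq_bigr => i _; rewrite ge0_integralZl// ?lee_fin//.
by move=> w _; rewrite lee_fin sqr_ge0.
Qed.

Lemma simple_isometry a T S : 0 <= a -> simple_on F a T S ->
  (\int[P]_w (simple_integral B S w ^+ 2)%:E = (normal_moment2 R)%:E *
   \int[P]_w \int[lebesgue_measure]_(s in `[a, T]%classic)
      (simple_value S s w ^+ 2)%:E)%E.
Proof.
by move=> a0 hS; rewrite (simple_isometry_energy a0 hS) (simple_energyE a0 hS).
Qed.

Lemma simple_running_time a T S n w : simple_on F a T S -> (n <= sp_size S)%N ->
  simple_running B S (sp_time S n) w = simple_partial S n w.
Proof.
move=> hS nS; rewrite /simple_running /simple_partial.
rewrite -(big_mkord xpredT (fun i => sp_coef S i w *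
    (B (Num.min (sp_time S n) (sp_time S i.+1)) w -
     B (Num.min (sp_time S n) (sp_time S i)) w))).
rewrite (big_cat_nat (leq0n n) nS)//= [X in _ + X]big_nat_cond [X in _ + X]big1 ?addr0.
  rewrite big_mkord; apply: eq_bigr => i _.
  have i_n := ltn_ord i.
  by rewrite !min_r//; apply: (simple_time_le hS); rewrite nS andbT// ltnW.
move=> i; rewrite andbT => /andP[ni iS].
rewrite !min_l ?subrr ?mulr0// (simple_time_le hS)// ?ni ?(ltnW iS)//.
by rewrite iS leqW.
Qed.

(** Stopping the integrand at the first time its integral exceeds e gives a
    simple process whose integral exceeds e on the whole event; the isometry
    bounds its second moment by the energy of the original process. *)
Lemma simple_maximal a T S (e : R) : 0 <= a -> simple_on F a T S -> 0 < e ->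
  ((e ^+ 2)%:E * P [set w | exists2 n, (n <= sp_size S)%N &
     (e <= `|simple_partial S n w|)%R] <= (normal_moment2 R)%:E *
   \int[P]_w \int[lebesgue_measure]_(s in `[a, T]%classic)
      (simple_value S s w ^+ 2)%:E)%E.
Proof.
move=> a0 hS e0; have t0 i : (i <= sp_size S)%N -> 0 <= sp_time S i.
  by move=> iS; have /andP[+ _] := simple_time_bounds hS iS; exact: le_trans.
pose E n := [set w | exists2 j, (j <= n)%N & e <= `|simple_partial S j w|].
have E_S n : E n.+1 = E n `|` [set w | e <= `|simple_partial S n.+1 w|].
  apply/seteqP; split => w /=.
    move=> [j]; rewrite leq_eqVlt => /predU1P[->|jn] ew; first by right.
    by left; exists j.
  by move=> [[j jn ew]|ew]; [exists j => //; exact: leqW|exists n.+1].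
have FE n : (n <= sp_size S)%N -> F (sp_time S n) (E n).
  have level j : (j <= sp_size S)%N ->
      F (sp_time S j) [set w | e <= `|simple_partial S j w|].
    move=> jS.
    have mD : measurable [set x : R | e <= `|x|].
      rewrite -[X in measurable X]setTI.
      apply: (measurable_fun_le (f := cst e) (g := fun x : R => `|x|)) => //.
    exact: (simple_partial_adapted a0 hS jS mD).
  elim: n => [|n IH] nS.
    suff -> : E 0%N = [set w | e <= `|simple_partial S 0 w|] by exact: level.
    apply/seteqP; split => w /=; last by exists 0%N.
    by move=> [j]; rewrite leqn0 => /eqP ->.
  have sF := filtration_sigma (t0 _ nS).
  rewrite E_S; apply: sub_measurableE => //; apply: measurableU.
    apply: sub_gen_smallest; apply: filtration_sub (IH (ltnW nS)).
      exact: t0 (ltnW nS).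
    by apply: (simple_time_le hS); rewrite leqnSn.
  by apply: sub_gen_smallest; exact: level.
(* the integrand switched off once the level e has been reached *)
pose S' := SimpleProcess (sp_size S) (sp_time S)
  (fun i w => sp_coef S i w * \1_(~` E i) w).
have le1 A w : `|\1_A w : R| <= 1 by rewrite indicE ger0_norm//; case: (w \in A).
have hS' : simple_on F a T S'.
  have [h1 h2 h3] := hS; split => //= i iS; have [ti mi [M hM]] := h3 i iS.
  have sF := filtration_sigma (t0 _ (ltnW iS)).
  split => //.
    apply: rv_measurableM => //; apply: rv_measurable_indic => //.
    apply: sub_measurableE => //; apply: measurableC.
    by apply: sub_gen_smallest; exact: FE (ltnW iS).
  exists M => w; rewrite normrM (le_trans _ (hM w))//.
  by rewrite ler_piMr.
have E_mono i j w : (i <= j)%N -> E i w -> E j w.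
  by move=> ij [k ki ek]; exists k => //; exact: leq_trans ij.
have stopped n w : (~ E n w -> simple_partial S' n w = simple_partial S n w) /\
    (E n w -> e <= `|simple_partial S' n w|).
  elim: n => [|n [IH1 IH2]].
    split; first by rewrite /simple_partial !big_ord0.
    by move=> [j]; rewrite leqn0 => /eqP ->; rewrite /simple_partial !big_ord0.
  have [nE|nE] := pselect (E n w).
    have e1 : simple_partial S' n.+1 w = simple_partial S' n w.
      rewrite /simple_partial big_ord_recr/= indicE memNset//=.
      by rewrite mulr0 mul0r addr0.
    rewrite e1; split; last by move=> _; exact: IH2.
    by move=> h; exfalso; apply: h; exact: E_mono nE.
  have e1 : simple_partial S' n.+1 w = simple_partial S n.+1 w.
    rewrite /simple_partial !big_ord_recr/=; congr (_ + _); first exact: IH1.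
    by rewrite indicE mem_set// mulr1.
  rewrite e1; split=> // -[j]; rewrite leq_eqVlt => /predU1P[->//|jn] ej.
  by exfalso; apply: nE; exists j.
have mE : measurable (E (sp_size S)).
  by apply: (filtration_measurable HF) (FE _ (leqnn _)); exact: t0.
have mS' : measurable_fun setT (simple_partial S' (sp_size S)).
  apply: adapted_measurable (simple_partial_adapted a0 hS' (leqnn _)).
  exact: t0.
apply: (@le_trans _ _ (\int[P]_w (simple_integral B S' w ^+ 2)%:E)%E).
  rewrite -[X in P X]setIT -integral_indic// -ge0_integralZl//; last 2 first.
  - by apply/measurable_EFinP; exact: measurable_indic.
  - by rewrite lee_fin sqr_ge0.
  apply: ge0_le_integral => //.
  - by move=> w _; rewrite mule_ge0// lee_fin sqr_ge0.
  - by apply: emeasurable_funM => //; apply/measurable_EFinP; exact: measurable_indic.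
  - by apply/measurable_EFinP/measurable_funX; exact: mS'.
  move=> w _; rewrite -EFinM lee_fin indicE.
  have [/set_mem Ew|_] := boolP (w \in _); last by rewrite mulr0 sqr_ge0.
  rewrite mulr1 -[leRHS]real_normK ?num_real// lerXn2r ?nnegrE ?(ltW e0)//.
  exact: (stopped _ w).2.
rewrite (simple_isometry_energy a0 hS') -(simple_energyE a0 hS).
apply: lee_wpmul2l; first by rewrite lee_fin normal_moment2_ge0.
apply: lee_sum => i _ /=; apply: lee_wpmul2l.
  by rewrite lee_fin subr_ge0; have [_ _ /(_ i (ltn_ord i))[]] := hS.
apply: ge0_le_integral => //.
- by move=> w _; rewrite lee_fin sqr_ge0.
- apply/measurable_EFinP/measurable_funX.
  exact: (simple_coef_measurable a0 hS' (ltn_ord i)).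
- apply/measurable_EFinP/measurable_funX.
  exact: (simple_coef_measurable a0 hS (ltn_ord i)).
- move=> w _; rewrite lee_fin exprMn ler_piMr ?sqr_ge0 ?exprn_ile1//.
Qed.

End Isometry.

(** * Mean square estimates *)

Section L2.
Context {R : realType} {d : measure_display} {T : measurableType d}.
Variable mu : {measure set T -> \bar R}.
Implicit Types (f g h : T -> R) (D : set T).

(** This weak form of Minkowski's inequality is enough to add null sequences, and
    holds without integrability. *)
Lemma integral_sqrD D f g (c : R) : measurable D ->
  measurable_fun D f -> measurable_fun D g ->
  (\int[mu]_(x in D) ((f x + c * g x) ^+ 2)%:E <=
   2%:E * \int[mu]_(x in D) (f x ^+ 2)%:E +
   (2 * c ^+ 2)%:E * \int[mu]_(x in D) (g x ^+ 2)%:E)%E.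
Proof.
move=> mD mf mg.
have m2 h : measurable_fun D h -> measurable_fun D (fun x => (h x ^+ 2)%:E).
  by move=> mh; apply/measurable_EFinP; exact: measurable_funX.
have p2 h x : (0 <= (h x ^+ 2)%:E)%E by rewrite lee_fin sqr_ge0.
have c2 : 0 <= 2 * c ^+ 2 by rewrite mulr_ge0 ?sqr_ge0.
rewrite -!ge0_integralZl ?lee_fin//; [|exact: m2..].
rewrite -ge0_integralD//; last 4 first.
- by move=> x _; rewrite mule_ge0// lee_fin.
- by apply: emeasurable_funM => //; exact: m2.
- by move=> x _; rewrite mule_ge0// lee_fin.
- by apply: emeasurable_funM => //; exact: m2.
apply: ge0_le_integral => //.
- by move=> x _; rewrite lee_fin sqr_ge0.
- by apply: m2; apply: measurable_funD => //; exact: measurable_funM.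
- by apply: emeasurable_funD; apply: emeasurable_funM => //; exact: m2.
- move=> x _; rewrite -!EFinM -EFinD lee_fin.
  by have := sqr_ge0 (f x - c * g x); nra.
Qed.

End L2.

Section ErealSqueeze.
Context {R : realType}.

Lemma cvge0_dominated (c1 c2 : R) (u v w : nat -> \bar R) :
  (forall n, 0 <= u n <= c1%:E * v n + c2%:E * w n)%E ->
  v @ \oo --> 0%E -> w @ \oo --> 0%E -> u @ \oo --> 0%E.
Proof.
move=> uvw v0 w0.
have h : (c1%:E * v n + c2%:E * w n @[n --> \oo] --> 0)%E.
  rewrite -[X in _ --> X]adde0; apply: cvgeD => //.
  - by rewrite -(mule0 c1%:E); apply: cvgeZl.
  - by rewrite -(mule0 c2%:E); apply: cvgeZl.
apply: (squeeze_cvge _ (cvg_cst 0%E) h).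
by apply: nearW.
Qed.

End ErealSqueeze.

Section MeanValue.
Context {R : realType} {d : measure_display} {Omega : measurableType d}.
Variable P : probability Omega R.

(** A function cannot exceed its mean by e everywhere. *)
Lemma exists_le_mean (g : Omega -> \bar R) (e : R) : 0 < e ->
  measurable_fun setT g -> (forall w, 0 <= g w)%E ->
  exists w, (g w <= \int[P]_w g w + e%:E)%E.
Proof.
move=> e0 mg g0.
have I0 : (0 <= \int[P]_w g w)%E by apply: integral_ge0.
have [If|] := boolP (\int[P]_w g w \is a fin_num)%E; last first.
  rewrite ge0_fin_numE// -leNgt leye_eq => /eqP ->.
  by exists point; rewrite addye// leey.
apply: contrapT => /forallNP h.
have : (\int[P]_w (\int[P]_w g w + e%:E) <= \int[P]_w g w)%E.
  apply: ge0_le_integral => //.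
  - by move=> w _; rewrite adde_ge0// lee_fin ltW.
  - by move=> w _; apply: ltW; rewrite ltNge; apply/negP; exact: h.
rewrite integral_cst// [X in (_ * X)%E](probability_setT P) mule1 -(fineK If).
by rewrite /= lee_fin gerDl leNgt e0.
Qed.

End MeanValue.

(** * The Wiener integral *)

Section SimpleValueMeasurable.
Context {R : realType} {d : measure_display} {Omega : measurableType d}.
Implicit Type S : @simple_process R d Omega.

Let measurable_cell (p q : R) :
  measurable_fun setT (fun s : measurableTypeR R => (p < s <= q)%R%:R : R).
Proof.
rewrite (_ : (fun s => _) = \1_(`]p, q]%classic)); first exact: measurable_indic.
by apply/funext => s; rewrite indicE mem_setE in_itv.
Qed.

Lemma measurable_simple_value S :
  (forall i, (i < sp_size S)%N -> measurable_fun setT (sp_coef S i)) ->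
  measurable_fun setT
    (fun p : Omega * measurableTypeR R => simple_value S p.2 p.1).
Proof.
move=> mS; apply: measurable_sum => i; apply: measurable_funM.
  by apply: (measurableT_comp (mS i (ltn_ord i))).
exact: (measurableT_comp (measurable_cell _ _)).
Qed.

Lemma measurable_simple_valuel S w (D : set R) :
  measurable_fun D (fun s => simple_value S s w).
Proof.
apply: measurable_funTS; apply: measurable_sum => i.
apply: measurable_funM; first exact: measurable_cst.
exact: measurable_cell.
Qed.

End SimpleValueMeasurable.

Section WienerIntegral.
Context {R : realType} {d : measure_display} {Omega : measurableType d}.
Variable P : probability Omega R.
Variables (F : R -> set (set Omega)) (B : R -> Omega -> R).
Hypotheses (HF : usual_conditions P F) (HB : brownian_motion P F B).
Implicit Types (S : @simple_process R d Omega) (h : R -> R) (J : Omega -> R).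
Local Notation leb := lebesgue_measure.

(** The Ito integral of a deterministic integrand (Wiener integral): the
    approximating step functions may be taken deterministic as well, which
    makes their integrals normal variables. *)
Definition wiener_integral (a t : R) h J : Prop :=
  exists S : nat -> simple_process,
    [/\ forall n, simple_on F a t (S n),
        forall n i w w', sp_coef (S n) i w = sp_coef (S n) i w',
        (fun n => \int[leb]_(s in `]a, t]%classic)
           ((simple_value (S n) s point - h s) ^+ 2)%:E)%E @ \oo --> 0%E &
        (fun n => \int[P]_w
           ((simple_integral B (S n) w - J w) ^+ 2)%:E)%E @ \oo --> 0%E].

Lemma measurable_simple_integral (a t : R) S : 0 <= a -> simple_on F a t S ->
  measurable_fun setT (simple_integral B S).
Proof.
move=> a0 hS; apply: (adapted_measurable HF (t := sp_time S (sp_size S))).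
  exact: (le_trans a0 (proj1 (andP (simple_time_bounds hS (leqnn _))))).
exact: (simple_partial_adapted HF HB a0 hS (leqnn _)).
Qed.

(** The mean over w of the squared distance between S_n(w) and h tends to zero,
    so some path S_n(w_n) is close to h; it is a deterministic step function. Its
    integral has the same limit, because the isometry bounds its distance to the
    integral of S_n by the two distances to h. *)
Lemma ito_wiener (a t : R) h J : 0 <= a -> measurable_fun `[a, t]%classic h ->
  measurable_fun setT J ->
  is_ito_integral P F B a t (fun s _ => h s) J -> wiener_integral a t h J.
Proof.
move=> a0 mh mJ [S [hS S1 S2]].
have mcoef n i : (i < sp_size (S n))%N -> measurable_fun setT (sp_coef (S n) i).
  exact: (simple_coef_measurable HF a0 (hS n)).
pose g n w := (\int[leb]_(s in `[a, t]%classic)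
  ((simple_value (S n) s w - h s) ^+ 2)%:E)%E.
have g0 n w : (0 <= g n w)%E by apply: integral_ge0 => s _; rewrite lee_fin sqr_ge0.
have mg n : measurable_fun setT (g n).
  pose f (p : Omega * measurableTypeR R) := ((simple_value (S n) p.2 p.1 -
    (h \_ `[a, t]%classic) p.2) ^+ 2 * \1_(`[a, t]%classic) p.2)%:E.
  have mf : measurable_fun setT f.
    apply/measurable_EFinP/measurable_funM.
      apply: measurable_funX; apply: measurable_funB.
        by apply: measurable_simple_value; exact: mcoef.
      apply: (measurableT_comp (f := h \_ `[a, t]%classic)) => //.
      exact/(measurable_restrictT _ _).1.
    by apply: measurableT_comp => //; exact: measurable_indic.
  have f0 p : (0 <= f p)%E by rewrite lee_fin mulr_ge0 ?sqr_ge0.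
  rewrite (_ : g n = fubini_F leb f).
    exact: measurable_fun_fubini_tonelli_F.
  apply/funext => w; rewrite /g /fubini_F [LHS]integral_mkcond.
  apply: eq_integral => s _; rewrite /f /= !patchE indicE.
  by case: ifPn => _; rewrite ?mulr1 ?mulr0.
have mint n := measurable_simple_integral a0 (hS n).
have /choice[w hw] n : exists w, (g n w <= \int[P]_w g n w + (n.+1%:R^-1)%:E)%E.
  by apply: exists_le_mean => //; rewrite invr_gt0.
pose S' n := SimpleProcess (sp_size (S n)) (sp_time (S n))
  (fun i _ => sp_coef (S n) i (w n)) : @simple_process R d Omega.
have t0 n i : (i <= sp_size (S n))%N -> 0 <= sp_time (S n) i.
  by move=> iS; have /andP[+ _] := simple_time_bounds (hS n) iS; exact: le_trans.
have hS' n : simple_on F a t (S' n).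
  have [h1 h2 h3] := hS n; split => //= i iS; have [ti mi [M hM]] := h3 i iS.
  split => //; last by exists M.
  by apply: rv_measurable_cst; apply: (filtration_sigma HF); exact: t0 (ltnW iS).
have inv0 : (fun n : nat => (n.+1%:R^-1)%:E : \bar R) @ \oo --> 0%E.
  by apply/fine_cvgP; split; [exact: nearW|exact: cvg_harmonic].
have gw0 : (fun n => g n (w n)) @ \oo --> 0%E.
  apply: (cvge0_dominated (c1 := 1) (c2 := 1) _ S1 inv0) => n.
  by rewrite g0 !mul1e hw.
exists S'; split => //.
  apply: (cvge0_dominated (c1 := 1) (c2 := 0) _ gw0 gw0) => n.
  rewrite integral_ge0/=; last by move=> s _; rewrite lee_fin sqr_ge0.
  rewrite mul1e mul0e adde0; apply: ge0_subset_integral => //.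
  - apply/measurable_EFinP/measurable_funX/measurable_funB => //.
    exact: measurable_simple_valuel.
  - by move=> s _; rewrite lee_fin sqr_ge0.
  - by apply: subset_itvr; rewrite bnd_simp.
pose D n := SimpleProcess (sp_size (S n)) (sp_time (S n))
  (fun i v => sp_coef (S n) i (w n) - sp_coef (S n) i v) : @simple_process R d Omega.
have hD n : simple_on F a t (D n).
  have [h1 h2 h3] := hS n; have [_ _ h3'] := hS' n; split => //= i iS.
  have [ti mi [M hM]] := h3 i iS; have [_ mi' [M' hM']] := h3' i iS.
  split => //.
    by apply: rv_measurableB => //; apply: (filtration_sigma HF); exact: t0 (ltnW iS).
  exists (M' + M) => v; apply: le_trans (ler_normB _ _) _.
  by rewrite lerD// (hM' v).
have Dint n v : simple_integral B (S' n) v - simple_integral B (S n) v =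
    simple_integral B (D n) v.
  by rewrite /simple_integral -sumrB; apply: eq_bigr => i _; rewrite -mulrBl.
have Dval n s v : simple_value (D n) s v =
    simple_value (S n) s (w n) - simple_value (S n) s v.
  by rewrite /simple_value -sumrB; apply: eq_bigr => i _; rewrite -mulrBl.
have D0 : (fun n => \int[P]_v (simple_integral B (D n) v ^+ 2)%:E)%E @ \oo --> 0%E.
  have k0 := normal_moment2_ge0 (R := R).
  apply: (cvge0_dominated (c1 := normal_moment2 R * 2) (c2 := normal_moment2 R * 2)
    _ gw0 S1) => n.
  rewrite integral_ge0/=; last by move=> v _; rewrite lee_fin sqr_ge0.
  rewrite (simple_isometry HF HB a0 (hD n)) !EFinM -!muleA -ge0_muleDr; last 2 first.
  - by rewrite mule_ge0.
  - by rewrite mule_ge0//; apply: integral_ge0 => v _; exact: g0.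
  rewrite lee_wpmul2l ?lee_fin//.
  apply: (@le_trans _ _ (\int[P]_v (2%:E * g n (w n) + 2%:E * g n v))%E).
    apply: ge0_le_integral => //.
    - by move=> v _; apply: integral_ge0 => s _; rewrite lee_fin sqr_ge0.
    - under eq_fun => v do rewrite (simple_integral_sqr v (hD n)).
      apply: emeasurable_sum => i; apply: emeasurable_funM => //.
      apply/measurable_EFinP; apply: measurable_funX.
      exact: (simple_coef_measurable HF a0 (hD n) (ltn_ord i)).
    - by apply: emeasurable_funD; apply: emeasurable_funM.
    move=> v _.
    under eq_integral => s _.
      rewrite Dval (_ : _ - _ = (simple_value (S n) s (w n) - h s) +
        (-1) * (simple_value (S n) s v - h s)); last by ring.
      over.
    have ms v' : measurable_fun `[a, t]%classic (fun s => simple_value (S n) s v' - h s).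
      by apply: measurable_funB => //; exact: measurable_simple_valuel.
    by have := integral_sqrD leb (-1) (measurable_itv _) (ms (w n)) (ms v);
      rewrite sqrrN expr1n mulr1.
  rewrite ge0_integralD//; try by move=> v _; rewrite mule_ge0.
    by rewrite integral_cst// [X in (_ * X + _)%E](probability_setT P) mule1 ge0_integralZl.
  by apply: emeasurable_funM.
apply: (cvge0_dominated (c1 := 2) (c2 := 2) _ D0 S2) => n.
rewrite integral_ge0/=; last by move=> v _; rewrite lee_fin sqr_ge0.
under eq_integral => v _.
  rewrite (_ : _ - _ = simple_integral B (D n) v +
    1 * (simple_integral B (S n) v - J v)); last by rewrite -Dint; ring.
  over.
have := integral_sqrD P 1 measurableT (measurable_simple_integral a0 (hD n))
  (measurable_funB (mint n) mJ).
by rewrite expr1n mulr1.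
Qed.

End WienerIntegral.

Section WienerIntegralTheory.
Context {R : realType} {d : measure_display} {Omega : measurableType d}.
Variable P : probability Omega R.
Variables (F : R -> set (set Omega)) (B : R -> Omega -> R).
Hypotheses (HF : usual_conditions P F) (HB : brownian_motion P F B).
Implicit Types (S : @simple_process R d Omega) (h : R -> R) (J : Omega -> R).
Local Notation leb := lebesgue_measure.
Local Notation wiener_integral := (wiener_integral P F B).

Lemma deterministic_value S s w w' :
  (forall i w w', sp_coef S i w = sp_coef S i w') ->
  simple_value S s w = simple_value S s w'.
Proof. by move=> cS; apply: eq_bigr => i _; rewrite (cS i w w'). Qed.

Lemma wiener_ito (a t : R) h J : measurable_fun `[a, t]%classic h ->
  wiener_integral a t h J -> is_ito_integral P F B a t (fun s _ => h s) J.
Proof.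
move=> mh [S [hS cS S1 S2]]; exists S; split => //.
rewrite (_ : (fun n => _) = (fun n => \int[leb]_(s in `]a, t]%classic)
           ((simple_value (S n) s point - h s) ^+ 2)%:E)%E)//.
apply/funext => n.
under eq_integral => w _.
  under eq_integral => s _ do rewrite (deterministic_value s w point (cS n)).
  over.
rewrite integral_cst// [X in (_ * X)%E](probability_setT P) mule1.
rewrite integral_itv_obnd_cbnd//.
apply/measurable_EFinP/measurable_funX/measurable_funB.
  exact: measurable_simple_valuel.
by apply: measurable_funS mh => //; apply: subset_itvr; rewrite bnd_simp.
Qed.

Lemma eq_wiener_integral (a t : R) h h' J :
  (forall s, a < s <= t -> h s = h' s) ->
  wiener_integral a t h J -> wiener_integral a t h' J.
Proof.
move=> hh' [S [hS cS S1 S2]]; exists S; split => //.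
rewrite (_ : (fun n => _) = (fun n => \int[leb]_(s in `]a, t]%classic)
           ((simple_value (S n) s point - h s) ^+ 2)%:E)%E)//.
apply/funext => n; apply: eq_integral => s; rewrite inE/= in_itv/= => sat.
by rewrite hh'.
Qed.

Lemma wiener_linear (a t c : R) h1 h2 J1 J2 : 0 <= a ->
  measurable_fun `]a, t]%classic h1 -> measurable_fun `]a, t]%classic h2 ->
  measurable_fun setT J1 -> measurable_fun setT J2 ->
  wiener_integral a t h1 J1 -> wiener_integral a t h2 J2 ->
  wiener_integral a t (fun s => h1 s + c * h2 s) (fun w => J1 w + c * J2 w).
Proof.
move=> a0 mh1 mh2 mJ1 mJ2 [S1 [hS1 cS1 S1a S1b]] [S2 [hS2 cS2 S2a S2b]].
have /choice[S hS] n : exists S, [/\ simple_on F a t S,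
    forall s w, simple_value S s w =
      simple_value (S1 n) s w + c * simple_value (S2 n) s w,
    forall w, simple_integral B S w =
      simple_integral B (S1 n) w + c * simple_integral B (S2 n) w &
    forall i w w', sp_coef S i w = sp_coef S i w'].
  have [S [hS Sv Sr Sc _]] := simple_combine c (Q := [::]) (filtration_sigma HF)
    (filtration_sub HF) a0 (hS1 n) (hS2 n) (fun q => ltac:(done)).
  exists S; split => //.
    move=> w; rewrite -(simple_running_end B w hS) Sr.
    by rewrite (simple_running_end B w (hS1 n)) (simple_running_end B w (hS2 n)).
  move=> i w w'; rewrite !Sc (deterministic_value _ w w' (cS1 n)).
  by rewrite (deterministic_value _ w w' (cS2 n)).
have mint n := measurable_simple_integral HF HB a0.
exists S; split.
- by move=> n; have [] := hS n.
- by move=> n; have [] := hS n.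
- apply: (cvge0_dominated (c1 := 2) (c2 := 2 * c ^+ 2) _ S1a S2a) => n.
  rewrite integral_ge0/=; last by move=> s _; rewrite lee_fin sqr_ge0.
  have [_ Sv _ _] := hS n.
  under eq_integral => s _.
    rewrite Sv (_ : _ - _ = (simple_value (S1 n) s point - h1 s) +
        c * (simple_value (S2 n) s point - h2 s)); last by ring.
    over.
  apply: integral_sqrD => //; apply: measurable_funB => //;
    exact: measurable_simple_valuel.
- apply: (cvge0_dominated (c1 := 2) (c2 := 2 * c ^+ 2) _ S1b S2b) => n.
  rewrite integral_ge0/=; last by move=> s _; rewrite lee_fin sqr_ge0.
  have [_ _ Sr _] := hS n.
  under eq_integral => w _.
    rewrite Sr (_ : _ - _ = (simple_integral B (S1 n) w - J1 w) +
        c * (simple_integral B (S2 n) w - J2 w)); last by ring.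
    over.
  by apply: integral_sqrD => //; apply: measurable_funB => //;
    [exact: (measurable_simple_integral HF HB a0 (hS1 n))|
     exact: (measurable_simple_integral HF HB a0 (hS2 n))].
Qed.

Lemma deterministic_energy (a t : R) S :
  (forall i w w', sp_coef S i w = sp_coef S i w') ->
  (\int[P]_w \int[leb]_(s in `[a, t]%classic) (simple_value S s w ^+ 2)%:E =
   \int[leb]_(s in `]a, t]%classic) (simple_value S s point ^+ 2)%:E)%E.
Proof.
move=> cS; under eq_integral => w _.
  under eq_integral => s _ do rewrite (deterministic_value s w point cS).
  over.
rewrite integral_cst// [X in (_ * X)%E](probability_setT P) mule1.
rewrite integral_itv_obnd_cbnd//.
by apply/measurable_EFinP/measurable_funX; exact: measurable_simple_valuel.
Qed.

Lemma deterministic_isometry (a t : R) S : 0 <= a -> simple_on F a t S ->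
  (forall i w w', sp_coef S i w = sp_coef S i w') ->
  (\int[P]_w (simple_integral B S w ^+ 2)%:E = (normal_moment2 R)%:E *
   \int[leb]_(s in `]a, t]%classic) (simple_value S s point ^+ 2)%:E)%E.
Proof.
move=> a0 hS cS.
by rewrite (simple_isometry HF HB a0 hS) deterministic_energy.
Qed.

(** The difference is a Wiener integral of zero; by the isometry the integrals
    approximating it tend to zero. *)
Lemma wiener_integral_unique (a t : R) h J1 J2 : 0 <= a ->
  measurable_fun `]a, t]%classic h ->
  measurable_fun setT J1 -> measurable_fun setT J2 ->
  wiener_integral a t h J1 -> wiener_integral a t h J2 ->
  {ae P, forall w, J1 w = J2 w}.
Proof.
move=> a0 mh mJ1 mJ2 w1 w2.
have [S [hS cS Sa Sb]] := wiener_linear (-1) a0 mh mh mJ1 mJ2 w1 w2.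
set J := (fun w => J1 w + -1 * J2 w) in Sb.
have mJ : measurable_fun setT J by apply: measurable_funD => //; exact: measurable_funM.
have k0 := normal_moment2_ge0 (R := R).
have Sc : (fun n => \int[P]_w (simple_integral B (S n) w ^+ 2)%:E)%E @ \oo --> 0%E.
  apply: (cvge0_dominated (c1 := normal_moment2 R) (c2 := 0) _ Sa Sa) => n.
  rewrite integral_ge0/=; last by move=> w _; rewrite lee_fin sqr_ge0.
  rewrite (deterministic_isometry a0 (hS n) (cS n)) mul0e adde0.
  rewrite le_eqVlt; apply/orP; left; apply/eqP; congr (_ * _)%E.
  by apply: eq_integral => s _; rewrite mulN1r subrr subr0.
have J0 : (\int[P]_w (J w ^+ 2)%:E = 0)%E.
  have cJ : (fun n : nat => \int[P]_w (J w ^+ 2)%:E)%E @ \oo --> 0%E.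
    apply: (cvge0_dominated (c1 := 2) (c2 := 2) _ Sc Sb) => n.
    rewrite integral_ge0/=; last by move=> w _; rewrite lee_fin sqr_ge0.
    under eq_integral => w _.
      rewrite (_ : J w = simple_integral B (S n) w +
        (-1) * (simple_integral B (S n) w - J w)); last by ring.
      over.
    have mI := measurable_simple_integral HF HB a0 (hS n).
    by have := integral_sqrD P (-1) measurableT mI (measurable_funB mI mJ);
      rewrite sqrrN expr1n mulr1.
  by rewrite -(cvg_lim _ cJ)// lim_cst.
have mJ2' : measurable_fun setT (fun w => (J w ^+ 2)%:E).
  by apply/measurable_EFinP; exact: measurable_funX.
have : ae_eq P setT (fun w => (J w ^+ 2)%:E) (cst 0%E).
  apply/(ae_eq_integral_abs P measurableT mJ2').
  rewrite -[RHS]J0; apply: eq_integral => w _.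
  by rewrite gee0_abs// lee_fin sqr_ge0.
apply: filterS => w /(_ I) [] /eqP; rewrite sqrf_eq0 /J mulN1r subr_eq0.
by move=> /eqP.
Qed.

End WienerIntegralTheory.

(** * Limits in mean square and in probability *)

Section L2Limit.
Context {R : realType}.
Local Notation leb := lebesgue_measure.
Implicit Types (a t M : R) (h : R -> R).

(** Young's inequality, applied to the cross term of (x + z)^2 with z = y - x. *)
Lemma sqr_perturb (M e x y : R) : `|x| <= M -> 0 < e ->
  y ^+ 2 <= x ^+ 2 + e + (1 + M ^+ 2 / e) * (y - x) ^+ 2 /\
  x ^+ 2 <= y ^+ 2 + e + (1 + M ^+ 2 / e) * (y - x) ^+ 2.
Proof.
move=> xM e0; set z := y - x.
have -> : y = x + z by rewrite /z; ring.
have M2 : x ^+ 2 <= M ^+ 2.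
  by rewrite -real_normK ?num_real// lerXn2r ?nnegrE// (le_trans _ xM).
have k : 2 * `|x * z| <= e + M ^+ 2 / e * z ^+ 2.
  have : 0 <= (e - `|x * z|) ^+ 2 / e by rewrite divr_ge0 ?sqr_ge0 ?ltW.
  have -> : (e - `|x * z|) ^+ 2 / e = e - 2 * `|x * z| + `|x * z| ^+ 2 / e.
    by field; rewrite gt_eqF.
  rewrite real_normK ?num_real// exprMn.
  have : x ^+ 2 * z ^+ 2 / e <= M ^+ 2 / e * z ^+ 2.
    by rewrite mulrAC ler_wpM2r ?sqr_ge0// ler_wpM2r// invr_ge0 ltW.
  lra.
have h1 := ler_norm (x * z); have h2 := ler_norm (- (x * z)).
rewrite normrN in h2; rewrite mulrDl mul1r sqrrD.
split; nra.
Qed.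

(** Convergence in the mean square on a bounded interval preserves the limit of
    the norms. With sqr_perturb a tolerance e on the squares costs e times the
    length of the interval plus a constant times the squared distance. *)
Lemma l2_norm_cvg a t M h (s_ : nat -> R -> R) (v_ : nat -> R) (V : R) :
  measurable_fun `]a, t]%classic h ->
  (forall s, a < s <= t -> `|h s| <= M) ->
  (forall n, measurable_fun `]a, t]%classic (s_ n)) ->
  (fun n => \int[leb]_(s in `]a, t]%classic) ((s_ n s - h s) ^+ 2)%:E)%E
    @ \oo --> 0%E ->
  (forall n, \int[leb]_(s in `]a, t]%classic) (s_ n s ^+ 2)%:E = (v_ n)%:E)%E ->
  (\int[leb]_(s in `]a, t]%classic) (h s ^+ 2)%:E = V%:E)%E ->
  v_ @ \oo --> V.
Proof.
move=> mh hM ms d0 v_E VE.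
pose D := `]a, t]%classic; pose L := fine (leb D).
have mD : measurable D by exact: measurable_itv.
have LE : (leb D = L%:E)%E.
  by rewrite /L fineK// /D lebesgue_measure_itv/=; case: ifP.
have L0 : 0 <= L by rewrite /L fine_ge0.
have m2 (f : R -> R) : measurable_fun D f ->
    measurable_fun D (fun s => (f s ^+ 2)%:E).
  by move=> mf; apply/measurable_EFinP; exact: measurable_funX.
have key (f g k : R -> R) (e C x y : R) (z : \bar R) : 0 < e -> 0 <= C ->
    measurable_fun D f -> measurable_fun D g -> measurable_fun D k ->
    (forall s, a < s <= t -> f s ^+ 2 <= g s ^+ 2 + e + C * k s ^+ 2) ->
    (\int[leb]_(s in D) (f s ^+ 2)%:E = x%:E)%E ->
    (\int[leb]_(s in D) (g s ^+ 2)%:E = y%:E)%E ->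
    (\int[leb]_(s in D) (k s ^+ 2)%:E = z)%E ->
    (x%:E <= y%:E + (e * L)%:E + C%:E * z)%E.
  move=> e0 C0 mf mg mk fgk <- <- <-.
  rewrite EFinM -LE -[X in (_ + X + _)%E](integral_cst leb mD).
  rewrite -ge0_integralZl ?lee_fin//; [|exact: m2|]; last first.
    by move=> s _; rewrite lee_fin sqr_ge0.
  have mCk : measurable_fun D (fun s => (C%:E * (k s ^+ 2)%:E)%E).
    by apply: emeasurable_funM => //; exact: m2.
  have mgk : measurable_fun D (fun s => (g s ^+ 2)%:E + e%:E)%E.
    by apply: emeasurable_funD => //; exact: m2.
  have gk0 s : (0 <= (g s ^+ 2)%:E + e%:E)%E.
    by rewrite adde_ge0// lee_fin ?sqr_ge0// ltW.
  have k0 s : (0 <= C%:E * (k s ^+ 2)%:E)%E.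
    by rewrite mule_ge0// lee_fin sqr_ge0.
  rewrite -[X in (_ <= X + _)%E]ge0_integralD//; try first
    [exact: m2|by move=> s _; rewrite lee_fin ?sqr_ge0// ltW].
  rewrite -ge0_integralD//.
  apply: ge0_le_integral => //.
  - by move=> s _; rewrite lee_fin sqr_ge0.
  - exact: m2.
  - by apply: emeasurable_funD => //; apply: emeasurable_funD => //; exact: m2.
apply/cvgrPdist_le => e e0.
pose e' := e / (2 * (L + 1)).
have e'0 : 0 < e' by rewrite /e' divr_gt0// mulr_gt0// ltr_wpDl.
pose C := 1 + M ^+ 2 / e'.
have C0 : 0 < C by rewrite /C ltr_pwDl// divr_ge0 ?sqr_ge0 ?ltW.
have eC0 : 0 < e / (2 * C) by rewrite divr_gt0// mulr_gt0.
have e'L : e' * L <= e / 2.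
  have L1 : 0 < 2 * (L + 1) by rewrite mulr_gt0// ltr_wpDl.
  rewrite /e' mulrAC ler_pdivrMr// mulrA divfK// mulrDr mulr1 lerDl ltW//.
move/fine_cvgP : d0 => [dfin /cvgrPdist_le/(_ _ eC0) d0].
near=> n.
have dnf : (\int[leb]_(s in D) ((s_ n s - h s) ^+ 2)%:E)%E \is a fin_num.
  by near: n.
have : `|0 - fine (\int[leb]_(s in D) ((s_ n s - h s) ^+ 2)%:E)%E| <= e / (2 * C).
  by near: n.
set dn := (\int[leb]_(s in D) ((s_ n s - h s) ^+ 2)%:E)%E in dnf * => dn_le'.
have dnE : dn = (fine dn)%:E by rewrite fineK.
have dn_le : C * fine dn <= e / 2.
  move: dn_le'; rewrite sub0r normrN => /(le_trans (ler_norm _)).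
  by rewrite ler_pdivlMr ?mulr_gt0//; lra.
have mk : measurable_fun D (fun s => s_ n s - h s) by exact: measurable_funB.
have h1 := key (s_ n) h _ e' C _ _ _ e'0 (ltW C0) (ms n) mh mk
  (fun s sat => (sqr_perturb (s_ n s) (hM s sat) e'0).1) (v_E n) VE dnE.
have h2 := key h (s_ n) _ e' C _ _ _ e'0 (ltW C0) mh (ms n) mk
  (fun s sat => (sqr_perturb (s_ n s) (hM s sat) e'0).2) VE (v_E n) dnE.
move: h1 h2; rewrite -!EFinM -!EFinD !lee_fin => h1 h2.
rewrite ler_norml; apply/andP; split; lra.
Unshelve. all: by end_near. Qed.

End L2Limit.

Section Chebyshev.
Context {R : realType} {d : measure_display} {Omega : measurableType d}.
Variable P : probability Omega R.

Lemma measurable_norm_ge (X : Omega -> R) (e : R) : measurable_fun setT X ->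
  measurable [set w | e <= `|X w|].
Proof.
move=> mX; rewrite -[X in measurable X]setTI.
apply: (measurable_fun_le (f := cst e) (g := fun w => `|X w|)) => //.
exact: measurableT_comp.
Qed.

Lemma measurable_sublevel (X : Omega -> R) (x : R) : measurable_fun setT X ->
  measurable [set w | X w <= x].
Proof.
move=> mX; rewrite -[X in measurable X]setTI.
exact: (measurable_fun_le (f := X) (g := cst x)).
Qed.

Lemma chebyshev_sqr (X : Omega -> R) (e : R) : 0 < e -> measurable_fun setT X ->
  (P [set w | e <= `|X w|]%R <= (e ^- 2)%:E * \int[P]_w (X w ^+ 2)%:E)%E.
Proof.
move=> e0 mX; have mE := measurable_norm_ge e mX.
rewrite -[X in P X]setIT -integral_indic//.
rewrite -ge0_integralZl//; last 3 first.
- by apply/measurable_EFinP; exact: measurable_funX.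
- by move=> w _; rewrite lee_fin sqr_ge0.
- by rewrite lee_fin invr_ge0 sqr_ge0.
apply: ge0_le_integral => //.
- by apply/measurable_EFinP; exact: measurable_indic.
- by apply: emeasurable_funM => //; apply/measurable_EFinP; exact: measurable_funX.
move=> w _; rewrite -EFinM lee_fin indicE.
have [/set_mem Ew|_] := boolP (w \in _); last first.
  by rewrite mulr_ge0 ?sqr_ge0// invr_ge0 sqr_ge0.
rewrite mulrC ler_pdivlMr ?exprn_gt0// mul1r -[leRHS]real_normK ?num_real//.
by rewrite lerXn2r// nnegrE ltW.
Qed.

End Chebyshev.

(** * The law of the Wiener integral *)

Section WienerLaw.
Context {R : realType} {d : measure_display} {Omega : measurableType d}.
Variable P : probability Omega R.
Variables (F : R -> set (set Omega)) (B : R -> Omega -> R).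
Hypotheses (HF : usual_conditions P F) (HB : brownian_motion P F B).
Implicit Types (S : @simple_process R d Omega) (h : R -> R) (J : Omega -> R).
Local Notation leb := lebesgue_measure.
Local Notation wiener_integral := (wiener_integral P F B).
Local Notation cdf := std_normal_cdf.

(** Each increment is independent of xi and of the earlier ones, so the law stays
    normal and the variance grows by the squared coefficient times the length of
    the cell. *)
Lemma deterministic_law (a t m v : R) S xi : 0 <= a -> simple_on F a t S ->
  (forall i w w', sp_coef S i w = sp_coef S i w') ->
  rv_measurable (F a) xi -> 0 < v -> has_normal_law P xi m v ->
  exists2 u, 0 <= u &
    (\int[leb]_(s in `]a, t]%classic) (simple_value S s point ^+ 2)%:E = u%:E)%E /\
    has_normal_law P (fun w => xi w + simple_integral B S w) m (v + u).
Proof.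
move=> a0 hS cS mxi v0 lxi.
pose var n := \sum_(i < n) (sp_time S i.+1 - sp_time S i) * sp_coef S i point ^+ 2.
have var_ge0 n : (n <= sp_size S)%N -> 0 <= var n.
  move=> nS; apply: sumr_ge0 => i _; rewrite mulr_ge0 ?sqr_ge0// subr_ge0.
  by have [_ _ /(_ i (leq_trans (ltn_ord i) nS))[]] := hS.
exists (var (sp_size S)); first exact: var_ge0.
split.
  rewrite integral_itv_obnd_cbnd; last first.
    by apply/measurable_EFinP; apply: measurable_funX; exact: measurable_simple_valuel.
  rewrite (simple_integral_sqr point hS) -sumEFin.
  by apply: eq_bigr => i _; rewrite EFinM.
have t0 i : (i <= sp_size S)%N -> 0 <= sp_time S i.
  by move=> iS; have /andP[+ _] := simple_time_bounds hS iS; exact: le_trans.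
suff H n : (n <= sp_size S)%N ->
    has_normal_law P (fun w => xi w + simple_partial B S n w) m (v + var n).
  exact: H (leqnn _).
elim: n => [|n IH] nS.
  rewrite /var big_ord0 addr0 (_ : (fun w => _) = xi)//.
  by apply/funext => w; rewrite /simple_partial big_ord0 addr0.
have {}IH := IH (ltnW nS).
pose Z w := B (sp_time S n.+1) w - B (sp_time S n) w.
have -> : (fun w => xi w + simple_partial B S n.+1 w) =
    (fun w => (xi w + simple_partial B S n w) + sp_coef S n point * Z w).
  apply/funext => w; rewrite /simple_partial big_ord_recr/= addrA.
  by rewrite (cS n w point).
rewrite /var big_ord_recr/= -/(var n) addrA [X in _ + X]mulrC.
have [_ _ /(_ n nS)[tn mn _]] := hS.
move: tn; rewrite le_eqVlt => /predU1P[tn|tn].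
  rewrite tn subrr mulr0 addr0 (_ : (fun w => _) = fun w => xi w + simple_partial B S n w)//.
  by apply/funext => w; rewrite /Z tn subrr mulr0 addr0.
have sFn := filtration_sigma HF (t0 _ (ltnW nS)).
have FnM : F (sp_time S n) `<=` measurable.
  by apply: (filtration_measurable HF); exact: t0 (ltnW nS).
have mU : rv_measurable (F (sp_time S n)) (fun w => xi w + simple_partial B S n w).
  apply: rv_measurableD; [exact: sFn| |
    exact: (simple_partial_adapted HF HB a0 hS (ltnW nS))].
  apply: rv_measurableS mxi; apply: (filtration_sub HF) => //.
  by have /andP[] := simple_time_bounds hS (ltnW nS).
have mZ : measurable_fun setT Z.
  apply: measurable_funB.
    exact: (adapted_measurable HF (t0 _ nS) (bm_adapted HB (t0 _ nS))).
  exact: (adapted_measurable HF (t0 _ (ltnW nS)) (bm_adapted HB (t0 _ (ltnW nS)))).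
have iZ := bm_independent HB (t0 _ (ltnW nS)) tn.
have lZ := bm_normal HB (t0 _ (ltnW nS)) tn.
have vn0 : 0 < v + var n by rewrite ltr_wpDr// var_ge0// ltnW.
have dt0 : 0 < sp_time S n.+1 - sp_time S n by rewrite subr_gt0.
exact: (normal_law_add (sp_coef S n point) HF HB sFn FnM mU IH mZ iZ lZ vn0 dt0).
Qed.

(** xi + J is the limit in probability of sums with a known normal law; its
    distribution function is squeezed between shifts of theirs. *)
Lemma wiener_integral_cdf (a t m v M V x : R) h xi J :
  0 <= a -> rv_measurable (F a) xi -> 0 < v -> has_normal_law P xi m v ->
  measurable_fun `]a, t]%classic h -> (forall s, a < s <= t -> `|h s| <= M) ->
  (\int[leb]_(s in `]a, t]%classic) (h s ^+ 2)%:E = V%:E)%E ->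
  measurable_fun setT J -> wiener_integral a t h J ->
  P [set w | xi w + J w <= x] = (cdf ((x - m) / Num.sqrt (v + V)))%:E.
Proof.
move=> a0 mxi v0 lxi mh hM VE mJ [S [hS cS S1 S2]].
have mxi' := adapted_measurable HF a0 mxi.
have /choice[u hu] n : exists u, 0 <= u /\
    ((\int[leb]_(s in `]a, t]%classic) (simple_value (S n) s point ^+ 2)%:E = u%:E)%E /\
    has_normal_law P (fun w => xi w + simple_integral B (S n) w) m (v + u)).
  have [u u0 hu] := deterministic_law a0 (hS n) (cS n) mxi v0 lxi.
  by exists u.
have V0 : 0 <= V.
  by rewrite -lee_fin -VE integral_ge0// => s _; rewrite lee_fin sqr_ge0.
have uV : u @ \oo --> V.
  apply: (l2_norm_cvg mh hM (s_ := fun n s => simple_value (S n) s point)) => //.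
    by move=> n; exact: measurable_simple_valuel.
  by move=> n; have [_ []] := hu n.
have s0 : 0 < v + V by rewrite ltr_wpDr.
have sqV0 : 0 < Num.sqrt (v + V) by rewrite sqrtr_gt0.
have cdf_cvg z : cdf ((z - m) / Num.sqrt (v + u n)) @[n --> \oo] -->
    cdf ((z - m) / Num.sqrt (v + V)).
  apply: continuous_cvg; first exact: continuous_std_normal_cdf.
  apply: (@cvgMl_tmp R); apply: cvgV; first by rewrite gt_eqF.
  apply: continuous_cvg; first exact: sqrt_continuous.
  by apply: cvgD => //; exact: cvg_cst.
have mI n := measurable_simple_integral HF HB a0 (hS n).
pose D n w := simple_integral B (S n) w - J w.
have mD n : measurable_fun setT (D n) by exact: measurable_funB.
have cheb e n : 0 < e -> (P [set w | e <= `|D n w|]%R <=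
    (e ^- 2)%:E * \int[P]_w (D n w ^+ 2)%:E)%E.
  by move=> e0; exact: chebyshev_sqr.
have mX : measurable_fun setT (fun w => xi w + J w) by exact: measurable_funD.
have mXn n : measurable_fun setT (fun w => xi w + simple_integral B (S n) w).
  exact: measurable_funD.
have cdfn n z : P [set w | xi w + simple_integral B (S n) w <= z] =
    (cdf ((z - m) / Num.sqrt (v + u n)))%:E.
  by have [u0 [_ lu]] := hu n; apply: normal_law_cdf => //; rewrite ltr_wpDr.
set p := P _.
have pf : p \is a fin_num by exact: fin_num_measure (measurable_sublevel _ mX).
have lim_err (e q : R) (q_ : nat -> R) : q_ @ \oo --> q ->
    ((q_ n)%:E + (e ^- 2)%:E * \int[P]_w (D n w ^+ 2)%:E)%E @[n --> \oo] --> q%:E.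
  move=> qq; rewrite -[X in _ --> X]adde0; apply: cvgeD => //.
    by apply/fine_cvgP; split => //; exact: nearW.
  by rewrite -(mule0 (e ^- 2)%:E); apply: cvgeZl.
(* xi + J <= x forces xi + J_n <= x + e, off the event |J_n - J| >= e *)
have upper e : 0 < e -> fine p <= cdf ((x + e - m) / Num.sqrt (v + V)).
  move=> e0; rewrite -lee_fin fineK//.
  apply: (lee_cvg_to (cvg_cst p) (lim_err e _ _ (cdf_cvg (x + e)))).
  apply: nearW => n.
  apply: (@le_trans _ _ (P ([set w | xi w + simple_integral B (S n) w <= x + e] `|`
    [set w | e <= `|D n w|]%R))).
    apply: le_measure; rewrite ?inE; [exact: measurable_sublevel mX| |].
      by apply: measurableU; [exact: measurable_sublevel (mXn n)|exact: measurable_norm_ge].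
    move=> w /= xw; have [De|De] := leP e `|D n w|; first by right.
    by left; move: De; rewrite ltr_norml /D => /andP[_]; lra.
  apply: le_trans (measureU2 _ _ _) _.
  - exact: measurable_sublevel (mXn n).
  - exact: measurable_norm_ge.
  by apply: leeD; [rewrite -cdfn|exact: cheb].
have lower e : 0 < e -> cdf ((x - e - m) / Num.sqrt (v + V)) <= fine p.
  move=> e0.
  have pE : (fun=> fine p) @ \oo --> fine p by exact: cvg_cst.
  rewrite -lee_fin.
  have cdf_cvgE : (cdf ((x - e - m) / Num.sqrt (v + u n)))%:E @[n --> \oo] -->
      (cdf ((x - e - m) / Num.sqrt (v + V)))%:E.
    by apply/fine_cvgP; split; [exact: nearW|exact: cdf_cvg].
  apply: (lee_cvg_to cdf_cvgE (lim_err e _ _ pE)); apply: nearW => n.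
  rewrite -cdfn fineK//.
  apply: (@le_trans _ _ (P ([set w | xi w + J w <= x] `|`
    [set w | e <= `|D n w|]%R))).
    apply: le_measure; rewrite ?inE; [exact: measurable_sublevel (mXn n)| |].
      by apply: measurableU; [exact: measurable_sublevel mX|exact: measurable_norm_ge].
    move=> w /= xw; have [De|De] := leP e `|D n w|; first by right.
    by left; move: De; rewrite ltr_norml /D => /andP[+ _]; lra.
  apply: le_trans (measureU2 _ _ _) _.
  - exact: measurable_sublevel mX.
  - exact: measurable_norm_ge.
  by apply: leeD; [|exact: cheb].
have shift_cvg (sg : R) : cdf ((x + sg * harmonic n - m) / Num.sqrt (v + V))
    @[n --> \oo] --> cdf ((x - m) / Num.sqrt (v + V)).
  apply: continuous_cvg; first exact: continuous_std_normal_cdf.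
  apply: (@cvgMr_tmp R); rewrite -[in X in _ --> X](addr0 x).
  apply: cvgB; last exact: cvg_cst.
  apply: cvgD; first exact: cvg_cst.
  by rewrite -(mulr0 sg); apply: (@cvgMl_tmp R); exact: cvg_harmonic.
rewrite -(fineK pf); congr EFin; apply/le_anti/andP; split.
- apply: (ler_cvg_to (cvg_cst _) (shift_cvg 1)); apply: nearW => n.
  by rewrite mul1r; apply: upper; rewrite /harmonic invr_gt0.
- apply: (ler_cvg_to (shift_cvg (-1)) (cvg_cst _)); apply: nearW => n.
  by rewrite mulN1r; apply: lower; rewrite /harmonic invr_gt0.
Qed.

End WienerLaw.

(** * Step functions approximating a continuous integrand *)

Section Heine.
Context {R : realType}.

Lemma within_continuous_dist (A : set R) (f : R -> R) (x e : R) :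
  {within A, continuous f} -> A x -> 0 < e ->
  exists2 r, 0 < r & forall z, A z -> `|x - z| < r -> `|f x - f z| <= e.
Proof.
move=> /subspace_continuousP/(_ x) h Ax e0.
have /cvgrPdist_le/(_ e e0) := h Ax.
rewrite /within/= => -[r /= r0 hr]; exists r => // z Az xz.
exact: hr.
Qed.

(** Heine's theorem, from the near-covering form of compactness. *)
Lemma within_segment_uniform_continuous (f : R -> R) (a b e : R) :
  {within `[a, b]%classic, continuous f} -> 0 < e ->
  exists2 r, 0 < r & forall x y, a <= x <= b -> a <= y <= b ->
    `|x - y| < r -> `|f x - f y| <= e.
Proof.
move=> cf e0; pose K := `[a, b]%classic.
pose Q (r x : R) := K x -> forall y, K y -> `|x - y| < r -> `|f x - f y| <= e.
have /compact_near_coveringP/(_ R 0^'+ Q _) h : compact K by exact: segment_compact.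
have : \forall r \near 0^'+, K `<=` Q r.
  apply: h => x Kx; have e20 : 0 < e / 2 by rewrite divr_gt0.
  have [r r0 hr] := within_continuous_dist cf Kx e20.
  have r20 : 0 < r / 2 by rewrite divr_gt0.
  exists (ball x (r / 2), [set s | s < r / 2]) => /=.
    split; first exact: nbhsx_ballx.
    by near=> s; near: s; exact: nbhs_right_lt.
  move=> [z s] /= [xz sr] Kz y Ky zy.
  have xz' : `|x - z| < r / 2 := xz; have sr' : s < r / 2 := sr.
  have xy : `|x - y| < r.
    rewrite (_ : x - y = (x - z) + (z - y)); last by ring.
    apply: le_lt_trans (ler_normD _ _) _; rewrite (splitr r).
    by apply: ltrD => //; exact: lt_trans zy sr'.
  have xzr : `|x - z| < r by apply: lt_trans xz' _; rewrite ltr_pdivrMr// ltr_pMr// ltr1n.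
  have fz := hr z Kz xzr.
  have fy := hr y Ky xy.
  rewrite (_ : f z - f y = (f x - f y) - (f x - f z)); last by ring.
  by apply: le_trans (ler_normB _ _) _; rewrite (splitr e) lerD.
move=> KQ; have [r [r0 hr]] : exists r : R, 0 < r /\ K `<=` Q r.
  near (0 : R)^'+ => r; exists r; split; first by near: r; exact: nbhs_right_gt.
  by near: r.
exists r => // x y xab yab xy; apply: (hr x _ _ y) => //; rewrite /K/= in_itv/=.
Unshelve. all: by end_near. Qed.

End Heine.

Section StepApproximation.
Context {R : realType} {d : measure_display} {Omega : measurableType d}.
Variables (F : R -> set (set Omega)).
Hypothesis sF : forall t, 0 <= t -> sigma_algebra setT (F t).
Implicit Types (S : @simple_process R d Omega) (h : R -> R).

(** Each cell carries the value at its left end; the cells are shorter than a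
    modulus of uniform continuity. *)
Lemma step_approximation (h : R -> R) (a T e : R) : 0 <= a -> a <= T ->
  {within `[a, T]%classic, continuous h} -> 0 < e ->
  exists S, [/\ simple_on F a T S,
    forall i w w', sp_coef S i w = sp_coef S i w' &
    forall s w, a < s <= T -> `|simple_value S s w - h s| <= e].
Proof.
move=> a0 aT ch e0.
have [r r0 hr] := within_segment_uniform_continuous ch e0.
have [N0 N0r] : exists N : nat, (T - a) / r < N%:R.
  by exists (Num.bound ((T - a) / r)); apply: archi_boundP; rewrite divr_ge0 ?subr_ge0// ltW.
pose N := N0.+1.
have Nr : (T - a) / N%:R < r.
  rewrite ltr_pdivrMr// mulrC -ltr_pdivrMr//; apply: lt_le_trans N0r _.
  by rewrite ler_nat.
pose q := (T - a) / N%:R.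
have q0 : 0 <= q by rewrite divr_ge0// subr_ge0.
pose tm i := a + i%:R * q.
have tmN : tm N = T by rewrite /tm /q mulrC divfK ?pnatr_eq0//; ring.
have tm_le i j : (i <= j)%N -> tm i <= tm j.
  by move=> ij; rewrite lerD2l ler_wpM2r// ler_nat.
have tm0 : tm 0 = a by rewrite /tm mul0r addr0.
pose S : simple_process := SimpleProcess N tm (fun i (_ : Omega) => h (tm i)).
have a_tm i : a <= tm i by rewrite -tm0 tm_le.
exists S; split => //.
  split => //= i iN; split; first exact: tm_le.
    by apply: rv_measurable_cst; apply: sF; exact: le_trans (a_tm i).
  by exists `|h (tm i)|.
move=> s w /andP[as_ sT].
have one : \sum_(i < N) (tm i < s <= tm i.+1)%R%:R = 1 :> R.
  transitivity (\sum_(i < N) ((s <= tm i.+1)%R%:R - (s <= tm i)%R%:R : R)).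
    apply: eq_bigr => i _; have := tm_le i i.+1 (leqnSn _).
    case: (leP s (tm i)) => /= [si|si] ii; last by rewrite subr0.
    by rewrite (le_trans si ii) subrr.
  rewrite -(big_mkord xpredT (fun i => (s <= tm i.+1)%R%:R - (s <= tm i)%R%:R)).
  rewrite (telescope_sumr (fun i => (s <= tm i)%R%:R))// tmN tm0 sT.
  by rewrite leNgt as_ subr0.
have cellE (c : R) : c = \sum_(i < N) c * (tm i < s <= tm i.+1)%R%:R.
  by rewrite -mulr_sumr one mulr1.
rewrite /simple_value [X in _ - X]cellE -sumrB [leRHS]cellE.
apply: le_trans (ler_norm_sum _ _ _) _; apply: ler_sum => i _ /=.
rewrite -mulrBl normrM [X in _ * X <= _]ger0_norm//.
case/boolP: (tm i < s <= tm i.+1) => /= [/andP[i1 i2]|_]; last by rewrite !mulr0.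
rewrite !mulr1; apply: hr.
- by rewrite a_tm -tmN tm_le// ltnW.
- by rewrite (ltW as_).
- rewrite distrC ltr_norml; have : tm i.+1 = tm i + q.
    by rewrite /tm -natr1 mulrDl mul1r addrA.
  rewrite -/q in Nr; lra.
Qed.

(** Capping all times at t makes the later cells empty. *)
Lemma simple_restrict a T t S : 0 <= a -> a <= t <= T -> simple_on F a T S ->
  (forall i w w', sp_coef S i w = sp_coef S i w') ->
  exists S', [/\ simple_on F a t S',
    forall i w w', sp_coef S' i w = sp_coef S' i w',
    forall s w, s <= t -> simple_value S' s w = simple_value S s w,
    forall B r w, r <= t -> simple_running B S' r w = simple_running B S r w &
    forall B w, simple_integral B S' w = simple_running B S t w].
Proof.
move=> a0 /andP[at_ tT] hS cS.
pose S' : simple_process := SimpleProcess (sp_size S)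
  (fun i => Num.min t (sp_time S i)) (sp_coef S).
have [h1 h2 h3] := hS.
exists S'; split => //.
- split => /=; first by rewrite h1 min_r.
    by rewrite h2 min_l.
  move=> i iS; have [ti mi bi] := h3 i iS; split => //.
    by rewrite le_min !ge_min lexx ti orbT.
  rewrite (_ : sp_coef S i = fun=> sp_coef S i point); last first.
    by apply/funext => w; exact: cS.
  apply: rv_measurable_cst; apply: sF; rewrite le_min (le_trans a0)//=.
  by have /andP[+ _] := simple_time_bounds hS (ltnW iS); exact: le_trans.
- move=> s w st; apply: eq_bigr => i _; congr (_ * _%:R) => /=.
  by rewrite gt_min le_min st/= ltNge st.
- move=> B r w rt; apply: eq_bigr => i _ /=.
  by rewrite !minA !(min_l rt).
Qed.

End StepApproximation.

(** * Uniform distance between integrals of step functions *)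

Section StepDistance.
Context {R : realType} {d : measure_display} {Omega : measurableType d}.
Variable P : probability Omega R.
Variables (F : R -> set (set Omega)) (B : R -> Omega -> R).
Hypotheses (HF : usual_conditions P F) (HB : brownian_motion P F B).
Implicit Types (S : @simple_process R d Omega) (h : R -> R).
Local Notation leb := lebesgue_measure.

Lemma simple_running_adapted a T t S : 0 <= a -> a <= t -> simple_on F a T S ->
  (forall i w w', sp_coef S i w = sp_coef S i w') ->
  rv_measurable (F t) (simple_running B S t).
Proof.
move=> a0 at_ hS cS; have t0 := le_trans a0 at_.
have sFt := filtration_sigma HF t0.
have BF i : (i <= sp_size S)%N -> rv_measurable (F t) (B (Num.min t (sp_time S i))).
  move=> iS; have m0 : 0 <= Num.min t (sp_time S i).
    rewrite le_min t0/=; apply: (le_trans a0).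
    by have /andP[] := simple_time_bounds hS iS.
  apply: rv_measurableS (bm_adapted HB m0); apply: (filtration_sub HF) => //.
  by rewrite ge_min lexx.
apply: rv_measurable_sum => // i _; apply: rv_measurableM => //.
  rewrite (_ : sp_coef S i = fun=> sp_coef S i point).
    exact: rv_measurable_cst.
  by apply/funext => w; exact: cS.
by apply: rv_measurableB => //; apply: BF => //; exact: ltnW.
Qed.

Section Pair.
Variables (a T e1 e2 : R) (h : R -> R) (S1 S2 : @simple_process R d Omega).
Hypotheses (a0 : 0 <= a) (hS1 : simple_on F a T S1) (hS2 : simple_on F a T S2).
Hypothesis cS1 : forall i w w', sp_coef S1 i w = sp_coef S1 i w'.
Hypothesis cS2 : forall i w w', sp_coef S2 i w = sp_coef S2 i w'.
Hypothesis h1 : forall s w, a < s <= T -> `|simple_value S1 s w - h s| <= e1.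
Hypothesis h2 : forall s w, a < s <= T -> `|simple_value S2 s w - h s| <= e2.
Let bound : R := normal_moment2 R * ((e1 + e2) ^+ 2 * (T - a)).

Let aT : a <= T.
Proof. by have [<- <- _] := hS1; apply: (simple_time_le hS1); rewrite leqnn. Qed.

(* The difference of the two step functions, on a partition containing Q, so that
   the maximal inequality sees its integral at the points of Q. *)
Let difference (Q : seq R) : (forall q, q \in Q -> a <= q <= T) ->
  exists S, [/\ simple_on F a T S,
    forall B t w, simple_running B S t w =
      simple_running B S1 t w - simple_running B S2 t w,
    ((normal_moment2 R)%:E * \int[P]_w \int[leb]_(s in `[a, T]%classic)
      (simple_value S s w ^+ 2)%:E <= bound%:E)%E &
    forall q, q \in Q -> exists2 j, (j <= sp_size S)%N & sp_time S j = q].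
Proof.
move=> hQ.
have [S [hS Sv Sr Sc SQ]] := simple_combine (-1) (filtration_sigma HF)
    (filtration_sub HF) a0 hS1 hS2 hQ.
exists S; split => //; first by move=> B' t w; rewrite Sr mulN1r.
rewrite deterministic_energy; last first.
  move=> i w w'; rewrite !Sc (deterministic_value _ w w' cS1).
  by rewrite (deterministic_value _ w w' cS2).
rewrite /bound EFinM lee_wpmul2l ?lee_fin ?normal_moment2_ge0//.
apply: (@le_trans _ _
  (\int[leb]_(s in `]a, T]%classic) (cst ((e1 + e2) ^+ 2)%:E s))%E).
  apply: ge0_le_integral => //.
  - by move=> s _; rewrite lee_fin sqr_ge0.
  - by apply/measurable_EFinP/measurable_funX; exact: measurable_simple_valuel.
  - move=> s; rewrite /= in_itv/= => sat; rewrite lee_fin Sv.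
    rewrite -[leLHS]real_normK ?num_real//.
    have n1 := h1 point sat; have n2 := h2 point sat.
    rewrite lerXn2r// ?nnegrE ?addr_ge0 ?(le_trans _ n1) ?(le_trans _ n2)//.
    rewrite (_ : _ + _ = (simple_value S1 s point - h s) -
      (simple_value S2 s point - h s)); last by ring.
    by rewrite (le_trans (ler_normB _ _))// lerD.
rewrite integral_cst//= lebesgue_measure_itv/= lte_fin.
have [aT'|Ta] := ltP a T; first by rewrite -EFinD -EFinM.
by rewrite mule0 lee_fin mulr_ge0 ?sqr_ge0// subr_ge0.
Qed.

Lemma step_integral_dist :
  (\int[P]_w ((simple_integral B S1 w - simple_integral B S2 w) ^+ 2)%:E
   <= bound%:E)%E.
Proof.
have [S [hS Sr Sb _]] := difference (Q := [::]) (fun q => ltac:(done)).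
apply: le_trans Sb; rewrite -(simple_isometry HF HB a0 hS).
rewrite le_eqVlt; apply/orP; left; apply/eqP; apply: eq_integral => w _.
by rewrite -(simple_running_end B w hS) Sr !(simple_running_end B w hS1)
   (simple_running_end B w hS2).
Qed.

Let level (e t : R) : set Omega :=
  [set w | e <= `|simple_running B S1 t w - simple_running B S2 t w|].

Let measurable_level e t : a <= t -> measurable (level e t).
Proof.
move=> at_; apply: measurable_norm_ge; apply: measurable_funB;
  apply: (adapted_measurable HF (le_trans a0 at_)).
  exact: (simple_running_adapted a0 at_ hS1 cS1).
exact: (simple_running_adapted a0 at_ hS2 cS2).
Qed.

Let maximal_finite (e : R) (q : nat -> R) k : 0 < e ->
  (forall j, a <= q j <= T) ->
  (P (\bigcup_(j in [set j | (j < k)%N]) level e (q j)) <=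
   (bound / e ^+ 2)%:E)%E.
Proof.
move=> e0 hq; pose Q := [seq q j | j <- iota 0 k].
have hQ r : r \in Q -> a <= r <= T by move=> /mapP[j _ ->].
have [S [hS Sr Sb SQ]] := difference hQ.
have e20 : 0 < e ^+ 2 by rewrite exprn_gt0.
apply: (@le_trans _ _ (P (\bigcup_(n in [set n | (n <= sp_size S)%N])
    [set w | e <= `|simple_partial B S n w|]))).
  apply: le_measure; rewrite ?inE.
  - by apply: bigcup_measurable => j _; apply: measurable_level; have /andP[] := hq j.
  - apply: bigcup_measurable => n nS; apply: measurable_norm_ge.
    have t0 : 0 <= sp_time S n.
      by have /andP[+ _] := simple_time_bounds hS nS; exact: le_trans.
    exact: (adapted_measurable HF t0 (simple_partial_adapted HF HB a0 hS nS)).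
  move=> w [j jk ew].
  have [n nS nE] : exists2 n, (n <= sp_size S)%N & sp_time S n = q j.
    by apply: SQ; apply: map_f; rewrite mem_iota.
  by exists n => //=; rewrite -(simple_running_time B w hS nS) nE Sr.
rewrite EFinM muleC lee_pdivlMl//.
exact: le_trans (simple_maximal HF HB a0 hS e0) Sb.
Qed.

(** The bound of the maximal inequality does not depend on the partition, so it
    passes from finitely many times to countably many. *)
Lemma step_maximal (e : R) (q : nat -> R) : 0 < e ->
  (forall j, a <= q j <= T) ->
  measurable (\bigcup_j level e (q j)) /\
  (P (\bigcup_j level e (q j)) <= (bound / e ^+ 2)%:E)%E.
Proof.
move=> e0 hq.
have mA k : measurable (\bigcup_(j in [set j | (j < k)%N]) level e (q j)).
  by apply: bigcup_measurable => j _; apply: measurable_level; have /andP[] := hq j.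
have AU : \bigcup_k \bigcup_(j in [set j | (j < k)%N]) level e (q j) =
    \bigcup_j level e (q j).
  apply/seteqP; split => w; first by move=> [k _ [j _ ew]]; exists j.
  by move=> [j _ ew]; exists j.+1 => //; exists j => //=.
rewrite -AU; have mU := bigcup_measurable (fun k (_ : setT k) => mA k).
split => //.
have cv := nondecreasing_cvg_mu (mu := P) mA mU.
apply: (cvge_to_le (cv _)); last by apply: nearW => k; exact: maximal_finite.
apply/nondecreasing_seqP => k; apply/subsetPset => w [j jk ew].
by exists j => //=; exact: ltnW.
Qed.

End Pair.
End StepDistance.

(** * The Wiener integral as a continuous process *)

Section RealLemmas.
Context {R : realType}.

(** Cauchy's criterion with its rate. *)
Lemma geometric_steps_cvg (u : nat -> R) k :
  (forall n, (k <= n)%N -> `|u n.+1 - u n| <= 2^-1 ^+ n) ->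
  exists l, u @ \oo --> l /\
    forall n, (k <= n)%N -> `|l - u n| <= 2 * 2^-1 ^+ n.
Proof.
move=> hu.
have step n j : (k <= n)%N -> `|u (n + j)%N - u n| <= 2 * 2^-1 ^+ n - 2 * 2^-1 ^+ (n + j).
  move=> kn; elim: j => [|j IH]; first by rewrite addn0 !subrr normr0.
  rewrite addnS (_ : _ - _ = (u (n + j).+1 - u (n + j)%N) + (u (n + j)%N - u n)); last by ring.
  apply: le_trans (ler_normD _ _) _.
  have := hu (n + j)%N (leq_trans kn (leq_addr _ _)).
  rewrite [2^-1 ^+ (n + j).+1]exprS; lra.
have bnd n m : (k <= n)%N -> (n <= m)%N -> `|u m - u n| <= 2 * 2^-1 ^+ n.
  move=> kn nm; rewrite -(subnKC nm); apply: le_trans (step _ _ kn) _.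
  by rewrite gerBl mulr_ge0// exprn_ge0.
have half0 : (fun n => 2 * 2^-1 ^+ n : R) @ \oo --> 0.
  rewrite -(mulr0 2); apply: (@cvgMl_tmp R); apply: cvg_expr.
  by rewrite ger0_norm ?invr_ge0// invf_lt1// ltr1n.
have cu : cvgn u.
  apply: cauchy_cvg; apply: cauchy_exP => e e0.
  move/cvgrPdist_lt : half0 => /(_ e e0) [N _ hN].
  exists (u (maxn k N)); exists (maxn k N) => // m /= Nm.
  rewrite /ball/= distrC; apply: le_lt_trans (bnd _ _ (leq_maxl _ _) Nm) _.
  have := hN (maxn k N) (leq_maxr _ _).
  by rewrite sub0r normrN ger0_norm// mulr_ge0// exprn_ge0.
exists (limn u); split => // n kn.
have cv : `|u m - u n| @[m --> \oo] --> `|limn u - u n|.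
  by apply: cvg_norm; apply: cvgB => //; exact: cvg_cst.
apply: (ler_cvg_to cv (cvg_cst _)).
by exists n => // m /= nm; exact: bnd.
Qed.

(** Extending a path constantly to negative times gives a function continuous on
    the whole line, to which the lemmas on continuous functions apply. *)
Lemma continuous_clamp (f : R -> R) : {within `[0, +oo[%classic, continuous f} ->
  continuous (fun t : R => f (Num.max t 0)).
Proof.
move=> cf x; apply/cvgrPdist_le => e e0.
have Ax : `[0, +oo[%classic (Num.max x 0).
  by rewrite /= in_itv/= andbT le_max lexx orbT.
have [r r0 hr] := within_continuous_dist cf Ax e0.
exists r => //= z xz; apply: hr.
  by rewrite /= in_itv/= andbT le_max lexx orbT.
apply: le_lt_trans xz; rewrite /Num.max.
by case: ltP => x0; case: ltP => z0; rewrite ler_norml; apply/andP; split;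
  (have := ler_norm (x - z); have := ler_norm (- (x - z)); rewrite normrN; lra).
Qed.

Lemma continuous_rat_le (f : R -> R) (a b c : R) : continuous f -> a < b ->
  (forall r : rat, a <= ratr r <= b -> f (ratr r) <= c) ->
  forall t, a <= t <= b -> f t <= c.
Proof.
move=> cf ab hf t /andP[at_ tb]; rewrite leNgt; apply/negP => ct.
have e0 : 0 < f t - c by rewrite subr_gt0.
have /cvgrPdist_lt/(_ _ e0) [r /= r0 hr] := cf t.
have lh : Num.max a (t - r) < Num.min b (t + r).
  by rewrite lt_min !gt_max; apply/andP; split; apply/andP; split; lra.
have [q] := rat_in_itvoo lh; rewrite in_itv/= lt_min gt_max.
move=> /andP[/andP[aq tq] /andP[qb qt]].
have : `|f t - f (ratr q)| < f t - c.
  by apply: hr; rewrite /= ltr_norml; apply/andP; split; lra.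
have := hf q _; rewrite (ltW aq) (ltW qb) => /(_ erefl) fq.
rewrite ltr_norml => /andP[_]; lra.
Qed.

End RealLemmas.

Section RunningContinuous.
Context {R : realType} {d : measure_display} {Omega : measurableType d}.
Implicit Types (S : @simple_process R d Omega) (B : R -> Omega -> R).

Lemma simple_running_clamp B S w t : 0 <= t ->
  (forall i, (i <= sp_size S)%N -> 0 <= sp_time S i) ->
  simple_running (fun s w => B (Num.max s 0) w) S t w = simple_running B S t w.
Proof.
move=> t0 hS; apply: eq_bigr => i _.
by rewrite !max_l// le_min t0 hS// ltnW.
Qed.

Lemma continuous_simple_running B S w : continuous (B ^~ w) ->
  continuous (fun t : R => simple_running B S t w).
Proof.
move=> cB.
have cmin (u : R) : continuous (fun t : R => B (Num.min t u) w).
  move=> x; apply: (@continuous_comp _ _ _ (fun t : R => Num.min t u) (B ^~ w));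
    last exact: cB.
  by apply: (continuous_min (f := id) (g := cst u)); [exact: cvg_id|exact: cvg_cst].
rewrite /simple_running; elim: (index_enum _) => [|i r IH] x.
  by under eq_fun do rewrite big_nil; exact: cvg_cst.
under eq_fun do rewrite big_cons.
apply: cvgD; last exact: IH.
by apply: (@cvgMl_tmp R); apply: cvgB; exact: cmin.
Qed.

End RunningContinuous.

Section Existence.
Context {R : realType} {d : measure_display} {Omega : measurableType d}.
Variable P : probability Omega R.
Variables (F : R -> set (set Omega)) (B : R -> Omega -> R).
Hypotheses (HF : usual_conditions P F) (HB : brownian_motion P F B).
Implicit Types (S : @simple_process R d Omega) (h : R -> R).
Local Notation leb := lebesgue_measure.
Local Notation kappa := (normal_moment2 R).

Section Construction.
Variables (a : R) (h : R -> R) (S : nat -> @simple_process R d Omega).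
Hypothesis a0 : 0 <= a.
Local Notation x n := ((2^-1 : R) ^+ n).
Hypothesis hS : forall n, simple_on F a (a + n%:R) (S n).
Hypothesis cS : forall n i w w', sp_coef (S n) i w = sp_coef (S n) i w'.
Hypothesis vS : forall n s w, a < s <= a + n%:R ->
  `|simple_value (S n) s w - h s| <= x n ^+ 2.

Hypothesis mh : forall t, measurable_fun `]a, t]%classic h.

Let X n := simple_running B (S n).

Let x_ge0 n : 0 <= x n.
Proof. by rewrite exprn_ge0. Qed.

Let x_gt0 n : 0 < x n.
Proof. by rewrite exprn_gt0. Qed.

Let x_le m n : (m <= n)%N -> x n <= x m.
Proof. by move=> mn; rewrite ler_wiXn2l// invf_le1// ler1n. Qed.

Let x_le1 n : x n <= 1.
Proof. by have := x_le (leq0n n); rewrite expr0. Qed.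

Let x_cvg0 (c : R) : (fun n => c * x n) @ \oo --> 0.
Proof.
rewrite -(mulr0 c); apply: (@cvgMl_tmp R); apply: cvg_expr.
by rewrite ger0_norm ?invr_ge0// invf_lt1// ltr1n.
Qed.

(* The rationals of [a, a + n], enumerated: the maximal inequality controls
   countably many times, and by continuity of the paths these determine all
   times. *)
Let q n j : R :=
  let r := ratr (odflt 0 (unpickle j)) in if a <= r <= a + n%:R then r else a.

Let q_itv n j : a <= q n j <= a + n%:R.
Proof. by rewrite /q; case: ifPn => // _; rewrite lexx lerDl ler0n. Qed.

Let E n := \bigcup_j
  [set w | x n <= `|X n.+1 (q n j) w - X n (q n j) w|].

(* Steps with accuracy x_n^2 on [a, a + n] differ by at most x_n^2 + x_{n+1}^2.
   The bound is of order x_n^4 n / x_n^2 for the level x_n, hence of order x_n. *)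
Let E_small n : measurable (E n) /\
  (P (E n) <= (8 * kappa / (2 ^ n.+1)%:R)%:E)%E.
Proof.
have nn : a <= a + n%:R <= a + n.+1%:R by rewrite lerDl ler0n lerD2l ler_nat/=.
have [S' [hS' cS' vS' rS' _]] :=
  simple_restrict (filtration_sigma HF) a0 nn (hS n.+1) (@cS n.+1).
have vS'h s w : a < s <= a + n%:R -> `|simple_value S' s w - h s| <= x n.+1 ^+ 2.
  move=> /andP[as_ sn]; rewrite vS'//; apply: vS; rewrite as_/= (le_trans sn)//.
  by have /andP[] := nn.
have [mE PE] := step_maximal HF HB a0 hS' (hS n) cS' (@cS n) vS'h (@vS n)
  (x_gt0 n) (q_itv n).
have EE : E n = \bigcup_j [set w | x n <=
    `|simple_running B S' (q n j) w - simple_running B (S n) (q n j) w|].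
  apply: eq_bigcupr => j _; apply/seteqP; split => w /=;
  by rewrite rS'//; have /andP[] := q_itv n j.
rewrite EE; split => //; apply: le_trans PE _; rewrite lee_fin.
have k0 := normal_moment2_ge0 (R := R).
rewrite addrAC subrr add0r.
have nx : n%:R * x n <= 1.
  rewrite exprVn ler_pdivrMr ?exprn_gt0// mul1r -natrX ler_nat.
  exact: ltnW (ltn_expl _ _).
have -> : 8 * kappa / (2 ^ n.+1)%:R = kappa * (4 * x n).
  rewrite natrX exprS exprVn; field.
  by rewrite expf_neq0.
rewrite -mulrA ler_wpM2l// ler_pdivrMr ?exprn_gt0//.
have xS : x n.+1 = x n / 2 by rewrite exprS mulrC.
rewrite xS; have := x_ge0 n; set y := x n in nx * => y0.
rewrite (_ : (_ + _) ^+ 2 * n%:R = 25 / 16 * (y ^+ 3 * (n%:R * y))); last by field.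
rewrite (_ : 4 * y * y ^+ 2 = 4 * y ^+ 3); last by ring.
have : y ^+ 3 * (n%:R * y) <= y ^+ 3 by rewrite ler_piMr// exprn_ge0.
have : 0 <= y ^+ 3 by rewrite exprn_ge0.
lra.
Qed.

(* The exceptional paths. By Borel-Cantelli and completeness N is a null set of
   F 0, so the integral may be set to zero on N without loss of adaptedness. *)
Let N := lim_sup_set E `|`
  ~` [set w | {within `[0, +oo[%classic, continuous (B ^~ w)}].

Let N_negligible : P.-negligible N.
Proof.
apply: negligibleU; last exact: (bm_continuous HB).
have mE n := (E_small n).1.
apply/negligibleP.
  apply: bigcap_measurable => // n _; exact: bigcup_measurable.
apply: lim_sup_set_cvg0 => //.
apply: (@le_lt_trans _ _ (8 * kappa)%:E); last by rewrite ltry.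
have k8 : 0 <= 8 * kappa by rewrite mulr_ge0// normal_moment2_ge0.
apply: le_trans (epsilon_trick0 xpredT k8).
by apply: lee_nneseries => // n _; exact: (E_small n).2.
Qed.

Let F0N : F 0 N.
Proof. exact: (filtration_complete HF). Qed.

Let mN : measurable N.
Proof. exact: (filtration_measurable HF (lexx 0)). Qed.

Let I (t : R) (w : Omega) : R := if w \in N then 0 else limn (fun n => X n t w).

Let time_ge0 n i : (i <= sp_size (S n))%N -> 0 <= sp_time (S n) i.
Proof.
by move=> iS; have /andP[+ _] := simple_time_bounds (hS n) iS; exact: le_trans.
Qed.

Let path_continuous w : ~ N w -> exists Y : nat -> R -> R,
  (forall n, continuous (Y n)) /\ (forall n t, 0 <= t -> Y n t = X n t w).
Proof.
move=> Nw; exists (fun n t => simple_running (fun s w => B (Num.max s 0) w) (S n) t w).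
split=> [n|n t t_0]; last by apply: simple_running_clamp => //; exact: time_ge0.
apply: continuous_simple_running; apply: (continuous_clamp (f := B ^~ w)).
by apply: contrapT => h1; apply: Nw; right.
Qed.

Let I_approx w : ~ N w -> exists k, forall n t, (k <= n)%N ->
  a <= t <= a + n%:R ->
  X m t w @[m --> \oo] --> I t w /\ `|I t w - X n t w| <= 2 * x n.
Proof.
move=> Nw; have [Y [cY YX]] := path_continuous Nw.
have [k hk] : exists k, forall n, (k <= n)%N -> ~ E n w.
  apply: contrapT => /forallNP hE; apply: Nw; left => k _.
  have /existsNP[n /not_implyP[kn /contrapT En]] := hE k.
  by exists n.
exists k.+1 => n t kn tn.
have steps m s : (n <= m)%N -> a <= s <= a + m%:R ->
    `|X m.+1 s w - X m s w| <= x m.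
  move=> nm sm; have m0 : (0 < m)%N by exact: leq_trans (leq_trans kn nm).
  have s0 : 0 <= s by have /andP[+ _] := sm; exact: le_trans.
  rewrite -!YX//.
  apply: (continuous_rat_le (f := fun s => `|Y m.+1 s - Y m s|) (a := a)
    (b := a + m%:R)) => //.
  - move=> z; apply: cvg_norm; apply: cvgB; exact: cY.
  - by rewrite ltrDl ltr0n.
  move=> r ra; have r0 : 0 <= ratr r :> R by have /andP[+ _] := ra; exact: le_trans.
  rewrite leNgt; apply/negP => xr; apply: (hk m (leq_trans (ltnW kn) nm)).
  exists (pickle r) => //=; rewrite /q pickleK/= ra -!YX//.
  exact: ltW.
have tm m : (n <= m)%N -> a <= t <= a + m%:R.
  move=> nm; have /andP[-> tn'] := tn; rewrite (le_trans tn')//.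
  by rewrite lerD2l ler_nat.
have [l [Xl hl]] := geometric_steps_cvg (u := fun m => X m t w)
  (fun m nm => steps m t nm (tm m nm)).
have -> : I t w = l.
  by rewrite /I memNset//; exact: cvg_lim Xl.
by split => //; exact: hl.
Qed.

Let horizon t : exists k : nat, t <= a + k%:R.
Proof.
exists (Num.bound `|t - a|); rewrite -lerBlDl; apply: le_trans (ler_norm _) _.
by apply: ltW; apply: archi_boundP.
Qed.

Let I_cvg w t : ~ N w -> a <= t -> X m t w @[m --> \oo] --> I t w.
Proof.
move=> Nw at_; have [k hk] := I_approx Nw; have [j tj] := horizon t.
have := hk (maxn k j) t (leq_maxl _ _).
rewrite at_/= (le_trans tj) ?lerD2l ?ler_nat ?leq_maxr//.
by move=> /(_ erefl)[].
Qed.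

Let I_continuous : continuous_paths a +oo%E I.
Proof.
move=> w; have [Nw|Nw] := pselect (N w).
  rewrite (_ : I ^~ w = cst 0); last by apply/funext => t; rewrite /I mem_set.
  by move=> t; exact: cvg_cst.
have [Y [cY YX]] := path_continuous Nw; have [k hk] := I_approx Nw.
apply/subspace_continuousP => t [at_ _]; apply/cvgrPdist_le => e e0.
have e6 : 0 < e / 3 by rewrite divr_gt0.
have /cvgrPdist_lt/(_ _ e6)[m _ hm] := x_cvg0 2.
have [j tj] := horizon (t + 1).
pose n := maxn k (maxn m j).
have xn : 2 * x n <= e / 3.
  have := hm n; rewrite /= sub0r normrN ger0_norm ?mulr_ge0//.
  by move=> h1; apply/ltW/h1; rewrite leq_max leq_maxl orbT.
have tn : t + 1 <= a + n%:R.
  by rewrite (le_trans tj)// lerD2l ler_nat !leq_max leqnn !orbT.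
have /cvgrPdist_le/(_ _ e6)[r /= r0 hr] := cY n t.
exists (Num.min r 1) => /=; first by rewrite lt_min r0 ltr01.
move=> s; rewrite /= lt_min => /andP[sr s1] [as_ _].
have sn : a <= s <= a + n%:R.
  rewrite as_/=; have := ler_norm (s - t); rewrite distrC; lra.
have tn' : a <= t <= a + n%:R by rewrite at_/=; lra.
have kn : (k <= n)%N by rewrite leq_maxl.
have [_ h1] := hk n t kn tn'; have [_ h2] := hk n s kn sn.
have h3 := hr s sr; rewrite !YX ?(le_trans a0)// in h3.
rewrite (_ : I t w - I s w = (I t w - X n t w) + (X n t w - X n s w) - (I s w - X n s w));
  last by ring.
apply: le_trans (ler_normB _ _) _; apply: (@le_trans _ _ (e / 3 + e / 3 + e / 3)).
  apply: lerD; last exact: le_trans h2 xn.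
  by apply: le_trans (ler_normD _ _) _; apply: lerD => //; exact: le_trans h1 xn.
lra.
Qed.

Let Y n t (w : Omega) : R := X n t w * \1_(~` N) w.

Let Y_cvg t w : a <= t -> Y n t w @[n --> \oo] --> I t w.
Proof.
move=> at_; rewrite /Y indicE.
have [Nw|Nw] := pselect (N w).
  rewrite memNset//=.
  under eq_fun do rewrite mulr0.
  by rewrite /I mem_set//; exact: cvg_cst.
rewrite mem_set//; under eq_fun do rewrite mulr1.
exact: I_cvg.
Qed.

Let Y_adapted n t : a <= t -> rv_measurable (F t) (Y n t).
Proof.
move=> at_; have t0 := le_trans a0 at_.
have sFt := filtration_sigma HF t0.
apply: rv_measurableM => //; first exact: (simple_running_adapted HF HB a0 at_ (hS n) (@cS n)).
apply: rv_measurable_indic => //; apply: sub_measurableE => //.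
apply: measurableC; apply: sub_gen_smallest.
exact: (filtration_sub HF (lexx 0) t0 F0N).
Qed.

Let I_adapted : adapted F a +oo%E I.
Proof.
move=> t [at_ _]; apply: (rv_measurable_lim (X_ := fun n => Y n t)).
- exact: (filtration_sigma HF (le_trans a0 at_)).
- by move=> n; exact: Y_adapted.
- by move=> w; exact: Y_cvg.
Qed.

(* By Fatou's lemma the distance from X_n to the limit is at most the supremum of
   its distances to the X_m with m >= n, which the isometry bounds. *)
Let I_wiener t : a <= t -> wiener_integral P F B a t h (I t).
Proof.
move=> at_; have [k tk] := horizon t.
have /choice[S' hS'] n : exists S', [/\ simple_on F a t S',
    forall i w w', sp_coef S' i w = sp_coef S' i w',
    forall s w, a < s <= t -> `|simple_value S' s w - h s| <= x n ^+ 2 &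
    forall w, simple_integral B S' w = X (n + k)%N t w].
  have nk : a <= t <= a + (n + k)%:R.
    by rewrite at_ (le_trans tk)// lerD2l ler_nat leq_addl.
  have [S' [hS' cS' vS' _ iS']] :=
    simple_restrict (filtration_sigma HF) a0 nk (hS (n + k)) (@cS (n + k)).
  exists S'; split => // s w /andP[as_ st]; rewrite vS'//.
  apply: le_trans (vS _ _) _.
    by rewrite as_/= (le_trans st)//; have /andP[] := nk.
  by rewrite lerXn2r// ?nnegrE// x_le// leq_addr.
have t0 := le_trans a0 at_.
have mI : measurable_fun setT (I t).
  by apply: (adapted_measurable HF t0); apply: I_adapted; split => //; rewrite ltry.
have xE : (fun n => (x n)%:E : \bar R) @ \oo --> 0%E.
  apply/fine_cvgP; split; first exact: nearW.
  have := x_cvg0 1; rewrite (_ : (fun n => 1 * x n) = (fun n => x n))//.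
  by apply/funext => n; rewrite mul1r.
have x4 n : x n ^+ 2 ^+ 2 <= x n.
  have := x_le1 n; have := x_ge0 n; set y := x n => y0 y1.
  rewrite -exprM/= exprS ler_piMr// exprn_ile1//.
exists S'; split.
- by move=> n; have [] := hS' n.
- by move=> n; have [] := hS' n.
- apply: (cvge0_dominated (c1 := t - a) (c2 := 0) _ xE xE) => n.
  rewrite integral_ge0/=; last by move=> s _; rewrite lee_fin sqr_ge0.
  rewrite mul0e adde0.
  have [_ _ vS' _] := hS' n.
  apply: (@le_trans _ _
    (\int[leb]_(s in `]a, t]%classic) (cst (x n)%:E s))%E).
    apply: ge0_le_integral => //.
    - by move=> s _; rewrite lee_fin sqr_ge0.
    - apply/measurable_EFinP; apply: measurable_funX; apply: measurable_funB.
        exact: measurable_simple_valuel.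
      exact: mh.
    - move=> s; rewrite /= in_itv/= => sat; rewrite lee_fin.
      apply: le_trans (x4 n); rewrite -[leLHS]real_normK ?num_real//.
      by rewrite lerXn2r// ?nnegrE ?sqr_ge0//; exact: vS'.
  rewrite integral_cst//= lebesgue_measure_itv/= lte_fin muleC.
  have [_|ta] := ltP a t; first by rewrite -EFinD.
  by rewrite mul0e mule_ge0// lee_fin subr_ge0.
pose b : R := kappa * (4 * (t - a)).
apply: (cvge0_dominated (c1 := b) (c2 := 0) _ xE xE) => n.
rewrite integral_ge0/=; last by move=> w _; rewrite lee_fin sqr_ge0.
rewrite mul0e adde0.
have mY m : measurable_fun setT (Y m t).
  exact: (adapted_measurable HF t0 (Y_adapted m at_)).
have mS' m : measurable_fun setT (simple_integral B (S' m)).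
  have [hSm _ _ _] := hS' m; exact: (measurable_simple_integral HF HB a0 hSm).
have mDY : measurable_fun setT (fun w => ((Y (n + k)%N t w - I t w) ^+ 2)%:E).
  by apply/measurable_EFinP; apply: measurable_funX; exact: measurable_funB.
have -> : (\int[P]_w ((simple_integral B (S' n) w - I t w) ^+ 2)%:E =
    \int[P]_w ((Y (n + k)%N t w - I t w) ^+ 2)%:E)%E.
  apply: ae_eq_integral => //.
    by apply/measurable_EFinP; apply: measurable_funX; exact: measurable_funB.
  apply: (negligibleS _ N_negligible) => w /=; apply: contra_notP => Nw _.
  have [_ _ _ ->] := hS' n.
  by rewrite /Y indicE mem_set// mulr1.
pose g m w : \bar R := ((Y (n + k)%N t w - Y (n + m + k)%N t w) ^+ 2)%:E.
have mg m : measurable_fun setT (g m).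
  by apply/measurable_EFinP; apply: measurable_funX; exact: measurable_funB.
have g0 m w : (0 <= g m w)%E by rewrite lee_fin sqr_ge0.
have g_le m : (\int[P]_w g m w <= b%:E * (x n)%:E)%E.
  have [hSn cSn vSn iSn] := hS' n; have [hSm cSm vSm iSm] := hS' (n + m)%N.
  have vSn' s w : a < s <= t -> `|simple_value (S' n) s w - h s| <= x n ^+ 2.
    exact: vSn.
  have vSm' s w : a < s <= t -> `|simple_value (S' (n + m)%N) s w - h s| <= x n ^+ 2.
    move=> st; apply: le_trans (vSm s w st) _.
    by rewrite lerXn2r// ?nnegrE// x_le// leq_addr.
  apply: le_trans (le_trans (step_integral_dist HF HB a0 hSn hSm cSn cSm vSn' vSm') _).
    apply: ge0_le_integral => //.
      apply/measurable_EFinP; apply: measurable_funX; exact: measurable_funB.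
    move=> w _; rewrite /g lee_fin iSn iSm /Y -mulrBl exprMn ler_piMr ?sqr_ge0//.
  rewrite -EFinM lee_fin /b.
  rewrite [leRHS](_ : _ = kappa * (4 * x n * (t - a))); last by ring.
  rewrite ler_wpM2l ?normal_moment2_ge0// ler_wpM2r ?subr_ge0//.
  have := x4 n; lra.
have -> : (\int[P]_w ((Y (n + k)%N t w - I t w) ^+ 2)%:E =
    \int[P]_w limn_einf (g^~ w))%E.
  apply: eq_integral => w _; apply/esym/(cvg_limn_einf_sup _).1.
  apply/fine_cvgP; split; first exact: nearW.
  have cZ : Y (n + k)%N t w - Y (m + (n + k))%N t w @[m --> \oo] -->
      Y (n + k)%N t w - I t w.
    apply: cvgB; first exact: cvg_cst.
    apply: (cvg_comp (fun m => m + (n + k))%N (fun m => Y m t w)).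
      exact: cvg_addnr.
    exact: Y_cvg.
  have cZ2 := cvgM cZ cZ.
  rewrite expr2 (_ : fine \o g ^~ w = (fun m => (Y (n + k)%N t w -
    Y (m + (n + k))%N t w) * (Y (n + k)%N t w - Y (m + (n + k))%N t w))); first exact: cZ2.
  by apply/funext => m; rewrite /g/= expr2 addnAC (addnC (n + k)%N).
apply: le_trans (fatou P measurableT mg (fun m w _ => g0 m w)) _.
rewrite limn_einf_lim; set v := (fun m => _).
have cv : einfs v @ \oo --> limn (einfs v) by exact: is_cvg_einfs.
apply: (cvge_to_le cv).
apply: nearW => m; apply: le_trans (g_le m).
by apply: ereal_inf_lbound; exists m => /=.
Qed.

Lemma wiener_process_construction : exists I : R -> Omega -> R,
  [/\ adapted F a +oo%E I, continuous_paths a +oo%E I &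
      forall t, a <= t -> wiener_integral P F B a t h (I t)].
Proof. by exists I. Qed.

End Construction.

(** The integrals of step functions with accuracy 4^(-n) on [a, a + n] converge
    almost surely, uniformly on bounded intervals, since by the maximal inequality
    the probabilities of a difference beyond 2^(-n) are summable. *)
Theorem exists_wiener_process (a : R) (h : R -> R) : 0 <= a ->
  {within `[0, +oo[%classic, continuous h} ->
  exists I : R -> Omega -> R,
    [/\ adapted F a +oo%E I, continuous_paths a +oo%E I &
        forall t, a <= t -> wiener_integral P F B a t h (I t)].
Proof.
move=> a0 ch.
have /choice[S hS] (n : nat) : exists S, [/\ simple_on F a (a + n%:R) S,
    forall i w w', sp_coef S i w = sp_coef S i w' &
    forall s w, a < s <= a + n%:R ->
      `|simple_value S s w - h s| <= ((2^-1 : R) ^+ n) ^+ 2].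
  apply: step_approximation => //.
  - exact: filtration_sigma HF.
  - by rewrite lerDl ler0n.
  - apply: continuous_subspaceW ch => s /=; rewrite !in_itv/= andbT => /andP[as_ _].
    exact: le_trans as_.
apply: (wiener_process_construction a0 (S := S)); last first.
  move=> t; apply: subspace_continuous_measurable_fun => //.
  apply: continuous_subspaceW ch => s /=; rewrite !in_itv/= andbT => /andP[as_ _].
  exact/ltW/(le_lt_trans a0).
- by move=> n; have [] := hS n.
- by move=> n; have [] := hS n.
- by move=> n; have [] := hS n.
Qed.

End Existence.

(** * Evolution of the standardized mean *)

Section Standardization.
Context {R : realType}.

(** Monotonicity of M / sqrt V. If m <= 0, a larger variance only helps. If
    m > 0, the growth of the denominator costs m (sqrt (v + dv) - sqrt v), which
    is at most m dv / (2 sqrt v) < sqrt v dv / 4 because m < v / 2; the gain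
    sqrt v dm is at least that much. *)
Lemma standardized_increase (m v dm dv : R) : 0 < v -> `|m| < v / 2 -> 0 < dv ->
  dv / 4 <= dm -> m / Num.sqrt v < (m + dm) / Num.sqrt (v + dv).
Proof.
move=> v0 mv dv0 dm4.
have vdv0 : 0 < v + dv by rewrite addr_gt0.
set s := Num.sqrt v; set s' := Num.sqrt (v + dv).
have s0 : 0 < s by rewrite sqrtr_gt0.
have s'0 : 0 < s' by rewrite sqrtr_gt0.
have sE : s * s = v by rewrite -expr2 sqr_sqrtr// ltW.
have s'E : s' * s' = v + dv by rewrite -expr2 sqr_sqrtr// ltW.
have ss' : s < s' by rewrite ltr_sqrt// ltrDl.
rewrite ltr_pdivrMr// mulrAC ltr_pdivlMr//.
have m_lt : m < s * s / 2 by rewrite sE; move: mv; rewrite ltr_norml => /andP[].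
have [m0|m0] := leP m 0; first by nra.
have ds : (s' - s) * (2 * s) <= dv by nra.
have : m * (s' - s) < s * (dv / 4).
  have : m * (s' - s) < s * s / 2 * (s' - s) by rewrite ltr_pM2r// subr_gt0.
  nra.
nra.
Qed.

End Standardization.

Section Integrals.
Context {R : realType}.
Local Notation leb := lebesgue_measure.

Lemma integrable_continuous (f : R -> R) (a b : R) :
  {within `[a, b]%classic, continuous f} -> leb.-integrable `[a, b]%classic (EFin \o f).
Proof.
move=> cf; apply: (@continuous_compact_integrable _ f) => //.
exact: segment_compact.
Qed.

Lemma integrable_scale (f : R -> R) (i : interval R) (k : R) :
  leb.-integrable [set` i] (EFin \o f) ->
  leb.-integrable [set` i] (EFin \o (fun s => k * f s)).
Proof.
have mi : measurable ([set` i] : set (measurableTypeR R)) by exact: measurable_itv.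
by move=> intf; have := integrableZl mi k intf.
Qed.

Lemma Rintegral_oo_gt0 (f : R -> R) (s t : R) : s < t ->
  {within `[s, t]%classic, continuous f} -> (forall r, s <= r <= t -> 0 < f r) ->
  0 < \int[leb]_(r in `]s, t[%classic) f r.
Proof.
move=> st cf f0; have [c cst_ hc] := EVT_min (ltW st) cf.
have c0 : 0 < f c by apply: f0; move: cst_; rewrite in_itv.
have sub : `]s, t[%classic `<=` `[s, t]%classic by exact: subset_itv_oo_cc.
apply: (@lt_le_trans _ _ (\int[leb]_(r in `]s, t[%classic) f c)).
  rewrite Rintegral_cst//= lebesgue_measure_itv/= lte_fin st/=.
  by rewrite mulr_gt0// subr_gt0.
apply: le_Rintegral => //.
- have ccst : {within `[s, t]%classic, continuous (cst (f c) : R -> R)}.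
    by move=> z; exact: cvg_cst.
  by apply: integrableS (integrable_continuous ccst).
- by apply: integrableS (integrable_continuous cf).
- by move=> r rst; apply: hc; exact: sub.
Qed.

End Integrals.

Section Dynamics.
Context {R : realType}.
Local Notation leb := lebesgue_measure.
Variables (t0 m0 v0 : R) (alpha1 alpha2 beta1 beta2 : R -> R) (p : R -> bool).
Hypothesis t0_ge0 : 0 <= t0.
Hypothesis v0_gt0 : 0 < v0.
Hypothesis m0_lt : `|m0| < v0 / 2.
Hypothesis calpha1 : {within `[0, +oo[%classic, continuous alpha1}.
Hypothesis calpha2 : {within `[0, +oo[%classic, continuous alpha2}.
Hypothesis cbeta1 : {within `[0, +oo[%classic, continuous beta1}.
Hypothesis cbeta2 : {within `[0, +oo[%classic, continuous beta2}.
Hypothesis alpha1_gt0 : forall t, t0 <= t -> 0 < alpha1 t.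
Hypothesis alpha2_gt0 : forall t, t0 <= t -> 0 < alpha2 t.
Hypothesis H1 : forall t, t0 <= t ->
  1 / 4 * alpha1 t ^+ 2 <= beta1 t <= 1 / 2 * alpha1 t ^+ 2.
Hypothesis H2 : forall t, t0 <= t ->
  - (1 / 2) * alpha2 t ^+ 2 <= beta2 t <= - (1 / 4) * alpha2 t ^+ 2.
Hypothesis mp : forall T, measurable_fun `[t0, T]%classic (fun s => (p s)%:R : R).

(** The variance rate and the drift of a solution that is in the first regime
    exactly at the times s with p s. *)
Definition regime_var s : R :=
  (p s)%:R * alpha1 s ^+ 2 + (~~ p s)%:R * alpha2 s ^+ 2.
Definition regime_drift s : R := (p s)%:R * beta1 s + (~~ p s)%:R * beta2 s.

Definition standardized_mean (t : R) : R :=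
  (m0 + \int[leb]_(s in `[t0, t]%classic) regime_drift s) /
  Num.sqrt (v0 + \int[leb]_(s in `[t0, t]%classic) regime_var s).
Local Notation g := standardized_mean.

Let cseg (f : R -> R) s t : t0 <= s -> {within `[0, +oo[%classic, continuous f} ->
  {within `[s, t]%classic, continuous f}.
Proof.
move=> t0s; apply: continuous_subspaceW => r /=.
by rewrite !in_itv/= andbT => /andP[+ _]; apply: le_trans; exact: le_trans t0s.
Qed.

Let sqr_continuous (f : R -> R) (A : set R) :
  {within A, continuous f} -> {within A, continuous (fun s => f s ^+ 2)}.
Proof.
move=> cf; rewrite (_ : (fun s => f s ^+ 2) = f \* f).
  by move=> x; apply: continuousM; exact: cf.
by apply/funext => s; rewrite expr2.
Qed.

Lemma integrable_regime (f1 f2 : R -> R) T :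
  {within `[t0, T]%classic, continuous f1} -> {within `[t0, T]%classic, continuous f2} ->
  leb.-integrable `[t0, T]%classic
    (EFin \o (fun s => (p s)%:R * f1 s + (~~ p s)%:R * f2 s)).
Proof.
move=> c1 c2.
have bnd (b : R -> bool) : [bounded (b s)%:R : R | s in `[t0, T]%classic].
  exists 1; split; first exact: num_real.
  by move=> M M1 s _ /=; case: (b s); rewrite ?normr1 ?normr0 ltW// (lt_trans _ M1).
pose D : set (measurableTypeR R) := `[t0, T]%classic.
have mD : measurable D by exact: measurable_itv.
have mnp : measurable_fun `[t0, T]%classic (fun s => (~~ p s)%:R : R).
  rewrite (_ : (fun s => _) = (fun s => 1 - (p s)%:R)).
    by apply: measurable_funB; [exact: measurable_cst|exact: mp].
  by apply/funext => s; case: (p s); rewrite ?subrr ?subr0.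
have i1 := @integrableMr _ (measurableTypeR R) R leb D mD _ _ (@mp T) (bnd _)
  (integrable_continuous c1).
have i2 := @integrableMr _ (measurableTypeR R) R leb D mD _ _ mnp (bnd _)
  (integrable_continuous c2).
have := integrableD mD i1 i2.
by apply: eq_integrable => // s _.
Qed.

Let ivar T : leb.-integrable `[t0, T]%classic (EFin \o regime_var).
Proof. by apply: integrable_regime; apply: sqr_continuous; exact: cseg. Qed.

Let idrift T : leb.-integrable `[t0, T]%classic (EFin \o regime_drift).
Proof. by apply: integrable_regime; exact: cseg. Qed.

Let regime_var_ge0 s : 0 <= regime_var s.
Proof. by rewrite addr_ge0// mulr_ge0// sqr_ge0. Qed.

Let V t := v0 + \int[leb]_(s in `[t0, t]%classic) regime_var s.
Let M t := m0 + \int[leb]_(s in `[t0, t]%classic) regime_drift s.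

Let V_gt0 t : 0 < V t.
Proof. by rewrite /V ltr_wpDr// Rintegral_ge0. Qed.

(* True at t0, and propagated because in both regimes the absolute value of the
   drift is at most half the variance rate. *)
Let M_lt t : `|M t| < V t / 2.
Proof.
rewrite /M /V mulrDl; apply: le_lt_trans (ler_normD _ _) _.
apply: ltr_leD => //.
apply: le_trans (le_normr_Rintegral _ (idrift t)) _ => //.
rewrite [leRHS]mulrC -RintegralZl//.
apply: le_Rintegral => //.
- exact: integrable_norm (idrift t).
- exact: integrable_scale.
move=> s /=; rewrite in_itv/= /regime_drift /regime_var => /andP[t0s _].
have /andP[h1 h2] := H1 t0s; have /andP[h3 h4] := H2 t0s.
have a1 := sqr_ge0 (alpha1 s); have a2 := sqr_ge0 (alpha2 s).
by case: (p s) => /=; rewrite !(mul0r, mul1r, add0r, addr0) ler_norml;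
  apply/andP; split; lra.
Qed.

Let increment (f : R -> R) s t : t0 <= s -> s < t ->
  (forall T, leb.-integrable `[t0, T]%classic (EFin \o f)) ->
  \int[leb]_(r in `[t0, t]%classic) f r =
  \int[leb]_(r in `[t0, s]%classic) f r + \int[leb]_(r in `]s, t[%classic) f r.
Proof.
move=> t0s st intf; apply/eqP; rewrite addrC -subr_eq; apply/eqP.
rewrite Rintegral_itvB// ?bnd_simp ?ltW//.
rewrite Rintegral_itv_bndo_bndc//; apply: integrableS (intf t) => //.
by apply: subset_itv; rewrite bnd_simp.
Qed.

Lemma standardized_mean_up s t : t0 <= s -> s < t ->
  (forall r, s < r < t -> p r) -> g s < g t.
Proof.
move=> t0s st hp.
have e (f1 f2 : R -> R) : \int[leb]_(r in `]s, t[%classic)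
    ((p r)%:R * f1 r + (~~ p r)%:R * f2 r) = \int[leb]_(r in `]s, t[%classic) f1 r.
  apply: eq_Rintegral => r; rewrite inE/= in_itv/= => /hp ->.
  by rewrite mul1r mul0r addr0.
have sub : `]s, t[%classic `<=` `[s, t]%classic by exact: subset_itv_oo_cc.
rewrite /standardized_mean (increment t0s st ivar) (increment t0s st idrift) !addrA.
have ca : {within `[s, t]%classic, continuous (fun r => alpha1 r ^+ 2)}.
  by apply: sqr_continuous; exact: cseg.
have ia : leb.-integrable `]s, t[%classic (EFin \o (fun r => alpha1 r ^+ 2)).
  by apply: integrableS (integrable_continuous ca).
apply: (standardized_increase (V_gt0 s) (M_lt s)).
  rewrite e; apply: Rintegral_oo_gt0 => // r /andP[sr _].
  by rewrite exprn_gt0// alpha1_gt0// (le_trans t0s).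
rewrite !e [leLHS]mulrC -RintegralZl//; apply: le_Rintegral => //.
- exact: integrable_scale.
- have cb : {within `[s, t]%classic, continuous beta1} by exact: cseg.
  by apply: integrableS (integrable_continuous cb).
move=> r /=; rewrite in_itv/= => /andP[sr _].
have /andP[h _] := H1 (le_trans t0s (ltW sr)); lra.
Qed.

Lemma standardized_mean_down s t : t0 <= s -> s < t ->
  (forall r, s < r < t -> ~~ p r) -> g t < g s.
Proof.
move=> t0s st hp.
have e (f1 f2 : R -> R) : \int[leb]_(r in `]s, t[%classic)
    ((p r)%:R * f1 r + (~~ p r)%:R * f2 r) = \int[leb]_(r in `]s, t[%classic) f2 r.
  apply: eq_Rintegral => r; rewrite inE/= in_itv/= => /hp np.
  by rewrite np (negbTE np) mul1r mul0r add0r.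
have sub : `]s, t[%classic `<=` `[s, t]%classic by exact: subset_itv_oo_cc.
rewrite /standardized_mean (increment t0s st ivar) (increment t0s st idrift) !addrA.
have ca : {within `[s, t]%classic, continuous (fun r => alpha2 r ^+ 2)}.
  by apply: sqr_continuous; exact: cseg.
have ia : leb.-integrable `]s, t[%classic (EFin \o (fun r => alpha2 r ^+ 2)).
  by apply: integrableS (integrable_continuous ca).
rewrite -ltrN2 -!mulNr [in X in _ < X]opprD.
have mN : `|- M s| < V s / 2 by rewrite normrN.
apply: (standardized_increase (V_gt0 s) mN).
  rewrite e; apply: Rintegral_oo_gt0 => // r /andP[sr _].
  by rewrite exprn_gt0// alpha2_gt0// (le_trans t0s).
rewrite !e [leLHS]mulrC -RintegralZl// lerNr -mulN1r -RintegralZl//; last first.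
  exact: integrable_scale.
apply: le_Rintegral => //.
- have cb : {within `[s, t]%classic, continuous beta2} by exact: cseg.
  by apply: integrableS (integrable_continuous cb).
- by do 2 apply: integrable_scale.
move=> r /=; rewrite in_itv/= => /andP[sr _].
have /andP[_ h] := H2 (le_trans t0s (ltW sr)); lra.
Qed.

Lemma standardized_mean_continuous T : t0 <= T ->
  {within `[t0, T]%classic, continuous g}.
Proof.
move=> t0T.
have cV := parameterized_integral_continuous t0T (ivar T).
have cM := parameterized_integral_continuous t0T (idrift T).
move=> x; apply: (@cvgM R); last first.
  apply: cvgV; first by rewrite gt_eqF// sqrtr_gt0 V_gt0.
  apply: continuous_cvg; first exact: sqrt_continuous.
  by apply: cvgD; [exact: cvg_cst|exact: cV].
by apply: cvgD; [exact: cvg_cst|exact: cM].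
Qed.

Lemma standardized_mean0 : g t0 = m0 / Num.sqrt v0.
Proof. by rewrite /standardized_mean set_itv1 !Rintegral_set1 !addr0. Qed.

End Dynamics.

(** * The regime never changes *)

Section Dichotomy.
Context {R : realType}.
Variables (t0 c0 : R) (g : R -> R) (p : R -> bool).
Hypothesis cg : forall T, t0 <= T -> {within `[t0, T]%classic, continuous g}.
Hypothesis g0 : g t0 = c0.
Hypothesis pE : forall t, t0 <= t -> p t = (c0 < g t).
Hypothesis up : forall s t, t0 <= s -> s < t ->
  (forall r, s < r < t -> p r) -> g s < g t.
Hypothesis down : forall s t, t0 <= s -> s < t ->
  (forall r, s < r < t -> ~~ p r) -> g t < g s.

(** Once above the level, g cannot come back: it increases up to the first
    return time. *)
Lemma first_regime_absorbing s t : t0 <= s -> s <= t -> p s -> p t.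
Proof.
move=> t0s st; have t0t := le_trans t0s st.
rewrite !pE// => gs; rewrite ltNge; apply/negP => gt.
pose A : set R := [set u | s <= u <= t /\ g u <= c0].
have At : A t by split; rewrite ?st ?lexx.
have lbA : lbound A s by move=> u [/andP[]].
have hasA : has_inf A by split; [exists t|exists s].
pose u := inf A.
have su : s <= u by apply: lb_le_inf => //; exists t.
have ut : u <= t by apply: inf_lbound => //; exists s.
have t0u := le_trans t0s su.
have gu : g u <= c0.
  rewrite leNgt; apply/negP => cu.
  have e0 : 0 < (g u - c0) / 2 by rewrite divr_gt0// subr_gt0.
  have Ku : `[t0, t]%classic u by rewrite /= in_itv/= t0u.
  have [r r0 hr] := within_continuous_dist (cg t0t) Ku e0.
  have [z Az zu] := inf_adherent r0 hasA.
  have uz : u <= z by apply: inf_lbound => //; exists s.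
  have [/andP[sz zt] gz] := Az.
  have : `|g u - g z| <= (g u - c0) / 2.
    apply: hr; first by rewrite /= in_itv/= (le_trans t0s).
    by rewrite distrC ger0_norm ?subr_ge0// ltrBlDl.
  by rewrite ler_norml => /andP[_]; lra.
have su' : s < u.
  by rewrite lt_neqAle su andbT; apply/eqP => su'; move: gs; rewrite su' ltNge gu.
have gsu : g s < g u.
  apply: up => // r /andP[sr ru]; rewrite pE ?(le_trans t0s (ltW sr))// ltNge.
  apply/negP => gr; suff : u <= r by rewrite leNgt ru.
  apply: inf_lbound; first by exists s.
  by split=> //; rewrite (ltW sr) (le_trans (ltW ru)).
by move: gs; rewrite ltNge (ltW (lt_le_trans gsu gu)).
Qed.

(** Suppose that p holds at some time and fails at an earlier time s > t0. By
    first_regime_absorbing p fails at all times before s, so g has decreased to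
    g s < g t0 and must cross the level again, at some u > s. There p fails, so
    the same argument gives g u < g t0, a contradiction. *)
Lemma regime_dichotomy :
  (forall t, t0 < t -> p t) \/ (forall t, t0 <= t -> ~~ p t).
Proof.
have [[t [t0t pt]]|none] := pselect (exists t, t0 <= t /\ p t); last first.
  by right => t t0t; apply/negP => pt; apply: none; exists t.
left=> s t0s; have [//|nps] := boolP (p s).
have st : s < t.
  rewrite ltNge; apply/negP => ts; move: nps.
  by rewrite (first_regime_absorbing t0t ts pt).
have before r : t0 <= r -> ~~ p r -> t0 < r -> g r < c0.
  move=> _ npr t0r; rewrite -g0; apply: down => // z /andP[t0z zr].
  apply/negP => pz; move/negP: npr; apply.
  exact: first_regime_absorbing (ltW t0z) (ltW zr) pz.
have gs := before s (ltW t0s) nps t0s.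
have gt : c0 < g t by rewrite -pE.
have csg : {within `[s, t]%classic, continuous g}.
  apply: continuous_subspaceW (cg t0t) => z /=; rewrite !in_itv/= => /andP[sz ->].
  by rewrite (le_trans (ltW t0s)).
have [|u] := IVT (v := c0) (ltW st) csg.
  by rewrite ge_min le_max (ltW gs) (ltW gt)/= orbT.
rewrite in_itv/= => /andP[su ut] gu.
have t0u : t0 < u by exact: lt_le_trans su.
have npu : ~~ p u by rewrite pE ?(ltW t0u)// gu ltxx.
by have := before u (ltW t0u) npu t0u; rewrite gu ltxx.
Qed.

End Dichotomy.

Section Paths.
Context {R : realType}.

(** The integral as a function of its upper end is known to be continuous on
    segments, whereas paths have to be continuous on a half-line. *)
Lemma continuous_from_segments (f : R -> R) (t0 : R) :
  (forall T, t0 <= T -> {within `[t0, T]%classic, continuous f}) ->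
  forall x, t0 <= x -> f @ within [set t | t0 <= t] (nbhs x) --> f x.
Proof.
move=> cf x t0x; apply/cvgrPdist_le => e e0.
have Kx : `[t0, x + 1]%classic x by rewrite /= in_itv/= t0x lerDl ler01.
have t0x1 : t0 <= x + 1 by rewrite (le_trans t0x)// lerDl ler01.
have [r r0 hr] := within_continuous_dist (cf _ t0x1) Kx e0.
exists (Num.min r 1) => /=; first by rewrite lt_min r0 ltr01.
move=> z; rewrite /= lt_min => /andP[xz xz1] t0z; apply: hr => //.
rewrite /= in_itv/= t0z/=; have := ler_norm (z - x); rewrite distrC; lra.
Qed.

Context {d : measure_display} {Omega : measurableType d}.
Variable P : probability Omega R.

Lemma time_intervaly (t0 : R) : time_interval t0 +oo%E = [set t | t0 <= t].
Proof.
by apply/seteqP; split => t; [case|move=> t0t; split => //; rewrite ltry].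
Qed.

(** Versions with continuous paths are compared at the countably many rational
    times. *)
Lemma continuous_versions_indistinguishable (t0 : R) (Y Z : R -> Omega -> R) :
  continuous_paths t0 +oo%E Y -> continuous_paths t0 +oo%E Z ->
  (forall t, t0 <= t -> {ae P, forall w, Y t w = Z t w}) ->
  indistinguishable P t0 +oo%E Y Z.
Proof.
move=> cY cZ YZ.
pose q n : R := let r := ratr (odflt 0 (unpickle n)) in if t0 <= r then r else t0.
have qt0 n : t0 <= q n by rewrite /q; case: ifPn.
have : {ae P, forall w, forall n, Y (q n) w = Z (q n) w}.
  by apply: ae_foralln => n; exact: YZ.
apply: filterS => w hw t [t0t _].
apply/eqP; rewrite -subr_eq0 -normr_le0 leNgt; apply/negP => e0.
set e := `|_| in e0; have e3 : 0 < e / 3 by rewrite divr_gt0.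
have At : time_interval t0 +oo%E t by rewrite time_intervaly.
have [r1 r10 h1] := within_continuous_dist (cY w) At e3.
have [r2 r20 h2] := within_continuous_dist (cZ w) At e3.
have tt : t < t + Num.min r1 r2 by rewrite ltrDl lt_min r10.
have [r] := rat_in_itvoo tt; rewrite in_itv/= => /andP[tr rt].
have t0r := le_trans t0t (ltW tr).
have Ar : time_interval t0 +oo%E (ratr r) by rewrite time_intervaly.
have dist : `|t - ratr r| < Num.min r1 r2.
  by rewrite distrC gtr0_norm ?subr_gt0// ltrBlDl.
move: dist; rewrite lt_min => /andP[d1 d2].
have {}h1 := h1 _ Ar d1; have {}h2 := h2 _ Ar d2.
have qr : q (pickle r) = ratr r by rewrite /q pickleK/= t0r.
have eq_r := hw (pickle r); rewrite qr in eq_r.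
have : e <= e / 3 + e / 3.
  rewrite {1}/e (_ : Y t w - Z t w = (Y t w - Y (ratr r) w) -
    (Z t w - Z (ratr r) w)); last by rewrite eq_r; ring.
  by apply: le_trans (ler_normB _ _) _; rewrite lerD.
lra.
Qed.

End Paths.

(** * Solutions of the equation *)

Section Probability.
Context {R : realType} {d : measure_display} {Omega : measurableType d}.
Variable P : probability Omega R.

Lemma ae_eq_prob (A A' : set Omega) : measurable A -> measurable A' ->
  {ae P, forall w, A w <-> A' w} -> P A = P A'.
Proof.
move=> mA mA' [N [mN PN sub]].
have le (C D : set Omega) : measurable C -> measurable D ->
    (forall w, ~ N w -> C w -> D w) -> (P C <= P D)%E.
  move=> mC mD CD; apply: (@le_trans _ _ (P (D `|` N))).
    apply: le_measure; rewrite ?inE//; first exact: measurableU.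
    by move=> w Cw; have [Nw|Nw] := pselect (N w); [right|left; exact: CD].
  have := measureU2 P mD mN; rewrite [X in (_ + X)%E]PN adde0; exact.
have NAA' w : ~ N w -> A w <-> A' w.
  by move=> Nw; apply: contrapT => h; apply: Nw; exact: sub.
by apply/le_anti/andP; split; apply: le => // w Nw /(NAA' w Nw).
Qed.

End Probability.

Section Solutions.
Context {R : realType} {d : measure_display} {Omega : measurableType d}.
Variable P : probability Omega R.
Variables (F : R -> set (set Omega)) (B : R -> Omega -> R).
Hypotheses (HF : usual_conditions P F) (HB : brownian_motion P F B).
Variables (t0 y : R) (alpha1 alpha2 beta1 beta2 : R -> R).
Hypothesis t0_ge0 : 0 <= t0.
Hypotheses (Halpha1 : continuous_bounded alpha1) (Halpha2 : continuous_bounded alpha2).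
Hypotheses (Hbeta1 : continuous_bounded beta1) (Hbeta2 : continuous_bounded beta2).
Variables (xi : Omega -> R) (mu0 m0 v0 : R).
Hypothesis mxi : rv_measurable (F t0) xi.
Hypothesis v0_gt0 : 0 < v0.
Hypothesis lxi : has_normal_law P xi (mu0 + m0) v0.
Hypothesis xi_y : P [set w | xi w <= mu0] = y%:E.
Hypothesis m0_lt : `|m0| < v0 / 2.
Hypothesis alpha1_gt0 : forall t, t0 <= t -> 0 < alpha1 t.
Hypothesis alpha2_gt0 : forall t, t0 <= t -> 0 < alpha2 t.
Hypothesis H1 : forall t, t0 <= t ->
  1 / 4 * alpha1 t ^+ 2 <= beta1 t <= 1 / 2 * alpha1 t ^+ 2.
Hypothesis H2 : forall t, t0 <= t ->
  - (1 / 2) * alpha2 t ^+ 2 <= beta2 t <= - (1 / 4) * alpha2 t ^+ 2.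
Implicit Type p : R -> bool.
Local Notation leb := lebesgue_measure.
Local Notation g p := (standardized_mean t0 m0 v0 alpha1 alpha2 beta1 beta2 p).
Local Notation solution :=
  (is_solution P F B t0 y alpha1 alpha2 beta1 beta2 xi mu0 +oo%E).

Let measurable_regime p := forall T : R,
  measurable_fun `[t0, T]%classic (fun s => (p s)%:R : R).

Let cseg (f : R -> R) (T : R) : continuous_bounded f ->
  {within `[t0, T]%classic, continuous f}.
Proof.
move=> [cf _]; apply: continuous_subspaceW cf => r /=.
by rewrite !in_itv/= andbT => /andP[+ _]; exact: le_trans.
Qed.

Let integrable_mix p (f1 f2 : R -> R) T : measurable_regime p ->
  continuous_bounded f1 -> continuous_bounded f2 ->
  leb.-integrable `[t0, T]%classic
    (EFin \o (fun s => (p s)%:R * f1 s + (~~ p s)%:R * f2 s)).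
Proof. by move=> mp c1 c2; apply: integrable_regime => //; exact: cseg. Qed.

Let cb0 : continuous_bounded (cst 0 : R -> R).
Proof.
split; first by move=> z; exact: cvg_cst.
by exists 0 => t _; rewrite normr0.
Qed.

Let cb_sqr (f : R -> R) : continuous_bounded f ->
  continuous_bounded (fun s => f s ^+ 2).
Proof.
move=> [cf [M hM]]; split.
  rewrite (_ : (fun s => f s ^+ 2) = f \* f).
    by move=> z; apply: continuousM; exact: cf.
  by apply/funext => s; rewrite expr2.
exists (M ^+ 2) => t t_ge0; rewrite normrX lerXn2r ?nnegrE ?hM//.
exact: le_trans (hM t t_ge0).
Qed.

Let cb_rate (f h : R -> R) : continuous_bounded f -> continuous_bounded h ->
  continuous_bounded (fun s => f s ^+ 2 + `|h s|).
Proof.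
move=> /cb_sqr[cf [M hM]] [ch [N hN]]; split.
  by move=> z; apply: cvgD; [exact: cf|apply: cvg_norm; exact: ch].
exists (M + N) => t t_ge0; apply: le_trans (ler_normD _ _) _.
by rewrite normr_id lerD ?hM ?hN.
Qed.

Let integrable_fst p (f : R -> R) T : measurable_regime p -> continuous_bounded f ->
  leb.-integrable `[t0, T]%classic (EFin \o (fun s => (p s)%:R * f s)).
Proof.
move=> mp cf; have := integrable_mix T mp cf cb0.
by apply: eq_integrable => // s _ /=; rewrite mulr0 addr0.
Qed.

Let integrable_snd p (f : R -> R) T : measurable_regime p -> continuous_bounded f ->
  leb.-integrable `[t0, T]%classic (EFin \o (fun s => (~~ p s)%:R * f s)).
Proof.
move=> mp cf; have := integrable_mix T mp cb0 cf.
by apply: eq_integrable => // s _ /=; rewrite mulr0 add0r.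
Qed.

Let integrable_measurable (f : R -> R) T :
  leb.-integrable `[t0, T]%classic (EFin \o f) ->
  measurable_fun `[t0, T]%classic f.
Proof. by move=> /(measurable_int _)/measurable_EFinP. Qed.

(* y is the value at -g(t0), the mean and variance at t0 being those of xi. *)
Let level0 : y = std_normal_cdf (- (m0 / Num.sqrt v0)).
Proof.
have := normal_law_cdf mu0 v0_gt0 lxi; rewrite xi_y => -[->].
by congr std_normal_cdf; rewrite opprD addrA subrr add0r mulNr.
Qed.

(** The one-dimensional laws depend on the regime only; this turns the equation
    into a condition on p alone. *)
Lemma regime_law p t (J Yt : Omega -> R) : measurable_regime p -> t0 <= t ->
  measurable_fun setT J -> measurable_fun setT Yt ->
  wiener_integral P F B t0 t
    (fun s => (p s)%:R * alpha1 s + (~~ p s)%:R * alpha2 s) J ->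
  {ae P, forall w, Yt w = xi w + J w +
     \int[leb]_(s in `[t0, t]%classic) regime_drift beta1 beta2 p s} ->
  fine (P [set w | Yt w <= mu0]) = std_normal_cdf (- g p t).
Proof.
move=> mp t0t mJ mY wJ YE.
set D := (\int[leb]_(s in _) _) in YE.
pose h s := (p s)%:R * alpha1 s + (~~ p s)%:R * alpha2 s.
have hE s : h s ^+ 2 = regime_var alpha1 alpha2 p s.
  by rewrite /h /regime_var; case: (p s); rewrite !(mul1r, mul0r, addr0, add0r).
pose V := \int[leb]_(s in `[t0, t]%classic) regime_var alpha1 alpha2 p s.
have ivar : leb.-integrable `[t0, t]%classic (EFin \o regime_var alpha1 alpha2 p).
  by apply: (integrable_mix (f1 := fun s => alpha1 s ^+ 2)
    (f2 := fun s => alpha2 s ^+ 2)) => //; exact: cb_sqr.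
have mh : measurable_fun `]t0, t]%classic h.
  apply: (@measurable_funS _ _ _ _ `[t0, t]%classic) => //.
    by apply: subset_itvr; rewrite bnd_simp.
  exact: (integrable_measurable (integrable_mix t mp Halpha1 Halpha2)).
have [_ [M1 hM1]] := Halpha1; have [_ [M2 hM2]] := Halpha2.
have hM s : t0 < s <= t -> `|h s| <= `|M1| + `|M2|.
  move=> /andP[t0s _]; have s0 := le_trans t0_ge0 (ltW t0s).
  have n1 := hM1 s s0; have n2 := hM2 s s0.
  have k1 := ler_norm M1; have k2 := ler_norm M2.
  have := normr_ge0 M1; have := normr_ge0 M2.
  by rewrite /h; case: (p s); rewrite !(mul1r, mul0r, addr0, add0r); lra.
have VE : (\int[leb]_(s in `]t0, t]%classic) (h s ^+ 2)%:E = V%:E)%E.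
  under eq_integral => s _ do rewrite hE.
  rewrite integral_itv_obnd_cbnd.
    by rewrite /V /Rintegral fineK//; exact: integrable_fin_num ivar.
  apply: (@measurable_funS _ _ _ _ `[t0, t]%classic) => //.
    by apply: subset_itvr; rewrite bnd_simp.
  exact: measurable_int ivar.
have cdfJ := wiener_integral_cdf HF HB (mu0 - D) t0_ge0 mxi v0_gt0 lxi mh hM VE mJ wJ.
rewrite (ae_eq_prob (A' := [set w | xi w + J w <= mu0 - D])).
- rewrite cdfJ /=; congr std_normal_cdf; rewrite /standardized_mean -/V -mulNr.
  by congr (_ / _); rewrite -/D; ring.
- exact: measurable_sublevel.
- apply: measurable_sublevel; apply: measurable_funD => //.
  exact: (adapted_measurable HF t0_ge0 mxi).
- by apply: filterS YE => w /= ->; rewrite lerBrDr.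
Qed.

Let consistent p t : measurable_regime p -> t0 <= t ->
  (std_normal_cdf (- g p t) < y) = (g p t0 < g p t).
Proof.
by move=> mp t0t; rewrite level0 std_normal_cdf_ltE ltrN2 standardized_mean0.
Qed.

(* A deterministic integrand is progressive if and only if it is measurable: pass
   to the section at a point. *)
Let progressive_section (h : R -> R) T : t0 <= T ->
  progressive F t0 +oo%E (fun s (_ : Omega) => h s) ->
  measurable_fun `[t0, T]%classic h.
Proof.
move=> t0T pr; have := pr T; rewrite time_intervaly => /(_ t0T) mh.
apply: (@measurable_comp _ _ _ _ _ _ (`[t0, T]%classic `*` setT)
  (fun q : measurableTypeR R * g_sigma_algebraType (F T) => h q.1) _
  (fun s : R => (s, point))) => //.
- by apply: measurableX => //; exact: measurable_itv.
- by move=> _ [s st <-]; split.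
- by apply: measurable_funTS; apply: measurable_fun_pair => //; exact: measurable_cst.
Qed.

Let section_progressive (h : R -> R) :
  (forall T, measurable_fun `[t0, T]%classic h) ->
  progressive F t0 +oo%E (fun s (_ : Omega) => h s).
Proof.
move=> mh t _; apply: (@measurable_comp _ _ _ _ _ _ `[t0, t]%classic h _ fst) => //.
- by move=> _ [q [qt _] <-].
- by apply: measurable_funTS; exact: measurable_fst.
Qed.

(** Since alpha1 is positive, the first regime can be read off the integrand of
    the first stochastic integral, which is progressive. *)
Lemma solution_regime_measurable Y : solution Y ->
  measurable_regime (fun s => prob_below P mu0 Y s < y).
Proof.
move=> [_ _ _ [I1 [I2 [[pr _ _ _] _ _]]]] T; pose p s := prob_below P mu0 Y s < y.
have [t0T|Tt0] := leP t0 T; last first.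
  rewrite (_ : `[t0, T]%classic = set0); first exact: measurable_fun_set0.
  apply/seteqP; split => s //=; rewrite in_itv/= => /andP[/le_trans h /h].
  by rewrite leNgt Tt0.
have mf := progressive_section t0T pr.
pose A := `[t0, T]%classic `&`
  (fun s => (p s)%:R * alpha1 s) @^-1` `]0, +oo[%classic.
have mA : measurable A by apply: mf; exact: measurable_itv.
apply: (@eq_measurable_fun _ _ _ _ _ (\1_A : R -> R)).
  move=> s; rewrite inE/= => sT; rewrite indicE -/(p s).
  have [ps|nps] := boolP (p s).
    rewrite mem_set//; split => //=; rewrite in_itv/= andbT ps mul1r alpha1_gt0//.
    by move: sT; rewrite in_itv/= => /andP[].
  by rewrite memNset// => -[_]; rewrite /= (negbTE nps) mul0r in_itv/= ltxx.
by apply: measurable_funTS; exact: measurable_indic.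
Qed.

(** The two stochastic integrals of a solution add up to the Wiener integral of
    the mixture, so its one-dimensional laws are known. *)
Lemma solution_cdf Y t : solution Y -> t0 <= t ->
  prob_below P mu0 Y t =
  std_normal_cdf (- g (fun s => prob_below P mu0 Y s < y) t).
Proof.
move=> solY t0t; have mp := solution_regime_measurable solY.
set p := (fun s => prob_below P mu0 Y s < y) in mp *.
have npE s : (y <= prob_below P mu0 Y s) = ~~ p s by rewrite leNgt.
have [aY _ _ [I1 [I2 [[pr1 aI1 _ w1] [pr2 aI2 _ w2] YE]]]] := solY.
have Tt : time_interval t0 +oo%E t by rewrite time_intervaly.
have t_ge0 := le_trans t0_ge0 t0t.
have mI1 := adapted_measurable HF t_ge0 (aI1 t Tt).
have mI2 := adapted_measurable HF t_ge0 (aI2 t Tt).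
have mY := adapted_measurable HF t_ge0 (aY t Tt).
have mh1 := progressive_section t0t pr1; have mh2 := progressive_section t0t pr2.
have W1 := ito_wiener HF HB t0_ge0 mh1 mI1 (w1 t Tt).
have W2 := ito_wiener HF HB t0_ge0 mh2 mI2 (w2 t Tt).
have sub : `]t0, t]%classic `<=` `[t0, t]%classic.
  by apply: subset_itvr; rewrite bnd_simp.
have mh1' := measurable_funS (measurable_itv _) sub mh1.
have mh2' := measurable_funS (measurable_itv _) sub mh2.
have W := wiener_linear HF HB 1 t0_ge0 mh1' mh2' mI1 mI2 W1 W2.
apply: (regime_law (p := p) (J := fun w => I1 t w + 1 * I2 t w)) => //.
- by apply: measurable_funD => //; exact: measurable_funM.
- by apply: eq_wiener_integral W => s _; rewrite mul1r npE.
apply: filterS YE => w /(_ t Tt) ->.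
rewrite /regime_drift RintegralD//; [|exact: integrable_fst|exact: integrable_snd].
have -> : \int[leb]_(s in `[t0, t]%classic) ((y <= prob_below P mu0 Y s)%R%:R * beta2 s) =
    \int[leb]_(s in `[t0, t]%classic) ((~~ p s)%:R * beta2 s).
  by apply: eq_Rintegral => s _; rewrite npE.
by rewrite mul1r; ring.
Qed.

(** Self-consistency of the regime of a solution, the hypothesis of the
    deterministic dichotomy. *)
Lemma solution_consistent Y t : solution Y -> t0 <= t ->
  (prob_below P mu0 Y t < y) =
  (g (fun s => prob_below P mu0 Y s < y) t0 <
   g (fun s => prob_below P mu0 Y s < y) t).
Proof.
move=> solY t0t; rewrite {1}(solution_cdf solY t0t).
by apply: consistent => //; exact: solution_regime_measurable.
Qed.

Lemma solution_dichotomy Y : solution Y ->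
  (forall t, t0 <= t -> (prob_below P mu0 Y t < y) = (t0 < t)) \/
  (forall t, t0 <= t -> (prob_below P mu0 Y t < y) = false).
Proof.
move=> solY; have mp := solution_regime_measurable solY.
have pE := fun t => @solution_consistent Y t solY.
set p := (fun s => prob_below P mu0 Y s < y) in mp pE.
have [cal1 _] := Halpha1; have [cal2 _] := Halpha2.
have [cbe1 _] := Hbeta1; have [cbe2 _] := Hbeta2.
have := @regime_dichotomy _ t0 (g p t0) (g p) p _ erefl pE _ _.
case.
- by move=> T t0T; exact: standardized_mean_continuous.
- by move=> s t; exact: standardized_mean_up.
- by move=> s t; exact: standardized_mean_down.
- move=> h; left => t; rewrite le_eqVlt => /predU1P[<-|t0t]; last by rewrite -/(p t) h// t0t.
  by rewrite [LHS]pE// !ltxx.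
- by move=> h; right => t t0t; apply/negbTE; exact: h.
Qed.

(** Solutions in the same regime at all times are driven by the same integrands,
    hence agree almost surely at every time. *)
Lemma solution_unique Y Z : solution Y -> solution Z ->
  (forall t, t0 <= t -> (prob_below P mu0 Y t < y) = (prob_below P mu0 Z t < y)) ->
  indistinguishable P t0 +oo%E Y Z.
Proof.
move=> solY solZ YZ.
have [_ cY _ [I1 [I2 [[pr1 aI1 _ w1] [pr2 aI2 _ w2] YE]]]] := solY.
have [_ cZ _ [J1 [J2 [[qr1 aJ1 _ u1] [qr2 aJ2 _ u2] ZE]]]] := solZ.
apply: continuous_versions_indistinguishable => // t t0t.
have Tt : time_interval t0 +oo%E t by rewrite time_intervaly.
have t_ge0 := le_trans t0_ge0 t0t.
have YZ' s : t0 <= s -> (y <= prob_below P mu0 Y s) = (y <= prob_below P mu0 Z s).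
  by move=> t0s; rewrite !leNgt YZ.
have unique h h' (I J : Omega -> R) :
    progressive F t0 +oo%E (fun s (_ : Omega) => h s) ->
    progressive F t0 +oo%E (fun s (_ : Omega) => h' s) ->
    (forall s, t0 <= s -> h s = h' s) ->
    rv_measurable (F t) I -> rv_measurable (F t) J ->
    is_ito_integral P F B t0 t (fun s _ => h s) I ->
    is_ito_integral P F B t0 t (fun s _ => h' s) J ->
    {ae P, forall w, I w = J w}.
  move=> pr pr' hh' mI mJ wI wJ.
  have {}mI := adapted_measurable HF t_ge0 mI.
  have {}mJ := adapted_measurable HF t_ge0 mJ.
  have mh := progressive_section t0t pr; have mh' := progressive_section t0t pr'.
  have W := ito_wiener HF HB t0_ge0 mh mI wI.
  have W' := ito_wiener HF HB t0_ge0 mh' mJ wJ.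
  apply: (wiener_integral_unique HF HB t0_ge0 _ mI mJ W).
    by apply: measurable_funS mh => //; apply: subset_itvr; rewrite bnd_simp.
  by apply: eq_wiener_integral W' => s /andP[t0s _]; rewrite hh'// ltW.
have e1 := unique _ _ _ _ pr1 qr1 (fun s t0s => congr1 (fun b : bool => b%:R * _) (YZ s t0s))
  (aI1 t Tt) (aJ1 t Tt) (w1 t Tt) (u1 t Tt).
have e2 := unique _ _ _ _ pr2 qr2 (fun s t0s => congr1 (fun b : bool => b%:R * _) (YZ' s t0s))
  (aI2 t Tt) (aJ2 t Tt) (w2 t Tt) (u2 t Tt).
apply: filterS2 (filterI YE ZE) (filterI e1 e2) => w.
move=> [/(_ t Tt) -> /(_ t Tt) ->] [-> ->].
congr (_ + (_ + _) + (_ + _)); apply: eq_Rintegral => s;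
  rewrite inE/= in_itv/= => /andP[t0s _]; [by rewrite YZ|by rewrite YZ'].
Qed.

(** A regime function that the dynamics it induces reproduces comes from a
    solution: the integrands are then known in advance, so the integrals can be
    formed first and the equation turned into a definition of Y.  The continuous
    k1, k2 stand for the two integrands off t0, where Wiener integrals do not
    see them. *)
Lemma solution_of_regime p (k1 k2 : R -> R) : measurable_regime p ->
  {within `[0, +oo[%classic, continuous k1} ->
  {within `[0, +oo[%classic, continuous k2} ->
  (forall s, t0 < s -> k1 s = (p s)%:R * alpha1 s) ->
  (forall s, t0 < s -> k2 s = (~~ p s)%:R * alpha2 s) ->
  (forall t, t0 <= t -> p t = (g p t0 < g p t)) ->
  exists2 Y, solution Y & forall t, t0 <= t -> (prob_below P mu0 Y t < y) = p t.
Proof.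
move=> mp ck1 ck2 k1E k2E pE.
have [I1 [aI1 cI1 w1]] := exists_wiener_process HF HB t0_ge0 ck1.
have [I2 [aI2 cI2 w2]] := exists_wiener_process HF HB t0_ge0 ck2.
pose D1 t := \int[leb]_(s in `[t0, t]%classic) ((p s)%:R * beta1 s).
pose D2 t := \int[leb]_(s in `[t0, t]%classic) ((~~ p s)%:R * beta2 s).
pose Y t w := xi w + (I1 t w + D1 t) + (I2 t w + D2 t).
have iD1 T := integrable_fst T mp Hbeta1.
have iD2 T := integrable_snd T mp Hbeta2.
have ge0 t : t0 <= t -> 0 <= t by exact: le_trans.
have aY : adapted F t0 +oo%E Y.
  move=> t Tt; have t0t : t0 <= t by case: Tt.
  have sG := filtration_sigma_algebra HF (ge0 _ t0t).
  apply: rv_measurableD => //; last first.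
    by apply: rv_measurableD => //; [exact: aI2|exact: rv_measurable_cst].
  apply: rv_measurableD => //.
    exact: (rv_measurableS (filtration_nondecreasing HF t0_ge0 t0t)).
  by apply: rv_measurableD => //; [exact: aI1|exact: rv_measurable_cst].
have W1 t : t0 <= t ->
    wiener_integral P F B t0 t (fun s => (p s)%:R * alpha1 s) (I1 t).
  by move=> t0t; apply: eq_wiener_integral (w1 t t0t) => s /andP[/k1E].
have W2 t : t0 <= t ->
    wiener_integral P F B t0 t (fun s => (~~ p s)%:R * alpha2 s) (I2 t).
  by move=> t0t; apply: eq_wiener_integral (w2 t t0t) => s /andP[/k2E].
have mh1 T := integrable_measurable (integrable_fst T mp Halpha1).
have mh2 T := integrable_measurable (integrable_snd T mp Halpha2).
have YE t : t0 <= t -> (prob_below P mu0 Y t < y) = p t.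
  move=> t0t; have Tt : time_interval t0 +oo%E t by rewrite time_intervaly.
  have mI1 := adapted_measurable HF (ge0 _ t0t) (aI1 t Tt).
  have mI2 := adapted_measurable HF (ge0 _ t0t) (aI2 t Tt).
  have mY := adapted_measurable HF (ge0 _ t0t) (aY t Tt).
  have sub : `]t0, t]%classic `<=` `[t0, t]%classic.
    by apply: subset_itvr; rewrite bnd_simp.
  have mh1' := measurable_funS (measurable_itv _) sub (mh1 t).
  have mh2' := measurable_funS (measurable_itv _) sub (mh2 t).
  have W := wiener_linear HF HB 1 t0_ge0 mh1' mh2' mI1 mI2 (W1 t t0t) (W2 t t0t).
  rewrite pE// -consistent//; congr (_ < y).
  apply: (regime_law (p := p) (J := fun w => I1 t w + 1 * I2 t w)) => //.
  - by apply: measurable_funD => //; exact: measurable_funM.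
  - by apply: eq_wiener_integral W => s _; rewrite mul1r.
  apply: aeW => w; rewrite /regime_drift RintegralD// mul1r /Y /D1 /D2; ring.
have YE' t : t0 <= t -> (y <= prob_below P mu0 Y t) = ~~ p t.
  by move=> t0t; rewrite leNgt YE.
exists Y => //; split => //.
- have cD f : (forall T, leb.-integrable `[t0, T]%classic (EFin \o f)) ->
      forall x, t0 <= x ->
        \int[leb]_(s in `[t0, t]%classic) f s @[t --> within [set t | t0 <= t] (nbhs x)]
          --> \int[leb]_(s in `[t0, x]%classic) f s.
    move=> fi; apply: continuous_from_segments => T t0T.
    exact: parameterized_integral_continuous t0T (fi T).
  move=> w; rewrite time_intervaly; apply/subspace_continuousP => x t0x.
  have cI I : continuous_paths t0 +oo%E I ->
      I t w @[t --> within [set t | t0 <= t] (nbhs x)] --> I x w.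
    by move=> /(_ w); rewrite time_intervaly => /subspace_continuousP; exact.
  apply: cvgD; first apply: cvgD; first exact: cvg_cst.
    by apply: cvgD; [exact: cI|exact: cD].
  by apply: cvgD; [exact: cI|exact: cD].
- move=> S t0S _.
  have := integrable_mix S mp (cb_rate Halpha1 Hbeta1) (cb_rate Halpha2 Hbeta2).
  apply: eq_integrable => // s; rewrite inE/= in_itv/= => /andP[t0s _].
  by rewrite YE// YE'.
exists I1, I2; split.
- split => //.
  + apply: section_progressive => T.
    apply: eq_measurable_fun (mh1 T) => s.
    by rewrite inE/= in_itv/= => /andP[/YE-> _].
  + move=> t Tt; have t0t : t0 <= t by case: Tt.
    apply: wiener_ito.
      by apply: eq_measurable_fun (mh1 t) => s; rewrite inE/= in_itv/= => /andP[/YE-> _].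
    by apply: eq_wiener_integral (W1 t t0t) => s /andP[/ltW/YE->].
- split => //.
  + apply: section_progressive => T.
    apply: eq_measurable_fun (mh2 T) => s.
    by rewrite inE/= in_itv/= => /andP[/YE'-> _].
  + move=> t Tt; have t0t : t0 <= t by case: Tt.
    apply: wiener_ito.
      by apply: eq_measurable_fun (mh2 t) => s; rewrite inE/= in_itv/= => /andP[/YE'-> _].
    by apply: eq_wiener_integral (W2 t t0t) => s /andP[/ltW/YE'->].
apply: aeW => w t Tt; have t0t : t0 <= t by case: Tt.
rewrite /Y /D1 /D2; congr (_ + (_ + _) + (_ + _)); apply: eq_Rintegral => s;
  rewrite inE/= in_itv/= => /andP[t0s _]; [by rewrite YE|by rewrite YE'].
Qed.

(** In the first regime after t0 the standardized mean exceeds its initial value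
    from then on; at t0 itself it equals it, so the regime starts after t0. *)
Lemma exists_increasing_solution : exists2 Y, solution Y &
  forall t, t0 <= t -> (prob_below P mu0 Y t < y) = (t0 < t).
Proof.
pose p s := t0 < s.
have mp : measurable_regime p.
  move=> T; apply: measurable_funTS.
  apply: (@eq_measurable_fun _ _ _ _ _ (\1_`]t0, +oo[%classic : R -> R)).
    move=> s _; rewrite indicE /p; congr (_%:R).
    by rewrite mem_setE/= in_itv/= andbT.
  by apply: measurable_indic; exact: measurable_itv.
have [[cal1 _] [cal2 _]] := (Halpha1, Halpha2).
have [[cbe1 _] [cbe2 _]] := (Hbeta1, Hbeta2).
apply: (solution_of_regime (p := p) (k1 := alpha1) (k2 := cst 0)) => //.
- exact: cb0.1.
- by move=> s ts; rewrite /p ts mul1r.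
- by move=> s ts; rewrite /p ts mul0r.
move=> t; rewrite le_eqVlt => /predU1P[<-|t0t]; first by rewrite /p !ltxx.
rewrite /p t0t; apply/esym; apply: standardized_mean_up => //.
by move=> r /andP[].
Qed.

(** In the second regime from t0 on, the standardized mean stays below its initial
    value, so this regime is never left. *)
Lemma exists_decreasing_solution : exists2 Y, solution Y &
  forall t, t0 <= t -> (prob_below P mu0 Y t < y) = false.
Proof.
have mp : measurable_regime (fun=> false).
  by move=> T; exact: measurable_cst.
have [[cal1 _] [cal2 _]] := (Halpha1, Halpha2).
have [[cbe1 _] [cbe2 _]] := (Hbeta1, Hbeta2).
apply: (solution_of_regime (p := fun=> false) (k1 := cst 0) (k2 := alpha2)) => //.
- exact: cb0.1.
- by move=> s ts; rewrite mul0r.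
- by move=> s ts; rewrite mul1r.
move=> t; rewrite le_eqVlt => /predU1P[<-|t0t]; first by rewrite ltxx.
apply/esym/negbTE; rewrite -leNgt ltW//.
by apply: standardized_mean_down.
Qed.

End Solutions.

Theorem proposition2 (R : realType) (d : measure_display)
  (Omega : measurableType d) (P : probability Omega R)
  (F : R -> set (set Omega)) (B : R -> Omega -> R)
  (HF : usual_conditions P F) (HB : brownian_motion P F B)
  (t0 y : R) (Ht0 : 0 <= t0) (Hy : 0 < y < 1)
  (alpha1 alpha2 beta1 beta2 : R -> R)
  (Halpha1_ge0 : forall t : R, 0 <= t -> 0 <= alpha1 t)
  (Halpha2_ge0 : forall t : R, 0 <= t -> 0 <= alpha2 t)
  (Halpha1 : continuous_bounded alpha1) (Halpha2 : continuous_bounded alpha2)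
  (Hbeta1 : continuous_bounded beta1) (Hbeta2 : continuous_bounded beta2)
  (xi : Omega -> R) (mu0 mut0 var0 vart0 : R)
  (Hxi : rv_measurable (F t0) xi)
  (Hvar0 : 0 < var0) (Hvart0 : 0 <= vart0)
  (Hmut0 : `|mut0| <= 1 / 2 * vart0)
  (Hxi_law : has_normal_law P xi (mu0 + mut0) (var0 + vart0))
  (Hxi_y : P [set w | xi w <= mu0] = y%:E)
  (H1 : forall t : R, t0 <= t ->
     1 / 4 * alpha1 t ^+ 2 <= beta1 t <= 1 / 2 * alpha1 t ^+ 2)
  (H2 : forall t : R, t0 <= t ->
     - (1 / 2) * alpha2 t ^+ 2 <= beta2 t <= - (1 / 4) * alpha2 t ^+ 2)
  (H1_strict : (forall t : R, t0 <= t -> 1 / 4 * alpha1 t ^+ 2 < beta1 t) \/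
               (forall t : R, t0 <= t -> beta1 t < 1 / 2 * alpha1 t ^+ 2))
  (H2_strict : (forall t : R, t0 <= t -> - (1 / 2) * alpha2 t ^+ 2 < beta2 t) \/
               (forall t : R, t0 <= t -> beta2 t < - (1 / 4) * alpha2 t ^+ 2)) :
  let solution := is_solution P F B t0 y alpha1 alpha2 beta1 beta2 xi mu0 +oo%E
  in
  exists Y1 Y2 : R -> Omega -> R,
    [/\ solution Y1, solution Y2,
        ~ indistinguishable P t0 +oo%E Y1 Y2 &
        forall Y, solution Y ->
          indistinguishable P t0 +oo%E Y Y1 \/
          indistinguishable P t0 +oo%E Y Y2].
Proof.
move=> solution.
have alpha_gt0 (al be : R -> R) (c1 c2 : R) :
    (forall t, 0 <= t -> 0 <= al t) ->
    (forall t, t0 <= t -> c1 * al t ^+ 2 <= be t <= c2 * al t ^+ 2) ->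
    (forall t, t0 <= t -> c1 * al t ^+ 2 < be t) \/
    (forall t, t0 <= t -> be t < c2 * al t ^+ 2) ->
    forall t, t0 <= t -> 0 < al t.
  move=> al_ge0 albe strict t t0t; rewrite lt0r al_ge0 ?(le_trans Ht0)// andbT.
  apply/eqP => al0; have := albe t t0t.
  by case: strict => /(_ t t0t); rewrite al0 expr0n/= !mulr0 => lt0 /andP[]; lra.
have al1 := alpha_gt0 _ _ _ _ Halpha1_ge0 H1 H1_strict.
have al2 := alpha_gt0 _ _ _ _ Halpha2_ge0 H2 H2_strict.
have v0_gt0 : 0 < var0 + vart0 by lra.
have m0_lt : `|mut0| < (var0 + vart0) / 2 by lra.
have [Y1 sol1 Y1E] := exists_increasing_solution HF HB Ht0 Halpha1 Halpha2
  Hbeta1 Hbeta2 Hxi v0_gt0 Hxi_law Hxi_y m0_lt al1 H1 H2.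
have [Y2 sol2 Y2E] := exists_decreasing_solution HF HB Ht0 Halpha1 Halpha2
  Hbeta1 Hbeta2 Hxi v0_gt0 Hxi_law Hxi_y m0_lt al2 H1 H2.
exists Y1, Y2; split => //; last first.
  move=> Y solY.
  have [YE|YE] := solution_dichotomy HF HB Ht0 Halpha1 Halpha2
    Hbeta1 Hbeta2 Hxi v0_gt0 Hxi_law Hxi_y m0_lt al1 al2 H1 H2 solY; [left|right].
    by apply: (solution_unique HF HB Ht0 solY sol1) => t t0t; rewrite YE// Y1E.
  by apply: (solution_unique HF HB Ht0 solY sol2) => t t0t; rewrite YE// Y2E.
move=> Y12.
have t0t : t0 <= t0 + 1 by rewrite lerDl.
have Tt : time_interval t0 +oo%E (t0 + 1) by rewrite time_intervaly.
have mle Y : solution Y -> measurable [set w | Y (t0 + 1) w <= mu0].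
  move=> [aY _ _ _]; apply: measurable_sublevel.
  exact: (adapted_measurable HF (le_trans Ht0 t0t) (aY _ Tt)).
have := Y1E _ t0t; rewrite ltrDl ltr01 /prob_below.
rewrite (ae_eq_prob (mle _ sol1) (mle _ sol2)); last first.
  by apply: filterS Y12 => w /(_ _ Tt) /= ->.
by rewrite -/(prob_below P mu0 Y2 (t0 + 1)) Y2E.
Qed.
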